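(* Suppose $Z\in L^2(\Omega\times[0,\infty))$ is predictable with respect to the augmented Brownian filtration $(\mathcal{F}_t)_{t\in[0,\infty)}$, and, for every $n\in\mathbb{N}$, $Z^n\in L^2_n(\Omega\times\mathbb{N})$ is predictable with respect to $(\mathcal{F}^n_i)_{i\in\mathbb{N}}$. Then the following are equivalent: (i) $(Z^n_{\lceil n\cdot\rceil})_{n\in\mathbb{N}}$ converges to $Z$ strongly (resp. weakly) in $L^2(\Omega\times[0,\infty))$. (ii) The sequence of discrete It\^o integrals $\left(\int Z^n\,dB^n\right)_{n\in\mathbb{N}}$ converges strongly (resp. weakly) in $L^2(\Omega,\mathcal{F},P)$ to $\int_0^\infty Z_s\,dB_s$.
   Context: Setting: $(\Omega,\mathcal{F},P)$ is a probability space carrying a Brownian motion $B=(B_t)_{t\ge 0}$, where $\mathcal{F}$ is the $\sigma$-field generated by $B$, completed by null sets; $(\mathcal{F}_t)_{t\ge0}$ is the augmented filtration generated by $B$. $\xi$ is a square-integrable random variable with zero expectation and variance one. For each $n\in\mathbb{N}=\{1,2,\dots\}$, $(\xi^n_i)_{i\in\mathbb{N}}$ is a sequence of independent random variables on $(\Omega,\mathcal{F},P)$ with the same distribution as $\xi$, and $B^n_t=\frac{1}{\sqrt n}\sum_{i=1}^{\lfloor nt\rfloor}\xi^n_i$. Standing assumption: for every $t\ge 0$, $B^n_t\to B_t$ in probability as $n\to\infty$. $\mathcal{F}^n=\sigma(\xi^n_i, i\in\mathbb{N})$, $\mathcal{F}^n_i=\sigma(\xi^n_1,\dots,\xi^n_i)$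 ($\mathcal{F}^n_0$ trivial). $L^2(\Omega\times[0,\infty))$ is taken with respect to $\mathcal{F}\otimes\mathcal{B}([0,\infty))$ and $P\otimes\lambda$, $\lambda$ Lebesgue measure. $L^2_n(\Omega\times\mathbb{N})$ is the space of $Z^n:\mathbb{N}\to L^2(\Omega,\mathcal{F}^n,P)$ with $\frac1n\sum_{i\ge1}\mathbb{E}[(Z^n_i)^2]<\infty$; convention $Z^n_0=0$; $Z^n_{\lceil n\cdot\rceil}$ denotes $t\mapsto Z^n_{\lceil nt\rceil}$. $Z^n$ is predictable with respect to $(\mathcal{F}^n_i)_{i\in\mathbb{N}}$ if $Z^n_i$ is $\mathcal{F}^n_{i-1}$-measurable for every $i\in\mathbb{N}$; in that case the discrete It\^o integral is $\int Z^n\,dB^n:=\sum_{i=1}^\infty Z^n_i\frac{\xi^n_i}{\sqrt n}$ (convergent in $L^2(\Omega,\mathcal{F},P)$). *)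

(* Defs.v *)
From HB Require Import structures.
From mathcomp Require Import all_boot all_order all_algebra.
From mathcomp Require Import all_classical all_reals all_analysis.

Set Implicit Arguments.
Unset Strict Implicit.
Unset Printing Implicit Defensive.
Import Order.TTheory GRing.Theory Num.Theory.
Import numFieldNormedType.Exports.
Local Open Scope classical_set_scope.
Local Open Scope ring_scope.

(* Time and sequence indices are encoded as follows: a
   process indexed by [0, +oo[ is a function on R of which only the values at
   nonnegative times are used, and a sequence indexed by {1, 2, ...} is a
   function on nat whose value at 0 is not used.  Random variables and processes
   are representatives of their almost-everywhere classes. *)

Section L2.
Context {d : measure_display} {T : measurableType d} {R : realType}.
Variables (mu : {measure set T -> \bar R}) (D : set T).

(* Elements of L^2(D, mu) are handled through representatives; values outside
   of D are discarded by the restriction f \_ D. *)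
Definition in_L2 (f : T -> R) : Prop := (f \_ D) \in Lfun mu 2%:E.

Definition L2_cvg (f_ : nat -> T -> R) (f : T -> R) : Prop :=
  'N[mu]_2%:E[EFin \o ((f_ n \- f)%R \_ D)]%E @[n --> \oo] --> 0%E.

(* Continuous linear functionals on L^2 are the inner products with elements
   of L^2. *)
Definition L2_weak_cvg (f_ : nat -> T -> R) (f : T -> R) : Prop :=
  forall g : T -> R, in_L2 g ->
    (\int[mu]_(x in D) (f_ n x * g x))%R @[n --> \oo]
      --> (\int[mu]_(x in D) (f x * g x))%R.

End L2.

Section probability.
Context {d : measure_display} {T : measurableType d} {R : realType}.
Variable P : probability T R.

Definition cvg_in_probability (X_ : nat -> T -> R) (X : T -> R) : Prop :=
  forall e : R, 0 < e ->
    P [set w | e <= `|X_ n w - X w|] @[n --> \oo] --> 0%E.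

Definition mutually_independent (I : choiceType) (X : I -> T -> R) : Prop :=
  forall (s : seq I) (A : I -> set R), uniq s ->
    (forall i, measurable (A i)) ->
    P (\bigcap_(i in [set` s]) (X i @^-1` A i)) =
      (\prod_(i <- s) P (X i @^-1` A i))%E.

Definition same_distribution (X Y : {RV P >-> R}) : Prop :=
  forall A : set R, measurable A -> distribution P X A = distribution P Y A.

Definition completion (G : set (set T)) : set (set T) :=
  [set A | exists A0 N, [/\ G A0, G N, P N = 0%E & A `+` A0 `<=` N]].

End probability.

(* f is measurable on D with respect to the sigma-algebra G of subsets of D. *)
Definition measurable_wrt {U : Type} {d' : measure_display}
    {V : measurableType d'} (D : set U) (G : set (set U)) (f : U -> V) : Prop :=
  preimage_set_system D f measurable `<=` G.

Section brownian.
Context {d : measure_display} {T : measurableType d} {R : realType}.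
Variables (P : probability T R) (B : R -> {RV P >-> R}).

Definition brownian_motion : Prop :=
  [/\ {ae P, forall w, B 0 w = 0},
      {ae P, forall w, {within `[0, +oo[, continuous (fun t => B t w)}},
      (forall (m : nat) (t : nat -> R), 0 <= t 0%N ->
         {homo t : i j / (i <= j)%N >-> i <= j} ->
         mutually_independent P
           (fun i : 'I_m => fun w => B (t i.+1) w - B (t i) w)) &
      (forall s t : R, 0 <= s -> s < t -> forall A : set R, measurable A ->
         P ((fun w => B t w - B s w) @^-1` A)
           = normal_prob 0 (Num.sqrt (t - s)) A)].

Definition brownian_sigma_algebra : set (set T) :=
  <<s \bigcup_(s in `[0, +oo[) g_sigma_algebra_preimage (B s) >>.

Definition augmented_filtration (t : R) : set (set T) :=
  <<s (\bigcup_(s in `[0, t]) g_sigma_algebra_preimage (B s))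
      `|` P.-negligible >>.

Definition time_space : set (T * measurableTypeR R) := [set: T] `*` `[0, +oo[.

Definition time_measure : {measure set (T * measurableTypeR R) -> \bar R} :=
  (P \x lebesgue_measure)%E.

Definition predictable_rectangles : set (set (T * measurableTypeR R)) :=
  [set C | exists A, augmented_filtration 0 A /\ C = A `*` [set 0]] `|`
  [set C | exists A s t, [/\ 0 <= s, s <= t, augmented_filtration s A &
                             C = A `*` `]s, t]]].

Definition predictable (Z : T * measurableTypeR R -> R) : Prop :=
  measurable_wrt time_space <<s time_space, predictable_rectangles >> Z.

(* The process \sum_(j < m) a j * 1_(]t j, t j.+1]). *)
Record step_process := StepProcess {
  step_size : nat ;
  step_time : nat -> R ;
  step_coef : nat -> T -> R }.

Definition simple_predictable (H : step_process) : Prop :=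
  [/\ 0 <= step_time H 0,
      (forall j, (j < step_size H)%N -> step_time H j <= step_time H j.+1),
      (forall j, (j < step_size H)%N ->
         measurable_wrt setT (augmented_filtration (step_time H j))
           (step_coef H j)) &
      (forall j, (j < step_size H)%N ->
         exists M : R, forall w, `|step_coef H j w| <= M)].

Definition step_value (H : step_process) (x : T * measurableTypeR R) : R :=
  \sum_(j < step_size H)
    step_coef H j x.1 * \1_(`]step_time H j, step_time H j.+1]) x.2.

Definition step_integral (H : step_process) (w : T) : R :=
  \sum_(j < step_size H)
    step_coef H j w * (B (step_time H j.+1) w - B (step_time H j) w).

(* I is a version of \int_0^oo Z_s dB_s; it is unique up to almost sure
   equality by the Ito isometry. *)
Definition ito_integral (Z : T * measurableTypeR R -> R) (I : T -> R) : Prop :=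
  in_L2 P setT I /\
  exists H : nat -> step_process,
    [/\ (forall k, simple_predictable (H k)),
        L2_cvg time_measure time_space (fun k => step_value (H k)) Z &
        L2_cvg P setT (fun k => step_integral (H k)) I].

End brownian.

Section random_walk.
Context {d : measure_display} {T : measurableType d} {R : realType}.
Variables (P : probability T R) (n : nat) (xi : nat -> {RV P >-> R}).

Definition random_walk (t : R) (w : T) : R :=
  (Num.sqrt n%:R)^-1 * \sum_(1 <= i < (Num.truncn (n%:R * t)).+1) xi i w.

Definition walk_sigma_algebra : set (set T) :=
  <<s \bigcup_(j in [set j | (1 <= j)%N]) g_sigma_algebra_preimage (xi j) >>.

Definition walk_filtration (i : nat) : set (set T) :=
  <<s \bigcup_(j in [set j | (1 <= j <= i)%N])
        g_sigma_algebra_preimage (xi j) >>.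

(* Z 0 = 0 is the convention extending Z from {1, 2, ...} to nat. *)
Definition in_discrete_L2 (Z : nat -> T -> R) : Prop :=
  [/\ Z 0%N = cst 0,
      (forall i, (1 <= i)%N ->
         in_L2 P setT (Z i) /\ measurable_wrt setT walk_sigma_algebra (Z i)) &
      ((n%:R^-1)%:E * \sum_(1 <= i <oo) 'E_P[(fun w => (Z i w ^+ 2)%R)] < +oo)%E].

Definition discrete_predictable (Z : nat -> T -> R) : Prop :=
  forall i, (1 <= i)%N -> measurable_wrt setT (walk_filtration i.-1) (Z i).

(* I is a version of \int Z dB^n, the L^2-limit of the partial sums. *)
Definition discrete_ito_integral (Z : nat -> T -> R) (I : T -> R) : Prop :=
  in_L2 P setT I /\
  L2_cvg P setT
    (fun N w => \sum_(1 <= i < N.+1) Z i w * (xi i w / Num.sqrt n%:R)) I.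

(* The absolute value only converts the ceiling to nat: it is used for
   nonnegative times. *)
Definition ceil_process (Z : nat -> T -> R) (x : T * measurableTypeR R) : R :=
  Z `|Num.ceil (n%:R * x.2)|%N x.1.

End random_walk.

(* Main.v *)
Require Import Defs.
From HB Require Import structures.
From mathcomp Require Import all_boot all_order all_algebra.
From mathcomp Require Import all_classical all_reals all_analysis.
From mathcomp Require Import measurable_realfun.
From mathcomp Require Import ring lra.

Set Implicit Arguments.
Unset Strict Implicit.
Unset Printing Implicit Defensive.
Import Order.TTheory GRing.Theory Num.Theory.
Import numFieldNormedType.Exports.
Local Open Scope classical_set_scope.
Local Open Scope ring_scope.

(** Both stochastic integrals are isometries. Strong convergence is weak
    convergence together with convergence of the norms ([strong_weakP]), and
    the norms of the integrand and of the integral agree, for every n and in the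
    limit. It is therefore enough to transfer weak convergence in both directions.

    The bridge between the discrete and the continuous world is the relation
    [limit_pair H G]: up to any error, the pair (H, G) of an integrand and a
    random variable is approximated, for all large n, by a discrete predictable
    integrand and its integral with respect to the n-th walk. Limit pairs form a
    closed linear space, and the isometry passes to it. By polarisation,
    pairing a bounded sequence of discrete integrals X_n with G is asymptotically
    the same as pairing their integrands with H ([limit_pair_transfer]). The pair
    (Z, I) of the theorem is itself a limit pair ([ito_limit_pair]): for
    a cos(phi + sum_k mu_k B_(t_k)) with all t_k <= s, the elementary integral
    over ]s, t] is the limit of its discrete counterpart, because the walk converges
    to B in L^2 ([cvg_random_walk]); a monotone class argument then reaches all
    bounded F_s-measurable coefficients, hence all simple predictable processes,
    hence Z.

    The second ingredient is a family of discrete martingales whose limits are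
    total in L^2. For a step function g = sum_k mu_k 1_([0, t_k]), the products
    M^n_j = Re (e^(i phi) prod_(i <= j) (1 + i g(i/n) xi^n_i / sqrt n)) are
    martingales of the n-th walk, are their own integrands up to a factor and a
    phase shift ([wick_phase_integral]), and converge at the time t of the walk,
    in L^2, to exp(q/2) cos(phi + sum_k mu_k B_(t_k)) where q is the squared norm
    of g ([cvg_walk_wick]). This convergence follows from two numbers only:
    the second moment of the product tends to exp q, and its correlation with
    exp(i sum_k mu_k B^n_(t_k)) is by independence a product of
    E[(1 + i x) e^(-i x)] = 1 + x^2/2 + ..., which tends to exp(q/2).

    Since t |-> M^n varies little over short time intervals, the integrand
    M^n_(j-1) 1_(j <= nt) is close to one that is constant on finitely many
    blocks, and this has a limit pair ([wick_process_approx]). Two consequences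
    follow. First, the limits of M^n are approximated by constants plus second
    components of limit pairs ([wick_limit_approx]); so if the integrands converge
    weakly, the integrals converge when tested against all
    cos(phi + sum_k mu_k B_(t_k)), and these are total in L^2 because the
    sigma-field is the completion of that generated by B ([weak_walk_of_ceil]).
    Second, since M^n is a martingale, testing a discrete integrand against
    M^n_T 1_(]0, t]) is the same as testing it against M^n_(j-1) 1_(j <= nt), which
    is nearly the first component of a limit pair ([wick_tensor_approx]); so if
    the integrals converge weakly, the integrands converge when tested against
    A 1_(]0, t]) for bounded A ([weak_tensor]), and such products are total
    ([tensor_tests_weak]). In both cases totality suffices because a weakly
    convergent sequence is bounded ([L2_weak_cvg_bounded]). *)

(** * Inner product and norm of square-integrable functions *)

Section L2_geometry.
Context {d : measure_display} {T : measurableType d} {R : realType}.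
Variables (mu : {measure set T -> \bar R}) (D : set T).
Hypothesis mD : measurable D.
Implicit Types (f g h : T -> R).

(** Working with honest functions and a real-valued norm, instead of classes
    modulo null sets, keeps sums, products and restrictions pointwise. *)
Definition sqint f : Prop :=
  measurable_fun D f /\ mu.-integrable D (EFin \o (fun x => f x ^+ 2)).

Definition L2inner f g : R := (\int[mu]_(x in D) (f x * g x))%R.

Local Notation ip := L2inner.

Definition L2norm f : R := Num.sqrt (ip f f).

Local Notation nrm := L2norm.

Lemma sqint_integrableM f g : sqint f -> sqint g ->
  mu.-integrable D (EFin \o (fun x => f x * g x)).
Proof.
move=> [mf f2] [mg g2].
apply: (@le_integrable _ _ _ mu D mD _
  ((EFin \o (fun x => f x ^+ 2)%R) \+ (EFin \o (fun x => g x ^+ 2)%R))%E).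
- by apply/measurable_EFinP; exact: measurable_funM.
- move=> x Dx /=; rewrite lee_fin normrM.
  rewrite (ger0_norm (addr_ge0 (sqr_ge0 _) (sqr_ge0 _))).
  rewrite -(real_normK (num_real (f x))) -(real_normK (num_real (g x))).
  have : 0 <= (`|f x| - `|g x|) ^+ 2 by exact: sqr_ge0.
  have := normr_ge0 (f x); have := normr_ge0 (g x).
  move: `|f x| `|g x| => a b; nra.
- exact: integrableD.
Qed.

Lemma sqint0 : sqint 0.
Proof.
split; first exact: measurable_cst.
apply: (eq_integrable mD (cst 0%E)); last exact: integrable0.
by move=> x _ /=; rewrite expr0n.
Qed.

Lemma sqintD f g : sqint f -> sqint g -> sqint (f + g).
Proof.
move=> sf sg; have ifg := sqint_integrableM sf sg.
case: (sf) (sg) => mf f2 [mg g2]; split; first exact: measurable_funD.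
apply: (eq_integrable mD (((EFin \o (fun x => f x ^+ 2)%R) \+
  (fun x => 2%:E * (EFin \o (fun x => f x * g x)%R) x)) \+
  (EFin \o (fun x => g x ^+ 2)%R))%E).
  by move=> x _ /=; rewrite sqrrD -!EFinD mulr_natl.
by apply: integrableD => //; apply: integrableD => //; exact: integrableZl.
Qed.

Lemma sqintZ (c : R) f : sqint f -> sqint (fun x => c * f x).
Proof.
move=> [mf f2]; split; first exact: measurable_funM.
apply: (eq_integrable mD
  (fun x => (c ^+ 2)%:E * (EFin \o (fun x => f x ^+ 2)%R) x)%E).
  by move=> x _ /=; rewrite exprMn.
exact: integrableZl.
Qed.

Lemma sqintN f : sqint f -> sqint (- f).
Proof.
move=> /(sqintZ (-1)); rewrite (_ : (fun x => -1 * f x) = - f)//.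
by apply/funext => x; rewrite mulN1r.
Qed.

Lemma sqintB f g : sqint f -> sqint g -> sqint (f - g).
Proof. by move=> sf /sqintN; exact: sqintD. Qed.

Lemma sqint_sum (J : Type) (s : seq J) (p : pred J) (F : J -> T -> R) :
  (forall i, p i -> sqint (F i)) -> sqint (\sum_(i <- s | p i) F i).
Proof.
move=> sF; elim/big_ind : _ => //; [exact: sqint0|exact: sqintD].
Qed.

Lemma ipC f g : ip f g = ip g f.
Proof. by apply: eq_Rintegral => x _; rewrite mulrC. Qed.

Lemma ip_ge0 f : 0 <= ip f f.
Proof. by apply: Rintegral_ge0 => x _; rewrite -expr2 sqr_ge0. Qed.

Lemma ipDl f g h : sqint f -> sqint g -> sqint h ->
  ip (f + g) h = ip f h + ip g h.
Proof.
move=> sf sg sh; rewrite /L2inner -RintegralD//; try exact: sqint_integrableM.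
by apply: eq_Rintegral => x _; rewrite mulrDl.
Qed.

Lemma ipZl (c : R) f g : sqint f -> sqint g ->
  ip (fun x => c * f x) g = c * ip f g.
Proof.
move=> sf sg; rewrite /L2inner -RintegralZl//; try exact: sqint_integrableM.
by apply: eq_Rintegral => x _; rewrite mulrA.
Qed.

Lemma ipNl f g : sqint f -> sqint g -> ip (- f) g = - ip f g.
Proof.
move=> sf sg; rewrite -[RHS]mulN1r -ipZl//; apply: eq_Rintegral => x _.
by rewrite mulN1r.
Qed.

Lemma ipBl f g h : sqint f -> sqint g -> sqint h ->
  ip (f - g) h = ip f h - ip g h.
Proof. by move=> sf sg sh; rewrite ipDl ?ipNl//; exact: sqintN. Qed.

Lemma ipDr f g h : sqint f -> sqint g -> sqint h ->
  ip h (f + g) = ip h f + ip h g.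
Proof. by move=> *; rewrite ipC ipDl// ![ip _ h]ipC. Qed.

Lemma ipBr f g h : sqint f -> sqint g -> sqint h ->
  ip h (f - g) = ip h f - ip h g.
Proof. by move=> *; rewrite ipC ipBl// ![ip _ h]ipC. Qed.

Lemma ipZr (c : R) f g : sqint f -> sqint g ->
  ip g (fun x => c * f x) = c * ip g f.
Proof. by move=> *; rewrite ipC ipZl// ipC. Qed.

Lemma nrm_ge0 f : 0 <= nrm f. Proof. exact: sqrtr_ge0. Qed.

Lemma nrm_sqr f : nrm f ^+ 2 = ip f f.
Proof. by rewrite sqr_sqrtr// ip_ge0. Qed.

(** The discriminant of t |-> |f - t g|^2 is nonpositive; when |g| = 0 the value of t
    makes the linear term outweigh |f|^2. *)
Lemma ip_sqr_le f g : sqint f -> sqint g ->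
  ip f g ^+ 2 <= ip f f * ip g g.
Proof.
move=> sf sg.
have quad t : 0 <= ip f f - 2 * t * ip f g + t ^+ 2 * ip g g.
  have sh : sqint (fun x => t * g x) by exact: sqintZ.
  have := ip_ge0 (f - (fun x => t * g x)).
  rewrite ipBl ?ipBr//; last exact: sqintB.
  rewrite !(ipZl, ipZr)// (ipC g f) => H; apply: (le_trans H); lra.
have := ip_ge0 g; rewrite le_eqVlt => /orP[/eqP g0|g0].
  have [->|fg0] := eqVneq (ip f g) 0.
    by rewrite expr2 mul0r mulr_ge0// ip_ge0.
  have := quad ((ip f f + 1) / (2 * ip f g)).
  rewrite -g0 mulr0 addr0.
  rewrite (_ : 2 * _ * _ = ip f f + 1); last by field.
  lra.
have := quad (ip f g / ip g g).
rewrite (_ : _ + _ = ip f f - ip f g ^+ 2 / ip g g); last by field; rewrite gt_eqF.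
by rewrite subr_ge0 ler_pdivrMr.
Qed.

Lemma ip_le f g : sqint f -> sqint g -> `|ip f g| <= nrm f * nrm g.
Proof.
move=> sf sg; rewrite -sqrtr_sqr -sqrtrM ?ip_ge0//.
by rewrite ler_wsqrtr// ip_sqr_le.
Qed.

Lemma nrmD f g : sqint f -> sqint g -> nrm (f + g) <= nrm f + nrm g.
Proof.
move=> sf sg; rewrite -(@ler_pXn2r _ 2)// ?nnegrE ?addr_ge0 ?nrm_ge0//.
have sfg := sqintD sf sg.
rewrite nrm_sqr ipDl// !ipDr// (ipC g f) sqrrD !nrm_sqr.
by have := le_trans (ler_norm _) (ip_le sf sg); lra.
Qed.

Lemma nrmZ (c : R) f : sqint f -> nrm (fun x => c * f x) = `|c| * nrm f.
Proof.
move=> sf; rewrite /L2norm ipZl ?ipZr//; last exact: sqintZ.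
by rewrite mulrA -expr2 sqrtrM ?sqr_ge0// sqrtr_sqr.
Qed.

Lemma nrmN f : nrm (- f) = nrm f.
Proof.
by congr Num.sqrt; apply: eq_Rintegral => x _; rewrite mulrNN.
Qed.

Lemma nrm_distC f g : nrm (f - g) = nrm (g - f).
Proof. by rewrite -nrmN opprB. Qed.

Lemma nrmB f g : sqint f -> sqint g -> nrm (f - g) <= nrm f + nrm g.
Proof. by move=> sf sg; rewrite -(nrmN g); apply: nrmD => //; exact: sqintN. Qed.

Lemma nrm_dist_trans f g h : sqint f -> sqint g -> sqint h ->
  nrm (f - h) <= nrm (f - g) + nrm (g - h).
Proof.
move=> sf sg sh; rewrite -[f - h](subrKA g) nrmD//; exact: sqintB.
Qed.

Lemma nrm_lip f g : sqint f -> sqint g -> `|nrm f - nrm g| <= nrm (f - g).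
Proof.
move=> sf sg; rewrite ler_norml; apply/andP; split.
  rewrite lerNl opprB lerBlDr nrm_distC -{1}[g](subrK f).
  by apply: nrmD => //; exact: sqintB.
by rewrite lerBlDr -{1}[f](subrK g); apply: nrmD => //; exact: sqintB.
Qed.

Lemma nrm0 : nrm 0 = 0.
Proof.
rewrite /L2norm /L2inner (@eq_Rintegral _ _ _ mu D (cst 0)) ?Rintegral_cst ?mul0r ?sqrtr0//.
by move=> x _; rewrite mul0r.
Qed.

Lemma nrm_sum (J : Type) (s : seq J) (p : pred J) (F : J -> T -> R) :
  (forall i, p i -> sqint (F i)) ->
  nrm (\sum_(i <- s | p i) F i) <= \sum_(i <- s | p i) nrm (F i).
Proof.
move=> sF; elim: s => [|i s IH]; first by rewrite !big_nil nrm0.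
rewrite !big_cons; case: ifP => pi //.
apply: le_trans (nrmD _ _) _; [exact: sF|exact: sqint_sum|].
by rewrite lerD2l.
Qed.

Lemma eq_sqint f g : {in D, f =1 g} -> sqint f -> sqint g.
Proof.
move=> fg [mf f2]; split; first exact: eq_measurable_fun mf.
by apply: (eq_integrable mD _ _ _ f2) => x Dx /=; rewrite fg.
Qed.

Lemma eq_nrm f g : {in D, f =1 g} -> nrm f = nrm g.
Proof.
by move=> fg; congr Num.sqrt; apply: eq_Rintegral => x Dx; rewrite fg.
Qed.

Lemma sqint_le f g : measurable_fun D f -> sqint g ->
  (forall x, D x -> `|f x| <= `|g x|) -> sqint f /\ nrm f <= nrm g.
Proof.
move=> mf [mg g2] fg.
have fg2 x : D x -> f x ^+ 2 <= g x ^+ 2.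
  by move=> Dx; rewrite -(real_normK (num_real (f x))) -(real_normK (num_real (g x))) ler_sqr// fg.
have f2 : mu.-integrable D (EFin \o (fun x => f x ^+ 2)).
  apply: le_integrable g2 => //.
  - by apply/measurable_EFinP; exact: measurable_funX.
  - by move=> x Dx /=; rewrite lee_fin !ger0_norm ?sqr_ge0// fg2.
split; first by [].
by apply: ler_wsqrtr; apply: le_Rintegral.
Qed.

Lemma nrm_sqrE f : sqint f ->
  ((nrm f ^+ 2)%:E = \int[mu]_(x in D) (f x ^+ 2)%:E)%E.
Proof.
move=> [mf f2]; rewrite nrm_sqr /L2inner /Rintegral fineK; first by [].
exact: integrable_fin_num.
Qed.

Lemma sqint_int_le f (c : R) : measurable_fun D f ->
  (\int[mu]_(x in D) (f x ^+ 2)%:E <= c%:E)%E ->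
  sqint f /\ nrm f ^+ 2 <= c.
Proof.
move=> mf fc.
have sf : sqint f.
  split=> //; apply/integrableP; split.
    by apply/measurable_EFinP; exact: measurable_funX.
  apply: le_lt_trans (ltry c); apply: le_trans fc.
  by under eq_integral do rewrite /= ger0_norm ?sqr_ge0//.
by split=> //; rewrite -lee_fin nrm_sqrE.
Qed.

End L2_geometry.

(** * Convergence in L^2 *)

Section L2_convergence.
Context {d : measure_display} {T : measurableType d} {R : realType}.
Variables (mu : {measure set T -> \bar R}) (D : set T).
Hypothesis mD : measurable D.
Implicit Types (f g h : T -> R).
Local Notation sqint := (sqint mu D).
Local Notation ip := (L2inner mu D).
Local Notation nrm := (L2norm mu D).

Lemma Lnorm2_nrm f : sqint f ->
  ('N[mu]_2%:E[EFin \o (f \_ D)] = (nrm f)%:E)%E.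
Proof.
move=> sf; rewrite unlock /Lnorm.
rewrite (_ : (\int[mu]_x _)%E = ((nrm f ^+ 2)%:E)); last first.
  rewrite nrm_sqrE// [in RHS]integral_mkcond; apply: eq_integral => x _ /=.
  rewrite powR_mulrn// real_normK ?num_real// !patchE.
  by case: ifP => // _; rewrite expr0n.
by rewrite poweR_EFin powR12_sqrt ?sqr_ge0// sqrtr_sqr ger0_norm ?nrm_ge0.
Qed.

Lemma in_L2P f : in_L2 mu D f <-> sqint f.
Proof.
split=> [fL|sf].
  have mf : measurable_fun D f.
    apply/(measurable_restrictT _ mD).
    by move: fL; rewrite /in_L2 inE => /andP[]; rewrite inE.
  split=> //.
  apply/(integrable_mkcond _ mD).
  apply: (eq_integrable measurableT _ _ _ (Lfun2_integrable_sqr fL)).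
  move=> x _ /=; rewrite !patchE; case: ifP => //= _.
  by rewrite expr0n.
rewrite /in_L2 inE; apply/andP; split; rewrite inE/=.
  by apply/(measurable_restrictT _ mD); case: sf.
by rewrite /finite_norm Lnorm2_nrm// ltry.
Qed.

(** The term of index 0 is arbitrary, hence the restriction to n >= 1 here and in
    all statements about sequences of square-integrable functions below. *)
Lemma L2_cvgP (f_ : nat -> T -> R) f :
  (forall n, (1 <= n)%N -> sqint (f_ n)) -> sqint f ->
  L2_cvg mu D f_ f <-> nrm (f_ n - f) @[n --> \oo] --> 0.
Proof.
move=> sf_ sf.
have E : \forall n \near \oo,
    ('N[mu]_2%:E[EFin \o ((f_ n \- f)%R \_ D)] = (nrm (f_ n - f))%:E)%E.
  near=> n; rewrite -(Lnorm2_nrm (f := f_ n - f)) => //.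
  by apply: sqintB => //; apply: sf_; near: n; exact: nbhs_infty_ge.
rewrite /L2_cvg; split=> H.
- have H' : ((nrm (f_ n - f))%:E @[n --> \oo] --> 0%:E)%E.
    by apply: cvg_trans H; apply: near_eq_cvg; near=> n; rewrite -(near E n).
  exact: fine_cvg H'.
- have H' : ((nrm (f_ n - f))%:E @[n --> \oo] --> 0%:E)%E.
    by apply: cvg_EFin => //; exact: nearW.
  apply: cvg_trans H'; apply: near_eq_cvg; near=> n.
  by rewrite (near E n).
Unshelve. all: by end_near.
Qed.

Lemma nrm_cvg0_sqr (h_ : nat -> T -> R) :
  ip (h_ n) (h_ n) @[n --> \oo] --> (0 : R) -> nrm (h_ n) @[n --> \oo] --> (0 : R).
Proof.
move=> H; rewrite -[X in _ --> X]sqrtr0.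
by apply: continuous_cvg => //; exact: sqrt_continuous.
Qed.

(** The dominating function also dominates the limit, which is needed because
    the limit is not assumed square-integrable in [sqint_dominated]. *)
Lemma ae_le_lim (u_ : nat -> T -> R) f g :
  {ae mu, forall x, D x -> u_ n x @[n --> \oo] --> f x} ->
  {ae mu, forall x n, D x -> `|u_ n x| <= g x} ->
  {ae mu, forall x, D x -> `|f x| <= g x}.
Proof.
move=> cf fg; apply: filterS2 cf fg => x cfx fgx Dx.
apply: (ler_cvg_to (cvg_norm (cfx Dx)) (cvg_cst (g x))).
by apply: nearW => n; exact: fgx.
Qed.

(** Dominated convergence for (f_n - f)^2, with dominating function 4 g^2. *)
Lemma sqint_dominated (f_ : nat -> T -> R) f g :
  (forall n, measurable_fun D (f_ n)) -> measurable_fun D f -> sqint g ->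
  {ae mu, forall x, D x -> f_ n x @[n --> \oo] --> f x} ->
  {ae mu, forall x n, D x -> `|f_ n x| <= g x} ->
  sqint f /\ nrm (f_ n - f) @[n --> \oo] --> 0.
Proof.
move=> mf_ mf [mg g2] cf fg.
have fg' := ae_le_lim cf fg.
split.
  split=> //.
  have [] // := @dominated_convergence _ _ _ mu D mD
    (fun n x => (f_ n x ^+ 2)%:E) (fun x => (f x ^+ 2)%:E)
    (EFin \o (fun x => g x ^+ 2)).
  - by move=> n; apply/measurable_EFinP; exact: measurable_funX.
  - by apply/measurable_EFinP; exact: measurable_funX.
  - apply: filterS cf => x cfx Dx; apply: cvg_EFin; first exact: nearW.
    by rewrite expr2 /=; apply: cvgM; exact: cfx.
  - apply: filterS fg => x fgx n Dx /=; rewrite lee_fin ger0_norm ?sqr_ge0//.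
    have h := fgx n Dx; have h0 : 0 <= g x by exact: le_trans h.
    by rewrite -(real_normK (num_real (f_ n x))) ler_sqr ?nnegrE.
apply: nrm_cvg0_sqr.
suff H : (\int[mu]_(x in D) ((f_ n - f) x * (f_ n - f) x)%:E)%E @[n --> \oo]
    --> 0%:E by exact: fine_cvg H.
rewrite -[X in _ --> X](integral0 mu D).
have [] // := @dominated_convergence _ _ _ mu D mD
    (fun n x => ((f_ n - f) x * (f_ n - f) x)%:E) (cst 0%E)
    (fun x => 4%:E * (EFin \o (fun x => (g x ^+ 2)%R)) x)%E.
- by move=> n; apply/measurable_EFinP; apply: measurable_funM;
    exact: measurable_funB.
- apply: filterS cf => x cfx Dx; apply: cvg_EFin; first exact: nearW.
  rewrite -[X in _ --> X](mulr0 (f x - f x)) /=.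
  apply: cvgM; first by apply: cvgB; [exact: cfx|exact: cvg_cst].
  by rewrite -[X in _ --> X](subrr (f x)); apply: cvgB; [exact: cfx|exact: cvg_cst].
- exact: integrableZl.
- apply: filterS2 fg fg' => x fgx fgx' n Dx /=.
  rewrite -EFinM lee_fin ger0_norm -?expr2 ?sqr_ge0//.
  have := fgx n Dx; have := fgx' Dx.
  rewrite !ler_norml => /andP[? ?] /andP[? ?].
  rewrite (_ : 4 * g x ^+ 2 = (2 * g x) ^+ 2); last by ring.
  have h0 : 0 <= 2 * g x by lra.
  rewrite -(real_normK (num_real ((f_ n - f) x))) ler_sqr ?nnegrE//.
  rewrite (_ : (f_ n - f) x = f_ n x - f x)// ler_norml.
  by apply/andP; split; lra.
Qed.

End L2_convergence.

(** * Completeness of L^2 *)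

Section L2_completeness.
Context {d : measure_display} {T : measurableType d} {R : realType}.
Variables (mu : {measure set T -> \bar R}) (D : set T).
Hypothesis mD : measurable D.
Implicit Types (f g h : T -> R).
Local Notation sqint := (sqint mu D).
Local Notation nrm := (L2norm mu D).

Lemma sqint_norm f : sqint f -> sqint (fun x => `|f x|).
Proof.
move=> sf; have [] // := @sqint_le _ _ _ mu D mD (fun x => `|f x|) f.
- by case: sf => mf _; exact: measurableT_comp.
- by move=> x _; rewrite normr_id.
Qed.

Lemma nrm_norm f : nrm (fun x => `|f x|) = nrm f.
Proof.
congr Num.sqrt; apply: eq_Rintegral => x _.
by rewrite -normrM ger0_norm// -expr2 sqr_ge0.
Qed.

(** Riesz-Fischer for absolutely summable series: the monotone limit L of the
    squared sums of |f_(k+1) - f_k| is integrable, hence finite almost everywhere;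
    there the series converges, dominated by |f_0| + sqrt L. *)
Lemma L2_summable_cvg (f_ : nat -> T -> R) (c : R) :
  (forall k, sqint (f_ k)) ->
  (forall N, \sum_(k < N) nrm (f_ k.+1 - f_ k) <= c) ->
  exists f, sqint f /\ nrm (f_ n - f) @[n --> \oo] --> 0.
Proof.
move=> sf_ fc.
have sh k : sqint (f_ k.+1 - f_ k) by exact: sqintB.
pose G N : T -> R := (\sum_(k < N) (fun x => `|(f_ k.+1 - f_ k) x|))%R.
have GE N x : G N x = \sum_(k < N) `|(f_ k.+1 - f_ k) x| by rewrite /G fct_sumE.
have sG N : sqint (G N) by apply: sqint_sum => // k _; exact: sqint_norm.
have G0 N x : 0 <= G N x by rewrite GE sumr_ge0.
have Gnd x : {homo (fun N => G N x) : n m / (n <= m)%N >-> n <= m}.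
  apply/nondecreasing_seqP => n; rewrite !GE big_ord_recr/=.
  by rewrite lerDl.
have nG N : nrm (G N) <= c.
  apply: le_trans (fc N); apply: le_trans (nrm_sum _ _ _) _ => //.
    by move=> k _; exact: sqint_norm.
  by apply: ler_sum => k _; rewrite nrm_norm.
pose L x := ereal_sup (range (fun N => (G N x ^+ 2)%:E)).
have G2nd x : nondecreasing_seq (fun N => (G N x ^+ 2)%:E).
  by move=> n m nm; rewrite lee_fin lerXn2r ?nnegrE// Gnd.
have Llim x : (G N x ^+ 2)%:E @[N --> \oo] --> L x.
  exact: ereal_nondecreasing_cvgn.
have mG2 N : measurable_fun D (fun x => (G N x ^+ 2)%:E).
  by apply/measurable_EFinP/measurable_funX; case: (sG N).
have mL : measurable_fun D L.
  by apply: (emeasurable_fun_cvg _ _ mG2) => x _; exact: Llim.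
have L0 x : (0 <= L x)%E.
  apply: le_trans (ereal_sup_ubound _); last by exists 0%N => //.
  by rewrite lee_fin sqr_ge0.
have intL : (\int[mu]_(x in D) L x <= (c ^+ 2)%:E)%E.
  have := @cvg_monotone_convergence _ _ _ mu D mD _ mG2
    (fun n x _ => sqr_ge0 (G n x)) (fun x _ => @G2nd x).
  rewrite (@eq_integral _ _ _ mu D L); last first.
    by move=> x _; apply/cvg_lim => //; exact: Llim.
  move=> H; apply: (cvge_le _ H); apply: nearW => N /=.
  rewrite -nrm_sqrE// lee_fin lerXn2r ?nnegrE ?nrm_ge0//.
  by rewrite (le_trans _ (nG N))// nrm_ge0.
have iL : mu.-integrable D L.
  apply/integrableP; split => //; apply: le_lt_trans (ltry (c ^+ 2)).
  by apply: le_trans intL; under eq_integral do rewrite gee0_abs//.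
(* off E the sequence is replaced by 0, which makes the limit measurable *)
pose E := D `&` [set x | L x \is a fin_num].
have mE : measurable E by exact: emeasurable_fin_num.
have LG x n : L x \is a fin_num -> G n x <= Num.sqrt (fine (L x)).
  move=> fL; rewrite -[leLHS]ger0_norm// -sqrtr_sqr ler_wsqrtr//.
  by rewrite -lee_fin fineK//; apply: ereal_sup_ubound; exists n.
have cvf x : L x \is a fin_num -> cvgn (fun n => f_ n x).
  move=> fL.
  have : cvgn [normed series (fun k => (f_ k.+1 - f_ k) x)].
    apply: nondecreasing_is_cvgn.
      apply/nondecreasing_seqP => n /=; rewrite seriesSr.
      by rewrite lerDl.
    exists (Num.sqrt (fine (L x))) => _ [n _ <-].
    by rewrite /= seriesEord /= -GE; exact: LG.
  move=> /normed_cvg /cvg_ex[/= l Hl].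
  apply/cvg_ex; exists (f_ 0%N x + l).
  have -> : (fun n => f_ n x) =
    (fun n => f_ 0%N x + series (fun k => (f_ k.+1 - f_ k) x) n).
    apply/funext => n.
    rewrite /series/= (telescope_sumr (fun k => f_ k x))//.
    by rewrite addrC subrK.
  by apply: cvgD; first exact: cvg_cst.
pose f x := limn (fun n => f_ n x * \1_E x).
have cvE x : L x \is a fin_num -> D x -> f_ n x @[n --> \oo] --> f x.
  move=> fL Dx.
  rewrite /f (_ : (fun n => f_ n x * \1_E x) = f_ ^~ x); first exact: cvf.
  by apply/funext => n; rewrite indicE mem_set ?mulr1.
have mf : measurable_fun D f.
  apply: (measurable_fun_cvg (h := fun n x => f_ n x * \1_E x)).
    move=> n; apply: measurable_funM; first by case: (sf_ n).
    exact: measurable_indic.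
  move=> x Dx; have [fL|fL] := boolP (L x \is a fin_num).
    have cvE' := cvE x fL Dx; rewrite (_ : (fun n => f_ n x * \1_E x) = f_ ^~ x)//.
    by apply/funext => n; rewrite indicE mem_set ?mulr1.
  rewrite /f (_ : (fun n => f_ n x * \1_E x) = cst 0).
    by rewrite lim_cst//; exact: cvg_cst.
  apply/funext => n; rewrite indicE memNset ?mulr0// => -[_] /=; exact/negP.
pose g0 x := Num.sqrt (fine (L x)).
have sg0 : sqint g0.
  split.
    apply: measurableT_comp.
      exact: continuous_measurable_fun (@sqrt_continuous R).
    exact: measurableT_comp.
  apply: (eq_integrable mD (fun x => (fine (L x))%:E)).
    by move=> x _ /=; rewrite sqr_sqrtr// fine_ge0.
  apply: le_integrable iL => //.
    by apply/measurable_EFinP; exact: measurableT_comp.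
  by move=> x _ /=; case: (L x) => //=; rewrite normr0 leey.
exists f.
have [] // := @sqint_dominated _ _ _ mu D mD f_ f ((fun x => `|f_ 0%N x|) + g0).
- by move=> n; case: (sf_ n).
- by apply: sqintD => //; exact: sqint_norm.
- by apply: filterS (integrable_ae mD iL) => x fL Dx; apply: cvE => //; exact: fL.
- apply: filterS (integrable_ae mD iL) => x fL n Dx.
  have -> : f_ n x = f_ 0%N x + \sum_(0 <= k < n) (f_ k.+1 x - f_ k x).
    by rewrite (telescope_sumr (fun k => f_ k x))// addrC subrK.
  apply: le_trans (ler_normD _ _) _; rewrite /GRing.add/= lerD2l.
  apply: le_trans (LG _ n (fL Dx)); rewrite GE big_mkord.
  exact: ler_norm_sum.
Qed.

End L2_completeness.

(** * Uniform boundedness of weakly convergent sequences *)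

Section uniform_boundedness.
Context {d : measure_display} {T : measurableType d} {R : realType}.
Variables (mu : {measure set T -> \bar R}) (D : set T).
Hypothesis mD : measurable D.
Implicit Types (f g h : T -> R).
Local Notation sqint := (sqint mu D).
Local Notation ip := (L2inner mu D).
Local Notation nrm := (L2norm mu D).

(** Only the divergence of (4/3)^k is needed, in a form that is explicit in k. *)
Lemma bernoulli_ineq (k : nat) : 1 + k%:R / 3 <= (4 / 3 : R) ^+ k.
Proof.
elim: k => [|k IH]; first by rewrite expr0 mul0r addr0.
rewrite exprS -natr1; have : (0 : R) <= k%:R by [].
by move: IH; move: (_ ^+ k) (k%:R : R) => a b; nra.
Qed.

(** Gliding hump: if |f_(n_k)| > 4^k, a series of the unit vectors
    +- f_(n_k) / |f_(n_k)| with coefficients 3^-k, whose signs are chosen one after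
    the other so that nothing cancels, pairs with f_(n_k) to at least (4/3)^k / 2. *)
Lemma L2_uniform_bounded (f_ : nat -> T -> R) :
  (forall n, (1 <= n)%N -> sqint (f_ n)) ->
  (forall g, sqint g -> exists M : R, forall n, (1 <= n)%N -> `|ip (f_ n) g| <= M) ->
  exists C : R, forall n, (1 <= n)%N -> nrm (f_ n) <= C.
Proof.
move=> sf_ bf; apply: contrapT => /forallNP unb.
have /choice[N HN] : forall k, exists n, (1 <= n)%N /\ (4 : R) ^+ k < nrm (f_ n).
  move=> k; have := unb (4 ^+ k) => /existsNP[n /not_implyP[n1 /negP]].
  by rewrite -ltNge => ?; exists n.
pose F k := f_ (N k).
have sF k : sqint (F k) by apply: sf_; case: (HN k).
have nF k : 0 < nrm (F k).
  by apply: le_lt_trans (HN k).2; rewrite exprn_ge0.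
pose q k : R := 3^-1 ^+ k.
have q0 k : 0 < q k by rewrite exprn_gt0.
have qS k : q k.+1 = q k / 3 by rewrite /q exprS mulrC.
pose e k : T -> R := (fun x => q k / nrm (F k) * F k x).
have se k : sqint (e k) by exact: sqintZ.
have ne k : nrm (e k) = q k.
  by rewrite nrmZ// ger0_norm ?divr_ge0 ?nrm_ge0 ?ltW// divfK// gt_eqF.
have ipe k : ip (F k) (e k) = q k * nrm (F k).
  by rewrite ipZr// -nrm_sqr expr2 mulrA divfK// gt_eqF.
pose x_ := fix x_ k : T -> R := if k is k'.+1 then
   (if 0 <= ip (F k') (x_ k') then x_ k' + e k' else x_ k' - e k') else 0.
have sx k : sqint (x_ k).
  elim: k => [|k IH] /=; first exact: sqint0.
  by case: ifP => _; [exact: sqintD|exact: sqintB].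
have dx k : nrm (x_ k.+1 - x_ k) = q k.
  rewrite /=; case: ifP => _; rewrite addrAC subrr add0r ?nrmN//.
have gain k : q k * nrm (F k) <= `|ip (F k) (x_ k.+1)|.
  rewrite /=; have p0 : 0 < q k * nrm (F k) by rewrite mulr_gt0.
  case: ifP => [h|/negbT]; [rewrite ipDr//|rewrite -ltNge ipBr// => h]; rewrite ipe.
    by rewrite ger0_norm; lra.
  by rewrite ler0_norm; lra.
(* remaining part of the geometric series with ratio 1/3 *)
have tail k j : nrm (x_ (k + j)%N - x_ k) <= q k * (3 / 2) - q (k + j)%N * (3 / 2).
  elim: j => [|j IH]; first by rewrite addn0 !subrr nrm0.
  rewrite addnS; apply: le_trans (nrm_dist_trans mD _ (sx (k + j)%N) _) _ => //.
  rewrite dx; have := qS (k + j)%N; move: IH; lra.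
have [|x [sx' cx]] := @L2_summable_cvg _ _ _ mu D mD x_ (3 / 2) sx.
  move=> n; have -> : \sum_(k < n) nrm (x_ k.+1 - x_ k) = 3 / 2 - q n * (3 / 2).
    elim: n => [|n IH]; first by rewrite big_ord0 /q expr0; lra.
    by rewrite big_ord_recr/= IH dx qS; lra.
  by have := q0 n; lra.
have tail' k : nrm (x - x_ k) <= q k * (3 / 2).
  apply/ler_addgt0Pr => eps eps0.
  have /cvgrPdist_lt/(_ _ eps0)[m _ Hm] := cx.
  have /Hm /= : (m <= k + m)%N by rewrite leq_addl.
  rewrite sub0r normrN ger0_norm ?nrm_ge0// nrm_distC => xm.
  apply: le_trans (nrm_dist_trans mD _ (sx (k + m)%N) _) _ => //.
  by have := tail k m; have := q0 (k + m)%N; lra.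
have [M HM] := bf x sx'.
have big k : (4 / 3) ^+ k / 2 <= M.
  apply: le_trans (HM (N k) (HN k).1).
  have -> : ip (f_ (N k)) x = ip (F k) (x_ k.+1) + ip (F k) (x - x_ k.+1).
    by rewrite ipBr// addrC subrK.
  have := ip_le mD (sF k) (sqintB mD sx' (sx k.+1)).
  have := ler_wpM2l (nrm_ge0 mu D (F k)) (tail' k.+1).
  have := gain k; rewrite qS.
  have := lerB_normD (ip (F k) (x_ k.+1)) (ip (F k) (x - x_ k.+1)).
  move=> h1 h2 h3 h4; apply: (@le_trans _ _ (q k * nrm (F k) / 2)); last by lra.
  rewrite ler_pM2r// exprMn mulrC; apply: ler_pM; rewrite ?exprn_ge0//.
  exact: ltW (HN k).2.
pose k := (Num.truncn (6 * `|M|)).+1.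
have := big k; have := bernoulli_ineq k.
have := truncnS_gt (6 * `|M|); rewrite -/k; have := ler_norm M.
move: ((4 / 3) ^+ k) (k%:R : R) => a b; lra.
Qed.

Lemma L2_weak_cvg_bounded (f_ : nat -> T -> R) f :
  (forall n, (1 <= n)%N -> sqint (f_ n)) ->
  L2_weak_cvg mu D f_ f ->
  exists C : R, forall n, (1 <= n)%N -> nrm (f_ n) <= C.
Proof.
move=> sf_ wf; apply: L2_uniform_bounded => // g sg.
have [|M [Mr HM]] := @cvg_seq_bounded R R (fun n => ip (f_ n) g).
  by apply/cvg_ex; exists (ip f g); apply: wf; exact/in_L2P.
by exists (M + 1) => n _; apply: HM => //; rewrite ltrDl.
Qed.

End uniform_boundedness.

(** * A functional monotone class theorem *)

Section abs_polynomials.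
Context {R : realType}.
Implicit Types v : R.

(** Newton-like iteration increasing to |v| on [-1, 1]: the absolute value is a
    limit of polynomials, which the monotone class argument requires. *)
Fixpoint abs_approx (k : nat) v : R :=
  if k is k'.+1 then abs_approx k' v + (v ^+ 2 - abs_approx k' v ^+ 2) / 2 else 0.

Lemma abs_approx_bounds k v : `|v| <= 1 ->
  0 <= abs_approx k v <= `|v| /\
  `|v| - abs_approx k v <= `|v| * (1 - `|v| / 2) ^+ k.
Proof.
move=> v1; have v0 := normr_ge0 v.
elim: k => [|k [/andP[p0 pv] IH]] /=.
  by rewrite expr0 mulr1 subr0; split; rewrite ?lexx.
move: p0 pv IH; rewrite -(real_normK (num_real v)) (exprSr (1 - _)).
move: (abs_approx k v) (`|v|) v0 v1 ((1 - _) ^+ k) => p w w0 w1 e p0 pw IH.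
have E : w - (p + (w ^+ 2 - p ^+ 2) / 2) = (w - p) * (1 - (w + p) / 2) by field.
have F : 0 <= (w - p) * (1 - (w + p) / 2) by apply: mulr_ge0; lra.
split.
  rewrite -E subr_ge0 in F.
  have G : 0 <= w ^+ 2 - p ^+ 2 by rewrite subr_sqr; apply: mulr_ge0; lra.
  by rewrite F andbT; lra.
rewrite E; apply: (@le_trans _ _ ((w - p) * (1 - w / 2))).
  by apply: ler_wpM2l; lra.
by rewrite mulrA; apply: ler_wpM2r => //; lra.
Qed.

Lemma cvg_abs_approx v : `|v| <= 1 -> abs_approx k v @[k --> \oo] --> `|v|.
Proof.
move=> v1; have [->|v0] := eqVneq v 0.
  rewrite normr0 (_ : (fun k => abs_approx k (0 : R)) = cst 0); first exact: cvg_cst.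
  apply/funext => k; have := @abs_approx_bounds k 0.
  by rewrite normr0 => /(_ ler01)[/andP[? ?] _]; apply/eqP; rewrite eq_le; apply/andP.
have v0' : 0 < `|v| by rewrite normr_gt0.
apply: (squeeze_cvgr (f := fun k => `|v| - `|v| * (1 - `|v| / 2) ^+ k)
  (h := cst `|v|)).
- apply: nearW => k; have [/andP[? ?] ?] := abs_approx_bounds k v1.
  by apply/andP; split => //; lra.
- rewrite -[X in _ --> X]subr0; apply: cvgB; first exact: cvg_cst.
  apply: cvg_geometric; rewrite ger0_norm; lra.
- exact: cvg_cst.
Qed.

End abs_polynomials.

Section functional_monotone_class.
Context {d : measure_display} {T : measurableType d} {R : realType}.
Variable mu : {measure set T -> \bar R}.
Implicit Types (f g k m : T -> R).

Definition bounded_measurable f :=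
  measurable_fun setT f /\ exists M : R, forall x, `|f x| <= M.

Local Notation bm := bounded_measurable.

Lemma bmD f g : bm f -> bm g -> bm (f + g).
Proof.
move=> [mf [M HM]] [mg [N HN]]; split; first exact: measurable_funD.
exists (M + N) => x; apply: le_trans (ler_normD _ _) _; exact: lerD.
Qed.

Lemma bmM f g : bm f -> bm g -> bm (fun x => f x * g x).
Proof.
move=> [mf [M HM]] [mg [N HN]]; split; first exact: measurable_funM.
by exists (M * N) => x; rewrite normrM; apply: ler_pM.
Qed.

Lemma bm_cst (c : R) : bm (fun=> c).
Proof. by split; [exact: measurable_cst|exists `|c|]. Qed.

Lemma bm_indic (A : set T) : measurable A -> bm \1_A.
Proof.
move=> mA; split; first exact: measurable_indic.
by exists 1 => x; rewrite indicE; case: (_ \in _); rewrite ?normr1 ?normr0.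
Qed.

Variables (K V : (T -> R) -> Prop).
Hypothesis K_bm : forall k, K k -> bm k.
Hypothesis K1 : K (fun=> 1).
Hypothesis KM : forall k k', K k -> K k' -> exists a b k1 k2,
  [/\ K k1, K k2 & forall x, k x * k' x = a * k1 x + b * k2 x].
Hypothesis KV : forall k, K k -> V k.
Hypothesis VD : forall f g, V f -> V g -> V (f + g).
Hypothesis VZ : forall (c : R) f, V f -> V (fun x => c * f x).
Hypothesis Vlim : forall (f_ : nat -> T -> R) f (M : R),
  (forall n, V (f_ n)) -> (forall n, measurable_fun setT (f_ n)) ->
  (forall n x, `|f_ n x| <= M) ->
  bm f -> {ae mu, forall x, f_ n x @[n --> \oo] --> f x} -> V f.

(** Two-step device that makes a multiplicative class out of V, which is only
    linear: first what carries K into V, then what carries these into themselves. *)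
Definition multiplies_generators m := bm m /\ forall k, K k -> V (fun x => m x * k x).

Definition multiplier f :=
  bm f /\ forall m, multiplies_generators m -> multiplies_generators (fun x => f x * m x).

Local Notation M1 := multiplies_generators.
Local Notation M2 := multiplier.

Lemma multiplies_generatorsD f g : M1 f -> M1 g -> M1 (f + g).
Proof.
move=> [bf Kf] [bg Kg]; split=> [|k Kk]; first exact: bmD.
rewrite (_ : (fun x => _) = (fun x => f x * k x) + (fun x => g x * k x)).
  by apply: VD; [exact: Kf|exact: Kg].
by apply/funext => x; rewrite /= mulrDl.
Qed.

Lemma multiplies_generatorsZ (c : R) f : M1 f -> M1 (fun x => c * f x).
Proof.
move=> [bf Kf]; split=> [|k Kk].
  by apply: (@bmM (fun=> c)) => //; exact: bm_cst.
rewrite (_ : (fun x => _) = (fun x => c * (f x * k x))).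
  by apply: VZ; exact: Kf.
by apply/funext => x; rewrite mulrA.
Qed.

Lemma multiplies_generators_lim (f_ : nat -> T -> R) f (M : R) :
  (forall n, M1 (f_ n)) -> (forall n x, `|f_ n x| <= M) ->
  bm f -> {ae mu, forall x, f_ n x @[n --> \oo] --> f x} -> M1 f.
Proof.
move=> f1 fM bf cf; split=> // k Kk.
have [mk [N HN]] := K_bm Kk.
apply: (Vlim (f_ := fun n x => f_ n x * k x) (M := M * N)).
- by move=> n; apply: (f1 n).2.
- by move=> n; apply: measurable_funM => //; case: (f1 n) => -[].
- by move=> n x; rewrite normrM; apply: ler_pM.
- by apply: bmM => //; exact: K_bm.
- by apply: filterS cf => x cfx; apply: cvgM => //; exact: cvg_cst.
Qed.

Lemma multiplierD f g : M2 f -> M2 g -> M2 (f + g).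
Proof.
move=> [bf Kf] [bg Kg]; split=> [|m Km]; first exact: bmD.
rewrite (_ : (fun x => _) = (fun x => f x * m x) + (fun x => g x * m x)).
  by apply: multiplies_generatorsD; [exact: Kf|exact: Kg].
by apply/funext => x; rewrite /= mulrDl.
Qed.

Lemma multiplierM f g : M2 f -> M2 g -> M2 (fun x => f x * g x).
Proof.
move=> [bf Kf] [bg Kg]; split=> [|m Km]; first exact: bmM.
rewrite (_ : (fun x => _) = (fun x => f x * (g x * m x))).
  by apply: Kf; exact: Kg.
by apply/funext => x; rewrite mulrA.
Qed.

Lemma multiplier_cst (c : R) : M2 (fun=> c).
Proof.
by split=> [|m Km]; [exact: bm_cst|exact: multiplies_generatorsZ].
Qed.

Lemma multiplierZ (c : R) f : M2 f -> M2 (fun x => c * f x).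
Proof. by move=> Kf; apply: (@multiplierM (fun=> c)) => //; exact: multiplier_cst. Qed.

Lemma multiplierX n f : M2 f -> M2 (fun x => f x ^+ n).
Proof.
move=> Kf; elim: n => [|n IH]; first exact: (multiplier_cst 1).
rewrite (_ : (fun x => _) = (fun x => f x * f x ^+ n)); first exact: multiplierM.
by apply/funext => x; rewrite exprS.
Qed.

Lemma multiplier_lim (f_ : nat -> T -> R) f (M : R) :
  (forall n, M2 (f_ n)) -> (forall n x, `|f_ n x| <= M) ->
  bm f -> {ae mu, forall x, f_ n x @[n --> \oo] --> f x} -> M2 f.
Proof.
move=> f2 fM bf cf; split=> // m [bm_m Km].
have [mm [N HN]] := bm_m.
apply: (@multiplies_generators_lim (fun n x => f_ n x * m x) _ (M * N)).
- by move=> n; apply: (f2 n).2.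
- by move=> n x; rewrite normrM; apply: ler_pM.
- exact: bmM.
- by apply: filterS cf => x cfx; apply: cvgM => //; exact: cvg_cst.
Qed.

(** This is the only place where products of generators enter. *)
Lemma generator_multiplier k : K k -> M2 k.
Proof.
move=> Kk; split=> [|m [bm_m Km]]; first exact: K_bm.
split; first by apply: bmM => //; exact: K_bm.
move=> k' Kk'; have [a [b [k1 [k2 [K1k K2k E]]]]] := KM Kk Kk'.
rewrite (_ : (fun x => _) =
  (fun x => a * (m x * k1 x)) + (fun x => b * (m x * k2 x))).
  by apply: VD; apply: VZ; exact: Km.
apply/funext => x; rewrite mulrAC E.
change ((a * k1 x + b * k2 x) * m x = a * (m x * k1 x) + b * (m x * k2 x)); ring.
Qed.

Lemma multiplier_V f : M2 f -> V f.
Proof.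
move=> [bf Kf].
have [_ /(_ _ K1)] : M1 (fun x => f x * 1).
  by apply: Kf; split=> [|k Kk]; [exact: bm_cst|under eq_fun do rewrite mul1r; exact: KV].
by under eq_fun do rewrite !mulr1.
Qed.

Lemma multiplier_abs f (M : R) : (forall x, `|f x| <= M) -> 0 < M -> M2 f ->
  M2 (fun x => `|f x|).
Proof.
move=> fM M0 Kf.
have Kg : M2 (fun x => M^-1 * f x) by exact: multiplierZ.
have g1 x : `|M^-1 * f x| <= 1.
  by rewrite normrM gtr0_norm ?invr_gt0// mulrC ler_pdivrMr// mul1r.
rewrite (_ : (fun x => _) = (fun x => M * `|M^-1 * f x|)); last first.
  by apply/funext => x; rewrite normrM gtr0_norm ?invr_gt0// mulrA divff ?mul1r ?gt_eqF.
apply: multiplierZ.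
apply: (@multiplier_lim (fun n x => abs_approx n (M^-1 * f x)) (fun x => `|M^-1 * f x|) 1).
- elim=> [|k IH] /=; first exact: (multiplier_cst 0).
  apply: multiplierD => //.
  under eq_fun do rewrite mulrC.
  apply: multiplierZ; apply: multiplierD; first exact: multiplierX.
  under eq_fun do rewrite -mulN1r.
  by apply: multiplierZ; exact: multiplierX.
- move=> n x; have [/andP[? ?] _] := abs_approx_bounds n (g1 x).
  by rewrite ger0_norm//; exact: le_trans (g1 x).
- case: Kg => -[mg _] _; split; last by exists 1 => x; rewrite normr_id.
  exact: measurableT_comp.
- by apply: nearW => x; exact: cvg_abs_approx.
Qed.

(** With v proportional to f - c, 1 - w = v^+ is positive exactly where f > c, so
    1 - w^n increases to the indicator of that set. *)
Lemma multiplier_indic_gt f (c : R) : M2 f -> M2 \1_[set x | c < f x].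
Proof.
move=> Kf; have [[mf [M HM]] _] := Kf.
have fM x : -M <= f x <= M by rewrite -ler_norml.
(* r brings f - c into [-1, 1], the range of the polynomial approximation *)
pose r := `|M| + `|c| + 1.
have r0 : 0 < r by rewrite ltr_pwDr// addr_ge0.
pose v x := r^-1 * (f x - c).
have Kv : M2 v.
  by apply: multiplierZ; apply: multiplierD => //; exact: multiplier_cst.
have v1 x : `|v x| <= 1.
  rewrite /v normrM gtr0_norm ?invr_gt0// mulrC ler_pdivrMr// mul1r.
  apply: le_trans (ler_normB _ _) _; rewrite /r.
  by have := HM x; have := ler_norm M; lra.
pose w x := 1 - 2^-1 * (v x + `|v x|).
have Kw : M2 w.
  have -> : w = (fun=> 1) + (fun x => - 2^-1 * (v x + `|v x|)).
    by apply/funext => x; rewrite {1}/w -mulNr.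
  apply: multiplierD; first exact: multiplier_cst.
  apply: multiplierZ; apply: multiplierD => //; exact: multiplier_abs Kv.
have w01 x : 0 <= w x <= 1.
  have := v1 x; rewrite /w; have := ler_norm (v x); have := ler_norm (- v x).
  by rewrite normrN; lra.
have mgt : measurable [set x | c < f x].
  rewrite (_ : [set x | _] = setT `&` f @^-1` `]c, +oo[); first exact: mf.
  by rewrite setTI; apply/seteqP; split => x /=; rewrite in_itv/= andbT.
apply: (@multiplier_lim (fun n x => 1 + (-1) * w x ^+ n) _ 1).
- move=> n; apply: multiplierD; first exact: multiplier_cst.
  by apply: multiplierZ; exact: multiplierX.
- move=> n x; have /andP[w0 w1] := w01 x.
  have := exprn_ge0 n w0; have := exprn_ile1 n w0 w1 => h1 h2.
  by rewrite ger0_norm; lra.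
- exact: bm_indic.
- apply: nearW => x; rewrite indicE.
  have [cf|fc] := ltP c (f x).
    rewrite mem_set// -[X in _ --> X]addr0; apply: cvgD; first exact: cvg_cst.
    rewrite -[X in _ --> X](mulr0 (-1)); apply: cvgM; first exact: cvg_cst.
    have v0 : 0 < v x by rewrite mulr_gt0 ?invr_gt0// subr_gt0.
    apply: cvg_expr; have := w01 x; rewrite /w.
    by rewrite (ger0_norm (ltW v0)) => ?; rewrite ger0_norm; lra.
  rewrite memNset /=; last by apply/negP; rewrite -leNgt.
  have v0 : v x <= 0 by rewrite /v pmulr_rle0 ?invr_gt0// subr_le0.
  rewrite (_ : (fun n => _) = cst 0); first exact: cvg_cst.
  by apply/funext => n; rewrite /w ler0_norm// subrr mulr0 subr0 expr1n mulr1 subrr.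
Qed.

Definition multiplier_sets : set (set T) := [set E | M2 \1_E /\ measurable E].

Lemma sigma_algebra_multiplier_sets : sigma_algebra setT multiplier_sets.
Proof.
have setC_closed E : multiplier_sets E -> multiplier_sets (~` E).
  move=> [KE mE]; split; last exact: measurableC.
  rewrite (_ : \1_(~` E) = (fun=> 1) + (fun x => (-1) * \1_E x)).
    by apply: multiplierD; [exact: multiplier_cst|exact: multiplierZ].
  apply/funext => x; change (\1_(~` E) x = 1 + (-1) * \1_E x :> R).
  by rewrite !indicE in_setC; case: (x \in E) => /=; ring.
have setI_closed E F : multiplier_sets E -> multiplier_sets F -> multiplier_sets (E `&` F).
  move=> [KE mE] [KF mF]; split; last exact: measurableI.
  rewrite (_ : \1_(E `&` F) = (fun x => \1_E x * \1_F x)); first exact: multiplierM.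
  by apply/funext => x; rewrite indicI.
have set0_in : multiplier_sets set0.
  by split; [rewrite indic0; exact: multiplier_cst|exact: measurable0].
split=> //.
- by move=> E HE; rewrite setTD; exact: setC_closed.
- move=> F HF.
  have HFn n : multiplier_sets (\big[setU/set0]_(i < n) F i).
    elim: n => [|n IH]; first by rewrite big_ord0.
    rewrite big_ord_recr/= -[X in multiplier_sets X]setCK setCU.
    exact: setC_closed (setI_closed _ _ (setC_closed _ IH) (setC_closed _ (HF n))).
  have mF : measurable (\bigcup_i F i) by apply: bigcup_measurable => i _; case: (HF i).
  split=> //.
  apply: (@multiplier_lim (fun n => \1_(\big[setU/set0]_(i < n) F i)) _ 1).
  + by move=> n; case: (HFn n).
  + by move=> n x; rewrite indicE; case: (_ \in _); rewrite ?normr1 ?normr0.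
  + exact: bm_indic.
  + apply: nearW => x; rewrite [X in _ --> X]indicE.
    have [/set_mem[i _ Fix]|nFx] := boolP (x \in _).
      apply: cvg_near_cst; exists i.+1 => // n /= ni.
      rewrite indicE mem_set//.
      by rewrite -bigcup_mkord; exists i.
    apply: cvg_near_cst; apply: nearW => n; rewrite indicE.
    rewrite memNset//; apply: contraNnot nFx => Fx; apply/mem_set.
    by move: Fx; rewrite -bigcup_mkord => -[i _ Fix]; exists i.
Qed.

Lemma multiplier_measurable f : M2 f ->
  forall A : set R, measurable A -> multiplier_sets (f @^-1` A).
Proof.
move=> Kf; have [[mf _] _] := Kf.
have SA : <<s multiplier_sets >> = multiplier_sets.
  exact: sigma_algebra_id sigma_algebra_multiplier_sets.
have : @measurable_fun _ _ (g_sigma_algebraType multiplier_sets) R setT f.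
  apply: (measurability _ (RGenOInfty.measurableE R)).
  move=> _ [_ [c ->] <-]; rewrite setTI.
  have -> : f @^-1` `]c, +oo[%classic = [set x | c < f x].
    by apply/seteqP; split => x /=; rewrite in_itv/= andbT.
  rewrite /measurable/= SA; split; first exact: multiplier_indic_gt.
  rewrite (_ : [set x | _] = setT `&` f @^-1` `]c, +oo[); first exact: mf.
  by rewrite setTI; apply/seteqP; split => x /=; rewrite in_itv/= andbT.
move=> mf' A mA; have := mf' measurableT A mA.
by rewrite setTI /measurable/= SA.
Qed.

(** Stability of V under almost everywhere limits puts null sets into the class,
    which is how the completed sigma-fields are reached. *)
Lemma multiplier_null E : measurable E -> mu E = 0%E -> multiplier_sets E.
Proof.
move=> mE E0; split=> //.
apply: (@multiplier_lim (fun _ _ => 0) _ 0).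
- by move=> n; exact: multiplier_cst.
- by move=> n x; rewrite normr0.
- exact: bm_indic.
- exists E; split=> // x /= H; apply: contrapT => nE; apply: H.
  by rewrite indicE memNset//; exact: cvg_cst.
Qed.

Import HBNNSimple.

(** The class of multipliers is stable under products and bounded limits, so it
    contains |f| with f, hence the indicators of the level sets of its members.
    Approximating by simple functions gives every measurable function. The
    hypothesis on K asks less than stability under products: the cosines that are
    used below are only stable up to linear combinations. *)
Theorem functional_monotone_class (G : set (set T)) f :
  (forall E, G E -> (exists k A, [/\ K k, measurable A & E = k @^-1` A]) \/
                    (measurable E /\ mu E = 0%E)) ->
  bm f -> @measurable_fun _ _ (g_sigma_algebraType G) R setT f -> V f.
Proof.
move=> HG [mf [M HM]] mGf.
have GS : <<s G >> `<=` multiplier_sets.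
  apply: smallest_sub; first exact: sigma_algebra_multiplier_sets.
  move=> E /HG[[k [A [Kk mA ->]]]|[mE E0]]; last exact: multiplier_null.
  by apply: multiplier_measurable => //; exact: generator_multiplier.
apply: multiplier_V.
pose h x : \bar R := (f x + M)%:E.
have h0 x : (0 <= h x)%E.
  rewrite lee_fin; have := HM x; rewrite ler_norml => /andP[]; lra.
have mh : @measurable_fun _ _ (g_sigma_algebraType G) _ setT h.
  by apply/measurable_EFinP; apply: measurable_funD => //; exact: measurable_cst.
pose s n := nnsfun_approx measurableT mh n.
have sh n x : 0 <= s n x <= f x + M.
  apply/andP; split; first exact: fun_ge0.
  rewrite -lee_fin /s nnsfun_approxE.
  exact: (@le_approx _ _ _ setT h n x (fun x _ => h0 x) Logic.I).
have Ks n : M2 (s n : T -> R).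
  have -> : (s n : T -> R) = (fun x =>
      \sum_(y <- finmap.enum_fset (fset_set (range (s n))))
        (y * \1_(s n @^-1` [set y]) x)).
    by apply/funext => x; rewrite fimfunE fsbig_finite.
  elim: (finmap.enum_fset _) => [|y l IH].
    by under eq_fun do rewrite big_nil; exact: multiplier_cst.
  rewrite (_ : (fun x => _) = (fun x => y * \1_(s n @^-1` [set y]) x) +
    (fun x => \sum_(z <- l) (z * \1_(s n @^-1` [set z]) x))); last first.
    by apply/funext => x; rewrite big_cons.
  apply: multiplierD => //; apply: multiplierZ.
  have : multiplier_sets (s n @^-1` [set y]).
    apply: GS.
    by have := @measurable_funPTI _ _ _ _ (s n) [set y] (measurable_set1 y).
  by case.
have KfM : M2 (fun x => f x + M).
  apply: (@multiplier_lim (fun n => s n) _ (`|M| + `|M|)) => //.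
  - move=> n x; have /andP[s0 sM] := sh n x; rewrite ger0_norm//.
    have := HM x; rewrite ler_norml => /andP[_]; have := ler_norm M; lra.
  - split; first by apply: measurable_funD => //; exact: measurable_cst.
    exists (`|M| + `|M|) => x; apply: le_trans (ler_normD _ _) _.
    by rewrite lerD2r (le_trans (HM x))// ler_norm.
  - apply: nearW => x.
    have := @cvg_nnsfun_approx _ (g_sigma_algebraType G) _ setT measurableT h mh (fun x _ => h0 x) x I.
    by move=> /fine_cvg.
rewrite (_ : f = (fun x => f x + M) + (fun=> - M)).
  by apply: multiplierD => //; exact: multiplier_cst.
by apply/funext => x; rewrite /GRing.add/= addrK.
Qed.

End functional_monotone_class.

(** * Truncation and independence *)

Section clipping.
Context {R : realType}.
Implicit Types c x y : R.

(** Truncation is 1-Lipschitz and continuous, unlike multiplication by the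
    indicator of a level set. *)
Definition clip c x := Num.max (- c) (Num.min x c).

Lemma clipE c x : 0 <= c ->
  clip c x = if x < - c then - c else if x < c then x else c.
Proof.
move=> c0; rewrite /clip; have [xc|cx] := ltP x c.
  by case: (ltP x (- c)).
by rewrite max_r; [case: ifPn => //; lra|lra].
Qed.

Lemma clip_le c x : 0 <= c -> `|clip c x| <= c.
Proof.
by move=> c0; rewrite clipE// ler_norml; do 2?case: ifPn; rewrite -?leNgt => *; lra.
Qed.

Lemma clip_le_id c x : 0 <= c -> `|clip c x| <= `|x|.
Proof.
move=> c0; have := ler_norm x; have := ler_norm (- x); rewrite normrN => ? ?.
by rewrite clipE// ler_norml; do 2?case: ifPn; rewrite -?leNgt => *; lra.
Qed.

Lemma clip_lip c x y : 0 <= c -> `|clip c x - clip c y| <= `|x - y|.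
Proof.
move=> c0; have := ler_norm (x - y); have := ler_norm (- (x - y)).
rewrite normrN => ? ?; rewrite !clipE// ler_norml.
by do 4?case: ifPn; rewrite -?leNgt => *; lra.
Qed.

Lemma clip_id c x : `|x| <= c -> clip c x = x.
Proof.
rewrite ler_norml => /andP[h1 h2]; rewrite clipE; last by lra.
by do 2?case: ifPn; rewrite -?leNgt => *; lra.
Qed.

Lemma measurable_clip c : measurable_fun setT (clip c).
Proof.
apply: measurable_maxr; first exact: measurable_cst.
by apply: measurable_minr; [exact: measurable_id|exact: measurable_cst].
Qed.

Lemma cvg_clip x : clip n%:R x @[n --> \oo] --> x.
Proof.
apply: cvg_near_cst; near=> n; rewrite clip_id//.
near: n; exists (Num.truncn `|x|).+1 => // n /= xn.
by rewrite (le_trans (ltW (truncnS_gt _)))// ler_nat.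
Unshelve. all: by end_near. Qed.

End clipping.

Section probability_L2.
Context {d : measure_display} {T : measurableType d} {R : realType}.
Variable P : probability T R.
Implicit Types (f g : T -> R).
Local Notation sq := (sqint P setT).

Lemma bm_integrable f : bounded_measurable f -> P.-integrable setT (EFin \o f).
Proof.
move=> [mf [M HM]]; apply: measurable_bounded_integrable => //.
  by rewrite ltey_eq fin_num_measure.
by exists M; split; [exact: num_real|move=> N MN x _; exact/(le_trans (HM x))/ltW].
Qed.

Lemma bm_sqint f : bounded_measurable f -> sq f.
Proof.
move=> bf; split; first by case: bf.
by apply: bm_integrable; under eq_fun do rewrite expr2; exact: bmM.
Qed.

Lemma sqint_cst (c : R) : sq (fun=> c).
Proof. exact/bm_sqint/bm_cst. Qed.

Lemma sqint_integrable f : sq f -> P.-integrable setT (EFin \o f).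
Proof.
move=> sf; have := sqint_integrableM measurableT sf (sqint_cst 1).
by under eq_fun do rewrite mulr1.
Qed.

Lemma ip_cst1 f : L2inner P setT f (fun=> 1) = (\int[P]_x f x)%R.
Proof. by apply: eq_Rintegral => x _; rewrite mulr1. Qed.

Lemma Rintegral_prob_cst (c : R) : (\int[P]_x c)%R = c.
Proof.
rewrite Rintegral_cst// [X in _ * X](_ : _ = 1) ?mulr1//.
exact: (congr1 fine (probability_setT P)).
Qed.

Lemma nrm_cst (c : R) : L2norm P setT (fun=> c) = `|c|.
Proof. by rewrite /L2norm /L2inner Rintegral_prob_cst -expr2 sqrtr_sqr. Qed.

End probability_L2.

Section ip_limits.
Context {d : measure_display} {T : measurableType d} {R : realType}.
Variables (mu : {measure set T -> \bar R}) (D : set T).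
Hypothesis mD : measurable D.
Implicit Types (f g : T -> R).

(** Continuity of the inner product, by the bound
    |f_n| |g_n - g| + |g| |f_n - f|. *)
Lemma cvg_ip (f_ g_ : nat -> T -> R) f g :
  (forall n, sqint mu D (f_ n)) -> (forall n, sqint mu D (g_ n)) ->
  sqint mu D f -> sqint mu D g ->
  L2norm mu D (f_ n - f) @[n --> \oo] --> 0 ->
  L2norm mu D (g_ n - g) @[n --> \oo] --> 0 ->
  L2inner mu D (f_ n) (g_ n) @[n --> \oo] --> L2inner mu D f g.
Proof.
move=> sf_ sg_ sf sg cf cg.
suff H : L2inner mu D (f_ n) (g_ n) - L2inner mu D f g @[n --> \oo] --> 0.
  rewrite -[X in _ --> X]add0r.
  have -> : (fun n => L2inner mu D (f_ n) (g_ n)) =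
      (fun n => (L2inner mu D (f_ n) (g_ n) - L2inner mu D f g) + L2inner mu D f g).
    by apply/funext => n; rewrite subrK.
  by apply: cvgD => //; exact: cvg_cst.
apply/norm_cvg0P.
apply: (squeeze_cvgr (f := cst 0) (h := fun n =>
  L2norm mu D (f_ n - f) * (L2norm mu D (g_ n - g) + L2norm mu D g) +
  L2norm mu D f * L2norm mu D (g_ n - g))).
- apply: nearW => n; rewrite normr_ge0/=.
  have -> : L2inner mu D (f_ n) (g_ n) - L2inner mu D f g =
      L2inner mu D (f_ n - f) (g_ n) + L2inner mu D f (g_ n - g).
    by rewrite ipBl// ipBr//; ring.
  apply: le_trans (ler_normD _ _) _; apply: lerD; last first.
    by apply: ip_le => //; exact: sqintB.
  apply: le_trans (ip_le _ _ _) _ => //; first exact: sqintB.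
  apply: ler_wpM2l; first exact: nrm_ge0.
  by rewrite -{1}[g_ n](subrK g); apply: nrmD => //; exact: sqintB.
- exact: cvg_cst.
- rewrite -[X in _ --> X](_ : 0 * (0 + L2norm mu D g) + L2norm mu D f * 0 = 0); last by ring.
  apply: cvgD; apply: cvgM => //; try exact: cvg_cst.
  by apply: cvgD => //; exact: cvg_cst.
Qed.

Lemma cvg_ipl (f_ : nat -> T -> R) f g :
  (forall n, sqint mu D (f_ n)) -> sqint mu D f -> sqint mu D g ->
  L2norm mu D (f_ n - f) @[n --> \oo] --> 0 ->
  L2inner mu D (f_ n) g @[n --> \oo] --> L2inner mu D f g.
Proof.
move=> sf_ sf sg cf; apply: (cvg_ip (g_ := fun=> g)) => //.
rewrite (_ : (fun n : nat => _) = cst 0); first exact: cvg_cst.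
by apply/funext => n; rewrite subrr nrm0.
Qed.

End ip_limits.

Section Rintegral_limit.
Context {d : measure_display} {T : measurableType d} {R : realType}.
Variables (mu : {measure set T -> \bar R}) (D : set T).
Hypothesis mD : measurable D.

Lemma cvg_Rintegral_dominated (f_ : nat -> T -> R) (f g : T -> R) :
  (forall n, measurable_fun D (f_ n)) -> measurable_fun D f ->
  (forall x, f_ n x @[n --> \oo] --> f x) ->
  mu.-integrable D (EFin \o g) -> (forall n x, `|f_ n x| <= g x) ->
  (\int[mu]_(x in D) f_ n x)%R @[n --> \oo] --> (\int[mu]_(x in D) f x)%R.
Proof.
move=> mf_ mf cf ig fg.
have [] // := @dominated_convergence _ _ _ mu D mD
  (fun n => EFin \o f_ n) (EFin \o f) (EFin \o g).
- by move=> n; exact/measurable_EFinP.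
- exact/measurable_EFinP.
- by apply: nearW => x _; apply: cvg_EFin; [exact: nearW|exact: cf].
- by apply: nearW => x n _; rewrite lee_fin.
move=> intf _ cint; apply: fine_cvg.
by rewrite fineK//; exact: integrable_fin_num.
Qed.

End Rintegral_limit.

Section independence.
Context {d : measure_display} {T : measurableType d} {R : realType}.
Variable P : probability T R.
Implicit Types (f g Y W : T -> R).

(** On a probability space bounded almost everywhere convergence implies
    convergence in L^2, so closed subspaces of L^2 meet the limit hypothesis of
    [functional_monotone_class]. *)
Lemma bounded_cvg_nrm (f_ : nat -> T -> R) f (M : R) :
  (forall n, measurable_fun setT (f_ n)) ->
  (forall n x, `|f_ n x| <= M) -> measurable_fun setT f ->
  {ae P, forall x, f_ n x @[n --> \oo] --> f x} ->
  L2norm P setT (f_ n - f) @[n --> \oo] --> 0.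
Proof.
move=> mf_ fM mf cf.
have [] // := @sqint_dominated _ _ _ P setT measurableT f_ f (fun=> M) mf_ mf.
- exact: sqint_cst.
- by apply: filterS cf.
- by apply: nearW => x n _.
Qed.

Section classes.
Variables (K1 K2 : (T -> R) -> Prop) (G1 G2 : set (set T)).
Hypothesis K1_bm : forall k, K1 k -> bounded_measurable k.
Hypothesis K2_bm : forall k, K2 k -> bounded_measurable k.
Hypothesis K11 : K1 (fun=> 1).
Hypothesis K21 : K2 (fun=> 1).
Hypothesis K1M : forall k k', K1 k -> K1 k' -> K1 (fun x => k x * k' x).
Hypothesis K2M : forall k k', K2 k -> K2 k' -> K2 (fun x => k x * k' x).
Hypothesis G1K : forall E, G1 E ->
  exists k A, [/\ K1 k, measurable A & E = k @^-1` A].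
Hypothesis G2K : forall E, G2 E ->
  exists k A, [/\ K2 k, measurable A & E = k @^-1` A].
Hypothesis indep : forall k1 k2, K1 k1 -> K2 k2 ->
  L2inner P setT k1 k2 = (\int[P]_x k1 x)%R * (\int[P]_x k2 x)%R.

Let factorizes g f := bounded_measurable f /\
  L2inner P setT f g = (\int[P]_x f x)%R * (\int[P]_x g x)%R.

Let factorizesD g f1 f2 : bounded_measurable g ->
  factorizes g f1 -> factorizes g f2 -> factorizes g (f1 + f2).
Proof.
move=> bg [b1 e1] [b2 e2]; split; first exact: bmD.
have [? [? ?]] : sqint P setT f1 /\ sqint P setT f2 /\ sqint P setT g.
  by split; [|split]; exact: bm_sqint.
rewrite ipDl// e1 e2 -mulrDl -RintegralD//; exact: bm_integrable.
Qed.

Let factorizesZ g (c : R) f : bounded_measurable g ->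
  factorizes g f -> factorizes g (fun x => c * f x).
Proof.
move=> bg [b1 e1]; split; first by apply: (@bmM _ _ _ (fun=> c)) => //; exact: bm_cst.
rewrite ipZl ?e1//; try exact: bm_sqint.
by rewrite RintegralZl//; [rewrite mulrA|exact: bm_integrable].
Qed.

Let factorizes_lim g (f_ : nat -> T -> R) f (M : R) : bounded_measurable g ->
  (forall n, factorizes g (f_ n)) -> (forall n, measurable_fun setT (f_ n)) ->
  (forall n x, `|f_ n x| <= M) -> bounded_measurable f ->
  {ae P, forall x, f_ n x @[n --> \oo] --> f x} -> factorizes g f.
Proof.
move=> bg ff mf fM bf cf; split=> //.
have sg := bm_sqint P bg; have sf := bm_sqint P bf.
have sf_ n : sqint P setT (f_ n) by apply: bm_sqint; case: (ff n).
have nf := bounded_cvg_nrm mf fM bf.1 cf.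
have h1 := cvg_ipl measurableT sf_ sf sg nf.
have h2 := cvg_ipl measurableT sf_ sf (sqint_cst P 1) nf.
apply: (cvg_unique _ h1) => //.
have -> : (fun n => L2inner P setT (f_ n) g) =
    (fun n => L2inner P setT (f_ n) (fun=> 1) * (\int[P]_x g x)%R).
  by apply/funext => n; rewrite (ff n).2 ip_cst1.
by rewrite -(ip_cst1 P f); apply: cvgM => //; exact: cvg_cst.
Qed.

(** Independence on generators extends by two monotone class arguments, one for
    each factor. *)
Lemma independent_bounded Y W :
  bounded_measurable Y -> bounded_measurable W ->
  @measurable_fun _ _ (g_sigma_algebraType G1) R setT Y ->
  @measurable_fun _ _ (g_sigma_algebraType G2) R setT W ->
  L2inner P setT Y W = (\int[P]_x Y x)%R * (\int[P]_x W x)%R.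
Proof.
move=> bY bW mY mW.
have Yk k2 : K2 k2 -> factorizes k2 Y.
  move=> Kk2; apply: (@functional_monotone_class _ _ _ P K1 (factorizes k2) _ _ _ _ _ _ _ G1) => //.
  - by move=> k k' Kk Kk'; exists 1, 0, (fun x => k x * k' x), (fun x => k x * k' x);
      split; [exact: K1M|exact: K1M|move=> x; rewrite mul1r mul0r addr0].
  - by move=> k Kk; split; [exact: K1_bm|exact: indep].
  - by move=> f1 f2; apply: factorizesD; exact: K2_bm.
  - by move=> c f; apply: factorizesZ; exact: K2_bm.
  - by move=> f_ f M; apply: factorizes_lim; exact: K2_bm.
  - by move=> E /G1K; left.
suff [_] : factorizes Y W by rewrite ipC mulrC.
apply: (@functional_monotone_class _ _ _ P K2 (factorizes Y) _ _ _ _ _ _ _ G2) => //.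
- by move=> k k' Kk Kk'; exists 1, 0, (fun x => k x * k' x), (fun x => k x * k' x);
    split; [exact: K2M|exact: K2M|move=> x; rewrite mul1r mul0r addr0].
- by move=> k Kk; split; [exact: K2_bm|rewrite ipC mulrC; case: (Yk k Kk)].
- by move=> f1 f2; exact: factorizesD.
- by move=> c f; exact: factorizesZ.
- by move=> f_ f M; exact: factorizes_lim.
- by move=> E /G2K; left.
Qed.

(** Truncation reduces to bounded factors; the product of the truncated absolute
    values has bounded integral, so Fatou gives the integrability of the product. *)
Lemma independent_integrable Y W :
  P.-integrable setT (EFin \o Y) -> P.-integrable setT (EFin \o W) ->
  @measurable_fun _ _ (g_sigma_algebraType G1) R setT Y ->
  @measurable_fun _ _ (g_sigma_algebraType G2) R setT W ->
  P.-integrable setT (EFin \o (fun x => Y x * W x)) /\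
  L2inner P setT Y W = (\int[P]_x Y x)%R * (\int[P]_x W x)%R.
Proof.
move=> iY iW mY mW.
have mY' : measurable_fun setT Y by apply/measurable_EFinP; exact: measurable_int iY.
have mW' : measurable_fun setT W by apply/measurable_EFinP; exact: measurable_int iW.
have bc (f : T -> R) n : measurable_fun setT f -> bounded_measurable (fun x => clip n%:R (f x)).
  move=> mf; split; first by apply: measurableT_comp => //; exact: measurable_clip.
  by exists n%:R => x; exact: clip_le.
have bn (f : T -> R) : bounded_measurable f -> bounded_measurable (fun x => `|f x|).
  move=> [mf [M HM]]; split; first exact: measurableT_comp.
  by exists M => x; rewrite normr_id.
have prod_n n (h : R -> R) : measurable_fun setT h ->
    (forall f, bounded_measurable f -> bounded_measurable (fun x => h (f x))) ->
    L2inner P setT (fun x => h (clip n%:R (Y x))) (fun x => h (clip n%:R (W x))) =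
    (\int[P]_x h (clip n%:R (Y x)))%R * (\int[P]_x h (clip n%:R (W x)))%R.
  move=> mh bh; apply: independent_bounded; try exact/bh/bc.
  - by apply: measurableT_comp => //; apply: measurableT_comp => //; exact: measurable_clip.
  - by apply: measurableT_comp => //; apply: measurableT_comp => //; exact: measurable_clip.
have mYW : measurable_fun setT (fun x => Y x * W x) by exact: measurable_funM.
have cv x : clip n%:R (Y x) * clip n%:R (W x) @[n --> \oo] --> Y x * W x.
  by apply: cvgM; exact: cvg_clip.
have cvabs (f : T -> R) : P.-integrable setT (EFin \o f) -> measurable_fun setT f ->
    (\int[P]_x `|clip n%:R (f x)|)%R @[n --> \oo] --> (\int[P]_x `|f x|)%R.
  move=> intf mf; apply: (@cvg_Rintegral_dominated _ _ _ P setT measurableT _ _ (fun x => `|f x|)) => //.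
  - by move=> n; apply: measurableT_comp => //; case: (bc f n mf).
  - exact: measurableT_comp.
  - by move=> x; apply: cvg_norm; exact: cvg_clip.
  - exact: integrable_norm.
  - by move=> n x; rewrite normr_id clip_le_id.
have cvid (f : T -> R) : P.-integrable setT (EFin \o f) -> measurable_fun setT f ->
    (\int[P]_x clip n%:R (f x))%R @[n --> \oo] --> (\int[P]_x f x)%R.
  move=> intf mf; apply: (@cvg_Rintegral_dominated _ _ _ P setT measurableT _ _ (fun x => `|f x|)) => //.
  - by move=> n; case: (bc f n mf).
  - by move=> x; exact: cvg_clip.
  - exact: integrable_norm.
  - by move=> n x; rewrite clip_le_id.
have iYW : P.-integrable setT (EFin \o (fun x => Y x * W x)).
  apply/integrableP; split; first exact/measurable_EFinP.
  have H := @fatou _ _ _ P setT measurableT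
    (fun n x => `|(clip n%:R (Y x) * clip n%:R (W x))|%:E).
  have -> : (\int[P]_x `|(EFin \o (fun x0 => (Y x0 * W x0)%R)) x| =
     \int[P]_x limn_einf (fun n => `|(clip n%:R (Y x) * clip n%:R (W x))%R|%:E))%E.
    apply: eq_integral => x _ /=.
    have cx : (`|(clip n%:R (Y x) * clip n%:R (W x))%R|%:E @[n --> \oo]
        --> `|Y x * W x|%:E)%E.
      by apply: cvg_EFin; [exact: nearW|apply: cvg_norm; exact: cv].
    rewrite is_cvg_limn_einfE; last by apply/cvg_ex; exists `|Y x * W x|%:E.
    exact/esym/cvg_lim.
  apply: le_lt_trans (H _ _) _.
  - move=> n; apply/measurable_EFinP; apply: measurableT_comp => //.
    by apply: measurable_funM; [case: (bc Y n)|case: (bc W n)].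
  - by move=> n x _; rewrite lee_fin.
  have L : (\int[P]_x `|(clip n%:R (Y x) * clip n%:R (W x))%R|%:E @[n --> \oo]
      --> ((\int[P]_x `|Y x|)%R * (\int[P]_x `|W x|)%R)%:E)%E.
    have -> : (fun n => \int[P]_x `|(clip n%:R (Y x) * clip n%:R (W x))%R|%:E)%E =
       (fun n => ((\int[P]_x `|clip n%:R (Y x)|)%R *
                  (\int[P]_x `|clip n%:R (W x)|)%R)%:E).
      apply/funext => n; rewrite -(prod_n n (fun y => `|y|) (@normr_measurable _ _) bn).
      rewrite /L2inner /Rintegral fineK.
        by apply: eq_integral => x _; rewrite normrM.
      apply: integrable_fin_num => //; apply: bm_integrable.
      by apply: bmM; apply/bn/bc.
    by apply: cvg_EFin; [exact: nearW|apply: cvgM; exact: cvabs].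
  rewrite is_cvg_limn_einfE; last by apply/cvg_ex; eexists; exact: L.
  by rewrite (cvg_lim _ L)// ltry.
split=> //.
have L1 : L2inner P setT (fun x => clip n%:R (Y x)) (fun x => clip n%:R (W x)) @[n --> \oo]
    --> L2inner P setT Y W.
  apply: (@cvg_Rintegral_dominated _ _ _ P setT measurableT _ _ (fun x => `|Y x * W x|)) => //.
  - by move=> n; apply: measurable_funM; [case: (bc Y n)|case: (bc W n)].
  - by apply: integrable_norm.
  - by move=> n x; rewrite !normrM; apply: ler_pM => //; exact: clip_le_id.
apply: (cvg_unique _ L1) => //.
have -> : (fun n => L2inner P setT (fun x => clip n%:R (Y x)) (fun x => clip n%:R (W x))) =
    (fun n => (\int[P]_x clip n%:R (Y x))%R * (\int[P]_x clip n%:R (W x))%R).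
  by apply/funext => n; apply: (prod_n n id).
by apply: cvgM; exact: cvid.
Qed.

End classes.
End independence.

(** * The filtration and the stochastic integral of a random walk *)

Section random_walk_integral.
Context {d : measure_display} {T : measurableType d} {R : realType}.
Variables (P : probability T R) (n : nat) (xi : nat -> {RV P >-> R}).
Implicit Types (X Y : T -> R) (Z : nat -> T -> R).
Local Notation sq := (sqint P setT).
Local Notation ip := (L2inner P setT).
Local Notation nrm := (L2norm P setT).

Definition walk_generators (i : nat) : set (set T) :=
  \bigcup_(j in [set j | (1 <= j <= i)%N]) g_sigma_algebra_preimage (xi j).

(** Adaptedness is phrased as measurability on the generated measurable space, so
    that the usual closure properties of measurable functions apply to it. *)
Definition adapted (i : nat) Y :=
  @measurable_fun _ _ (g_sigma_algebraType (walk_generators i)) R setT Y.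

Lemma adaptedP i Y :
  measurable_wrt setT (walk_filtration xi i) Y <-> adapted i Y.
Proof.
split=> [HY _ B mB|HY]; first by apply: HY; exists B.
by move=> _ [B mB <-]; exact: HY.
Qed.

Lemma adapted_le i j Y : (i <= j)%N -> adapted i Y -> adapted j Y.
Proof.
move=> ij HY _ B mB; have := HY measurableT B mB.
apply: sub_smallest2r; first exact: smallest_sigma_algebra.
move=> A [k /andP[k1 ki] Hk]; exists k => //=.
by rewrite k1 (leq_trans ki).
Qed.

Lemma adapted_step i j : (1 <= j <= i)%N -> adapted i (xi j).
Proof.
move=> ji _ B mB; apply: sub_sigma_algebra.
by exists j => //; exists B.
Qed.

Lemma adapted_cst i (c : R) : adapted i (fun=> c).
Proof. exact: measurable_cst. Qed.

Lemma adaptedD i X Y : adapted i X -> adapted i Y -> adapted i (X + Y).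
Proof. by move=> hX hY; apply: measurable_funD. Qed.

Lemma adaptedB i X Y : adapted i X -> adapted i Y -> adapted i (X - Y).
Proof. by move=> hX hY; apply: measurable_funB. Qed.

Lemma adaptedM i X Y : adapted i X -> adapted i Y -> adapted i (fun w => X w * Y w).
Proof. by move=> hX hY; apply: measurable_funM. Qed.

Lemma adapted_comp i (h : R -> R) Y : measurable_fun setT h ->
  adapted i Y -> adapted i (fun w => h (Y w)).
Proof. by move=> mh mY; apply: measurableT_comp. Qed.

Hypothesis xi_indep : mutually_independent P (fun i => xi i.+1 : T -> R).

(** Products of indicators of finitely many steps generate the past and are
    closed under products, as [independent_bounded] requires. *)
Definition cylinder (B : nat -> set R) (i : nat) : T -> R :=
  fun w => \prod_(k < i) \1_(B k) (xi k.+1 w).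

Lemma cylinderE B i : cylinder B i =
  \1_(\bigcap_(k in [set` iota 0 i]) (xi k.+1 @^-1` B k)).
Proof.
apply/funext => w; rewrite /cylinder indicE.
have [/set_mem Hw|nw] := boolP (w \in _).
  rewrite big1// => k _; rewrite indicE mem_set//.
  by apply: Hw; rewrite /= mem_iota add0n ltn_ord.
have [k [ki Hk]] : exists k, (k < i)%N /\ ~ B k (xi k.+1 w).
  apply: contrapT => /forallNP H; move/negP: nw; apply; apply/mem_set => k /=.
  by rewrite mem_iota /= => ki; apply: contrapT => nB; apply: (H k).
by rewrite (bigD1 (Ordinal ki))//= indicE memNset// mul0r.
Qed.

Lemma cylinder_measurable B i : (forall k, measurable (B k)) ->
  measurable (\bigcap_(k in [set` iota 0 i]) (xi k.+1 @^-1` B k)).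
Proof.
move=> mB; apply: bigcap_measurableType => k _.
by rewrite -[X in measurable X]setTI; exact: measurable_funP.
Qed.

Lemma cylinder_bm B i : (forall k, measurable (B k)) ->
  bounded_measurable (cylinder B i).
Proof. by move=> mB; rewrite cylinderE; apply: bm_indic; exact: cylinder_measurable. Qed.

Lemma Rintegral_indic (A : set T) : measurable A -> (\int[P]_w \1_A w)%R = fine (P A).
Proof. by move=> mA; rewrite /Rintegral integral_indic// setIT. Qed.

Lemma integral_cylinder B i : (forall k, measurable (B k)) ->
  (\int[P]_w cylinder B i w)%R = \prod_(k < i) fine (P (xi k.+1 @^-1` B k)).
Proof.
move=> mB; rewrite cylinderE Rintegral_indic; last exact: cylinder_measurable.
rewrite xi_indep ?iota_uniq//.
rewrite -(big_mkord xpredT (fun k => fine (P (xi k.+1 @^-1` B k)))).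
rewrite /index_iota subn0; elim: (iota 0 i) => [|k s IH]; first by rewrite !big_nil.
have mk : measurable (xi k.+1 @^-1` B k).
  by rewrite -[X in measurable X]setTI; exact: measurable_funP.
rewrite !big_cons fineM; first by rewrite IH.
  exact: fin_num_measure.
rewrite big_seq; elim/big_ind : _ => //; first exact: fin_numM.
move=> j _; apply: fin_num_measure.
by rewrite -[X in measurable X]setTI; exact: measurable_funP.
Qed.

(** The step i+1 is independent of the sigma-field of the first i steps. The
    function h is there to apply it to the rotations (1 + ix) e^(-ix) as well. *)
Lemma walk_indep i Y (h : R -> R) : adapted i Y ->
  P.-integrable setT (EFin \o Y) -> measurable_fun setT h ->
  P.-integrable setT (EFin \o (fun w => h (xi i.+1 w))) ->
  P.-integrable setT (EFin \o (fun w => Y w * h (xi i.+1 w))) /\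
  ip Y (fun w => h (xi i.+1 w)) = (\int[P]_w Y w)%R * (\int[P]_w h (xi i.+1 w))%R.
Proof.
move=> aY iY mh ih.
pose K1 k := exists B, (forall k, measurable (B k)) /\ k = cylinder B i.
pose K2 (k : T -> R) := exists A : set R, measurable A /\ k = (fun w => \1_A (xi i.+1 w)).
apply: (@independent_integrable _ _ _ P K1 K2 (walk_generators i)
  (preimage_set_system setT (xi i.+1) measurable)) => //.
- by move=> _ [B [mB ->]]; exact: cylinder_bm.
- move=> _ [A [mA ->]]; split; last first.
    by exists 1 => w; rewrite indicE; case: (_ \in _); rewrite ?normr1 ?normr0.
  exact: measurableT_comp.
- exists (fun=> setT); split=> //; apply/funext => w.
  by rewrite /cylinder big1// => k _; rewrite indicE in_setT.
- by exists setT; split=> //; apply/funext => w; rewrite indicE in_setT.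
- move=> _ _ [B [mB ->]] [B' [mB' ->]]; exists (fun k => B k `&` B' k); split.
    by move=> k; exact: measurableI.
  apply/funext => w; rewrite /cylinder -big_split/=.
  by apply: eq_bigr => k _; rewrite indicI.
- move=> _ _ [A [mA ->]] [A' [mA' ->]]; exists (A `&` A'); split.
    exact: measurableI.
  by apply/funext => w; rewrite indicI.
- move=> _ [[//|j] /andP[_ ji] [A mA <-]].
  pose B k := if k == j then A else setT.
  exists (cylinder B i), [set 1]; split; last 2 first.
  - exact: measurable_set1.
  - rewrite setTI; apply/seteqP; split => w /=.
      move=> Aw; rewrite /cylinder big1// => k _; rewrite indicE mem_set// /B.
      by case: ifP => // /eqP ->.
    rewrite /cylinder (bigD1 (Ordinal ji))//= /B eqxx indicE.
    have [/set_mem//|_] := boolP (xi j.+1 w \in A).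
    by rewrite mul0r => /eqP; rewrite eq_sym oner_eq0.
  by exists B; split=> // k; rewrite /B; case: ifP.
- move=> _ [A mA <-]; exists (fun w => \1_A (xi i.+1 w)), [set 1]; split.
  - by exists A.
  - exact: measurable_set1.
  - rewrite setTI; apply/seteqP; split => w /= => [Aw|].
      by rewrite indicE mem_set.
    rewrite indicE; have [/set_mem//|_] := boolP (xi i.+1 w \in A).
    by move=> /eqP; rewrite eq_sym oner_eq0.
- move=> _ _ [B [mB ->]] [A [mA ->]].
  pose B' k := if k == i then A else B k.
  have mB' k : measurable (B' k) by rewrite /B'; case: ifP.
  have BE : cylinder B' i.+1 = (fun w => cylinder B i w * \1_A (xi i.+1 w)).
    apply/funext => w; rewrite /cylinder big_ord_recr/= {2}/B' eqxx; congr (_ * _).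
    by apply: eq_bigr => k _; rewrite /B' ltn_eqF.
  have -> : ip (cylinder B i) (fun w => \1_A (xi i.+1 w)) =
      (\int[P]_w cylinder B' i.+1 w)%R by rewrite BE.
  rewrite !integral_cylinder// big_ord_recr/= {2}/B' eqxx; congr (_ * _).
    by apply: eq_bigr => k _; rewrite /B' ltn_eqF.
  rewrite -Rintegral_indic//.
  by rewrite -[X in measurable X]setTI; exact: measurable_funP.
- by move=> _ B mB; apply: sub_sigma_algebra; exists (h @^-1` B) => //;
    rewrite -[X in measurable X]setTI; exact: mh.
Qed.

Hypothesis xi_sq : forall i, (1 <= i)%N -> sq (xi i).
Hypothesis xi_mean : forall i, (1 <= i)%N -> (\int[P]_w xi i w)%R = 0.
Hypothesis xi_var : forall i, (1 <= i)%N -> (\int[P]_w (xi i w ^+ 2))%R = 1.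

(** The step has second moment one and is independent of the past, so
    multiplication by it preserves the norm. *)
Lemma sqint_mul_step i Y : adapted i Y -> sq Y ->
  sq (fun w => Y w * xi i.+1 w) /\
  nrm (fun w => Y w * xi i.+1 w) ^+ 2 = nrm Y ^+ 2.
Proof.
move=> aY sY; have [mY Y2] := sY.
have [||||iYX EYX] := @walk_indep i (fun w => Y w ^+ 2) (fun x => x ^+ 2).
- by apply: (@adapted_comp _ (fun x => x ^+ 2)) => //; exact: exprn_measurable.
- exact: Y2.
- exact: exprn_measurable.
- exact: (xi_sq (ltn0Sn i)).2.
have E : (fun w => (Y w * xi i.+1 w) ^+ 2) = (fun w => Y w ^+ 2 * xi i.+1 w ^+ 2).
  by apply/funext => w; rewrite exprMn.
split.
  split; first by apply: measurable_funM.
  by rewrite E.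
rewrite !nrm_sqr /L2inner; under eq_Rintegral do rewrite -expr2 exprMn.
rewrite -[LHS]/(ip _ _) EYX xi_var// mulr1.
by apply: eq_Rintegral => w _; rewrite expr2.
Qed.

Lemma ip_step_orth i X Y : adapted i X -> sq X -> adapted i Y -> sq Y ->
  ip X (fun w => Y w * xi i.+1 w) = 0.
Proof.
move=> aX sX aY sY.
have [||||_ H] := @walk_indep i (fun w => X w * Y w) id.
- exact: adaptedM.
- exact: sqint_integrableM.
- exact: measurable_id.
- exact/sqint_integrable/xi_sq.
transitivity (ip (fun w => X w * Y w) (xi i.+1)).
  by apply: eq_Rintegral => w _; rewrite mulrA.
by rewrite H xi_mean// mulr0.
Qed.

Definition walk_integral Z (N : nat) : T -> R :=
  fun w => \sum_(1 <= i < N.+1) Z i w * (xi i w / Num.sqrt n%:R).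

Lemma walk_integralS Z N : walk_integral Z N.+1 =
  walk_integral Z N + (fun w => (Num.sqrt n%:R)^-1 * (Z N.+1 w * xi N.+1 w)).
Proof.
apply/funext => w; rewrite /walk_integral big_nat_recr//=.
by congr (_ + _); rewrite mulrA mulrC.
Qed.

Lemma walk_integral0 Z : walk_integral Z 0 = 0.
Proof. by apply/funext => w; rewrite /walk_integral big_geq. Qed.

Definition predictable_sq Z :=
  forall i, (1 <= i)%N -> sq (Z i) /\ adapted i.-1 (Z i).

Lemma walk_integral_adapted Z N : predictable_sq Z ->
  adapted N (walk_integral Z N) /\ sq (walk_integral Z N).
Proof.
move=> pZ; elim: N => [|N [aI sI]].
  by rewrite walk_integral0; split; [exact: adapted_cst|exact: sqint0].
have [sZ aZ] := pZ N.+1 isT.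
rewrite walk_integralS; split.
- apply: adaptedD; first exact: adapted_le aI.
  apply: adaptedM; first exact: adapted_cst.
  apply: adaptedM; first exact: adapted_le aZ.
  by apply: adapted_step; rewrite leqnn.
- apply: sqintD => //; apply: sqintZ => //.
  exact: (sqint_mul_step aZ sZ).1.
Qed.

(** Induction on N: the new increment has the right norm by [sqint_mul_step] and
    is orthogonal to the past by [ip_step_orth]. *)
Lemma walk_integral_isometry Z N : predictable_sq Z ->
  nrm (walk_integral Z N) ^+ 2 = n%:R^-1 * \sum_(1 <= i < N.+1) nrm (Z i) ^+ 2.
Proof.
move=> pZ; elim: N => [|N IH].
  by rewrite walk_integral0 nrm0// big_geq// expr0n mulr0.
have [aI sI] := walk_integral_adapted N pZ.
have [sZ aZ] := pZ N.+1 isT.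
have [sZX nZX] := sqint_mul_step aZ sZ.
rewrite walk_integralS big_nat_recr//= mulrDr -IH -nZX !nrm_sqr.
have sZX' : sq (fun w => (Num.sqrt n%:R)^-1 * (Z N.+1 w * xi N.+1 w)) by exact: sqintZ.
rewrite ipDl ?ipDr//; last exact: sqintD.
rewrite (ipC _ _ _ (walk_integral Z N)) ipZr// ip_step_orth// mulr0 addr0 add0r.
rewrite ipZl// ipZr// !mulrA -expr2 exprVn sqr_sqrtr//.
Qed.

End random_walk_integral.

(** * Functions of time and chance *)

Section time_space.
Context {d : measure_display} {T : measurableType d} {R : realType}.
Variable P : probability T R.
Local Notation tm := (time_measure P).
Local Notation ts := (@time_space d T R).
Local Notation leb := (@lebesgue_measure R).
Implicit Types (a b : T -> R).

Lemma measurable_time_space : measurable ts.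
Proof. exact: measurableX. Qed.

Local Notation mts := measurable_time_space.

Definition tensor a (I : set R) : T * measurableTypeR R -> R :=
  fun x => a x.1 * \1_I x.2.

Lemma measurable_tensor a I : measurable_fun setT a -> measurable I ->
  measurable_fun setT (tensor a I).
Proof.
move=> ma mI; apply: measurable_funM.
  exact: measurableT_comp.
exact: measurableT_comp (measurable_indic mI) measurable_snd.
Qed.

Lemma integral_tensor a (I : set R) :
  measurable_fun setT a -> (forall w, 0 <= a w) ->
  measurable I -> I `<=` `[0, +oo[ ->
  (\int[tm]_(x in ts) (tensor a I x)%:E = (\int[P]_w (a w)%:E) * leb I)%E.
Proof.
move=> ma a0 mI I0.
rewrite integral_mkcond.
rewrite (eq_integral (fun x => (tensor a I x)%:E)); last first.
  move=> x _; rewrite patchE; case: ifPn => // /negP nx.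
  rewrite /tensor indicE memNset ?mulr0// => Ix; apply: nx; apply/mem_set.
  by split => //; exact: I0.
rewrite fubini_tonelli1; last 2 first.
- by apply/measurable_EFinP; exact: measurable_tensor.
- by move=> x; rewrite lee_fin /tensor mulr_ge0// indicE; case: (_ \in _).
rewrite -ge0_integralZr//; last 2 first.
- exact/measurable_EFinP.
- by move=> w _; rewrite lee_fin.
apply: eq_integral => w _; rewrite /fubini_F /tensor /=.
under eq_integral do rewrite EFinM.
rewrite ge0_integralZl//; last 2 first.
- exact/measurable_EFinP/measurable_indic.
- by rewrite lee_fin.
by rewrite integral_indic// setIT.
Qed.

(** Tonelli for a product function. *)
Lemma sqint_tensor a (I : set R) (c : R) : sqint P setT a ->
  measurable I -> I `<=` `[0, +oo[ -> leb I = c%:E ->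
  sqint tm ts (tensor a I) /\ L2norm tm ts (tensor a I) ^+ 2 = L2norm P setT a ^+ 2 * c.
Proof.
move=> sa mI I0 Ic.
have mt : measurable_fun ts (tensor a I).
  by apply: measurable_funTS; apply: measurable_tensor => //; case: sa.
have E : (\int[tm]_(x in ts) (tensor a I x ^+ 2)%:E =
    (L2norm P setT a ^+ 2 * c)%:E)%E.
  rewrite (_ : (fun x => _) = (fun x => (tensor (fun w => a w ^+ 2) I x)%:E)).
    rewrite integral_tensor//; last by move=> w; exact: sqr_ge0.
      by rewrite Ic -nrm_sqrE.
    by apply: measurable_funX; case: sa.
  apply/funext => x; rewrite /tensor exprMn indicE.
  by case: (_ \in _); rewrite ?expr1n ?expr0n.
have [] := @sqint_int_le _ _ _ tm ts mts (tensor a I) (L2norm P setT a ^+ 2 * c) mt.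
  by rewrite E.
move=> st _; split=> //; apply: EFin_inj.
by rewrite (nrm_sqrE mts st).
Qed.

Lemma lebesgue_itvoc (s t : R) : s <= t -> leb `]s, t] = (t - s)%:E.
Proof.
move=> st; rewrite lebesgue_measure_itv/= lte_fin.
by case: ltP => // ts; rewrite (_ : t - s = 0)//; apply/eqP; rewrite subr_eq0 eq_le ts.
Qed.

Lemma itvoc_pos (s t : R) : 0 <= s -> `]s, t] `<=` `[0, +oo[%classic.
Proof. by move=> s0 x /=; rewrite !in_itv/= andbT => /andP[sx _]; exact/ltW/(le_lt_trans s0). Qed.

Section ceil.
Variable n : nat.
Hypothesis n1 : (1 <= n)%N.
Implicit Type Z : nat -> T -> R.

Let n0 : 0 < n%:R :> R. Proof. by rewrite ltr0n. Qed.

(** The times t with ceil(nt) = i. *)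
Definition cell (i : nat) : set R := `]i.-1%:R / n%:R, i%:R / n%:R]%classic.

Lemma cellP i (u : R) : (1 <= i)%N -> 0 <= u ->
  cell i u <-> `|Num.ceil (n%:R * u)|%N = i.
Proof.
case: i => // i _ u0; rewrite /cell /= in_itv/=.
rewrite ltr_pdivrMr// ler_pdivlMr// (mulrC u).
have c0 : 0 <= n%:R * u by rewrite mulr_ge0.
have := ceil_itv (n%:R * u).
have : (0 <= Num.ceil (n%:R * u))%R by rewrite ceil_ge0 (lt_le_trans _ c0) ?ltrN10.
move: (Num.ceil _) => [k|//] _ /=.
move=> /andP[h1 h2]; split=> [/andP[h3 h4]|ki].
  apply/eqP; rewrite eqn_leq; apply/andP; split.
    rewrite -ltnS -(ltr_nat R); move: h1; move=> h1.
    by rewrite -natr1; move: h1 h4; lra.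
  rewrite -(ltr_nat R); apply: lt_le_trans h3 _.
  exact: h2.
have e : i.+1%:R - 1 = i%:R :> R by rewrite -natr1 addrK.
by move: h1 h2; rewrite ki intrB => h1 h2; apply/andP; split; [rewrite -e|].
Qed.

Lemma cell0P (u : R) : 0 <= u -> `|Num.ceil (n%:R * u)|%N = 0%N ->
  forall i, (1 <= i)%N -> ~ cell i u.
Proof. by move=> u0 c0 i i1 /cellP; rewrite c0 => /(_ i1 u0) i0; rewrite -i0 in i1. Qed.

(** The embedded process cut after N cells, a finite sum of tensors: the embedding
    itself is the pointwise limit of these. *)
Definition ceil_sum Z (N : nat) : T * measurableTypeR R -> R :=
  fun x => \sum_(1 <= i < N.+1) tensor (Z i) (cell i) x.

Lemma sum_cells (F : nat -> R) (k N : nat) (u : R) : 0 <= u ->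
  `|Num.ceil (n%:R * u)|%N = k -> (k <= N)%N ->
  \sum_(1 <= i < N.+1) F i * \1_(cell i) u = if k == 0%N then 0 else F k.
Proof.
move=> u0 uk kN; case: (posnP k) => [k0|k0].
  rewrite big_nat big1// => i /andP[i1 _].
  by rewrite indicE memNset ?mulr0//; apply: cell0P => //; rewrite uk k0.
rewrite (bigD1_seq k) ?mem_index_iota ?iota_uniq ?k0 ?ltnS//=.
rewrite indicE mem_set; last exact/cellP.
rewrite mulr1 big_nat_cond big1 ?addr0// => i /andP[/andP[i1 _] ik].
rewrite indicE memNset ?mulr0// => /(cellP i1 u0).
by rewrite uk => ki; rewrite ki eqxx in ik.
Qed.

Lemma ceil_sumE Z (N : nat) x : Z 0%N = cst 0 -> 0 <= x.2 ->
  (`|Num.ceil (n%:R * x.2)| <= N)%N -> ceil_sum Z N x = ceil_process n Z x.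
Proof.
move=> Z0 u0 kN; rewrite /ceil_sum /tensor /ceil_process.
rewrite (@sum_cells (fun i => Z i x.1) _ N x.2 u0 erefl kN).
by case: ifP => // /eqP ->; rewrite Z0.
Qed.

Lemma cvg_ceil_sum Z x : Z 0%N = cst 0 -> 0 <= x.2 ->
  ceil_sum Z N x @[N --> \oo] --> ceil_process n Z x.
Proof.
move=> Z0 x0; apply: cvg_near_cst; exists `|Num.ceil (n%:R * x.2)|%N => // N /= kN.
exact: ceil_sumE.
Qed.

Lemma measurable_cell i : measurable (cell i).
Proof. exact: measurable_itv. Qed.

Lemma cell_pos i : cell i `<=` `[0, +oo[%classic.
Proof. by apply: itvoc_pos; rewrite divr_ge0. Qed.

Lemma lebesgue_cell i : (1 <= i)%N -> leb (cell i) = (n%:R^-1)%:E.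
Proof.
case: i => // i _; rewrite lebesgue_itvoc/=; last by rewrite ler_pM2r ?invr_gt0// ler_nat.
by rewrite -mulrBl -natr1 addrAC subrr add0r mul1r.
Qed.

Lemma ts_pos x : ts x -> 0 <= x.2.
Proof. by move=> [_ /=]; rewrite in_itv/= andbT. Qed.

Definition sq_seq Z := Z 0%N = cst 0 /\ forall i, (1 <= i)%N -> sqint P setT (Z i).

Lemma measurable_ceil Z : sq_seq Z -> measurable_fun ts (ceil_process n Z).
Proof.
move=> [Z0 sZ]; apply: (measurable_fun_cvg (h := ceil_sum Z)); last first.
  by move=> x /ts_pos x0; exact: cvg_ceil_sum.
move=> N; apply: (@measurable_sum _ _ R ts _ (index_iota 1 N.+1) (fun i x => tensor (Z i) (cell i) x)) => i.
apply: measurable_funTS; apply: measurable_tensor; last exact: measurable_cell.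
case: i => [|i]; first by rewrite Z0; exact: measurable_cst.
by case: (sZ i.+1 isT).
Qed.

(** The squared norm of the embedded process, an extended real because only the
    integrability of the stochastic integral makes it finite. *)
Definition energy Z : \bar R :=
  (\sum_(i <oo) (n%:R^-1 * L2norm P setT (Z i.+1) ^+ 2)%:E)%E.

(** The cells are disjoint, so the square of the process is a series of tensors. *)
Lemma integral_ceil_sqr Z : sq_seq Z ->
  (\int[tm]_(x in ts) (ceil_process n Z x ^+ 2)%:E = energy Z)%E.
Proof.
move=> [Z0 sZ].
have mZ i : measurable_fun setT (Z i).
  case: i => [|i]; first by rewrite Z0; exact: measurable_cst.
  by case: (sZ i.+1 isT).
pose F i x := tensor (fun w => Z i w ^+ 2) (cell i) x.
have F0 i x : 0 <= F i x by rewrite /F /tensor mulr_ge0 ?sqr_ge0// indicE; case: (_ \in _).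
have E x : ts x -> ((ceil_process n Z x ^+ 2)%:E = \sum_(i <oo) (F i.+1 x)%:E)%E.
  move=> /ts_pos x0; apply/esym/cvg_lim => //.
  apply: cvg_near_cst; exists `|Num.ceil (n%:R * x.2)|%N => // N /= kN.
  rewrite sumEFin -(big_add1 _ _ 0%N N.+1 xpredT (fun i => F i x)); congr EFin.
  rewrite (@sum_cells (fun i => Z i x.1 ^+ 2) _ N x.2 x0 erefl kN) /ceil_process.
  by case: ifP => // /eqP ->; rewrite Z0 expr0n.
rewrite (eq_integral (fun x => (\sum_(i <oo) (F i.+1 x)%:E)%E)); last first.
  by move=> x /set_mem; exact: E.
rewrite integral_nneseries; last 3 first.
- exact: mts.
- move=> k; apply/measurable_EFinP; apply: measurable_funTS; apply: measurable_tensor.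
    exact: measurable_funX.
  exact: measurable_cell.
- by move=> k x _; rewrite lee_fin.
apply: eq_eseriesr => i _.
rewrite integral_tensor; last 4 first.
- exact: measurable_funX.
- by move=> w; exact: sqr_ge0.
- exact: measurable_cell.
- exact: cell_pos.
by rewrite lebesgue_cell// -(nrm_sqrE measurableT (sZ i.+1 isT)) -EFinM mulrC.
Qed.

End ceil.
End time_space.

(** * The discrete Ito isometry *)

Section walk_pairs.
Context {d : measure_display} {T : measurableType d} {R : realType}.
Variables (P : probability T R) (n : nat) (xi : nat -> {RV P >-> R}).
Hypothesis n1 : (1 <= n)%N.
Local Notation tm := (time_measure P).
Local Notation ts := (@time_space d T R).
Local Notation mts := (@measurable_time_space d T R).
Local Notation sq := (sqint P setT).
Local Notation ceil := (ceil_process n).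
Implicit Types (X W : T -> R) (Z Y : nat -> T -> R).

Definition standard_steps : Prop :=
  [/\ mutually_independent P (fun i => xi i.+1 : T -> R),
      (forall i, (1 <= i)%N -> sq (xi i)),
      (forall i, (1 <= i)%N -> (\int[P]_w xi i w)%R = 0) &
      (forall i, (1 <= i)%N -> (\int[P]_w (xi i w ^+ 2))%R = 1)].

Hypothesis xi_std : standard_steps.

(** The discrete integrand Z and its integral X over an infinite horizon, as the
    limit of the partial sums. *)
Definition walk_pair Z X : Prop :=
  [/\ Z 0%N = cst 0, predictable_sq xi Z, sq X &
      L2norm P setT (walk_integral n xi Z N - X) @[N --> \oo] --> 0].

Lemma predictable_sq_seq Z : Z 0%N = cst 0 -> predictable_sq xi Z -> sq_seq P Z.
Proof. by move=> Z0 pZ; split=> // i i1; case: (pZ i i1). Qed.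

Lemma sqint_ceil Z (c : R) : sq_seq P Z -> energy P n Z = c%:E ->
  sqint tm ts (ceil Z) /\ L2norm tm ts (ceil Z) ^+ 2 = c.
Proof.
move=> sZ eZ; have E := integral_ceil_sqr n1 sZ.
have [] := @sqint_int_le _ _ _ tm ts mts (ceil Z) c (measurable_ceil n1 sZ).
  by rewrite E eZ.
move=> sc _; split=> //; apply: EFin_inj.
by rewrite (nrm_sqrE mts sc) E.
Qed.

Lemma energyD Z Y (a b : R) : energy P n Z = a%:E -> energy P n Y = b%:E ->
  sq_seq P Z -> sq_seq P Y ->
  (forall i, (1 <= i)%N -> L2inner P setT (Z i) (Y i) = 0) ->
  energy P n (fun i => Z i + Y i) = (a + b)%:E.
Proof.
move=> eZ eY [_ sZ] [_ sY] ZY; rewrite EFinD -eZ -eY /energy -nneseriesD; last 2 first.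
- by move=> i _ _; rewrite lee_fin mulr_ge0 ?invr_ge0 ?sqr_ge0.
- by move=> i _ _; rewrite lee_fin mulr_ge0 ?invr_ge0 ?sqr_ge0.
apply: eq_eseriesr => i _; rewrite -EFinD -mulrDr; congr (_ * _)%:E.
have [sZi sYi] := (sZ i.+1 isT, sY i.+1 isT).
rewrite !nrm_sqr ipDl ?ipDr//; last exact: sqintD.
by rewrite (ipC _ _ (Y i.+1)) ZY// addr0 add0r.
Qed.

(** Orthogonality of all coordinates gives orthogonality of the embeddings; it is
    read off from the additivity of the energies, which avoids a second series. *)
Lemma ceil_orth Z Y (a b : R) : energy P n Z = a%:E -> energy P n Y = b%:E ->
  sq_seq P Z -> sq_seq P Y ->
  (forall i, (1 <= i)%N -> L2inner P setT (Z i) (Y i) = 0) ->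
  L2inner tm ts (ceil Z) (ceil Y) = 0.
Proof.
move=> eZ eY sZ sY ZY.
have [scZ nZ] := sqint_ceil sZ eZ; have [scY nY] := sqint_ceil sY eY.
have sZY : sq_seq P (fun i => Z i + Y i).
  case: (sZ) (sY) => Z0 sZi [Y0 sYi]; split.
    by rewrite Z0 Y0; apply/funext => w; exact: addr0.
  by move=> i i1; apply: sqintD => //; [exact: sZi|exact: sYi].
have [_] := sqint_ceil sZY (energyD eZ eY sZ sY ZY).
rewrite -nZ -nY !nrm_sqr.
rewrite (_ : ceil (fun i => Z i + Y i) = ceil Z + ceil Y)//.
rewrite (ipDl mts scZ scY (sqintD mts scZ scY)) !(ipDr mts scZ scY)//.
rewrite (ipC _ _ (ceil Y) (ceil Z)); lra.
Qed.

Lemma energy_finite Z (m : nat) : (forall i, (m < i)%N -> Z i = cst 0) ->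
  energy P n Z = (n%:R^-1 * \sum_(1 <= i < m.+1) L2norm P setT (Z i) ^+ 2)%:E.
Proof.
move=> Zm; apply/cvg_lim => //; apply: cvg_near_cst; exists m => // N /= mN.
rewrite sumEFin -mulr_sumr.
rewrite -(big_add1 _ _ 0%N N.+1 xpredT (fun i => L2norm P setT (Z i) ^+ 2)).
rewrite (big_cat_nat (n := m.+1))//= [X in _ + X]big_nat_cond [X in _ + X]big1 ?addr0//.
by move=> i /andP[/andP[mi _] _]; rewrite Zm// -[cst 0]/(0 : T -> R) nrm0 ?expr0n.
Qed.

Lemma walk_pair_energy Z X : walk_pair Z X -> energy P n Z = (L2norm P setT X ^+ 2)%:E.
Proof.
move=> [Z0 pZ sX cX]; have [i1 i2 i3 i4] := xi_std.
apply/cvg_lim => //.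
have -> : (fun N => \sum_(0 <= i < N) (n%:R^-1 * L2norm P setT (Z i.+1) ^+ 2)%:E)%E =
    (fun N => (L2norm P setT (walk_integral n xi Z N) ^+ 2)%:E).
  apply/funext => N; rewrite sumEFin -mulr_sumr walk_integral_isometry//.
  by rewrite big_add1.
apply: cvg_EFin; first exact: nearW.
have sI N : sq (walk_integral n xi Z N) by exact: (walk_integral_adapted n i1 i2 i4 N pZ).2.
have := cvg_ip measurableT sI sI sX sX cX cX.
by under eq_fun do rewrite -nrm_sqr; rewrite -nrm_sqr.
Qed.

(** The discrete Ito isometry, for the embedding of the integrand into functions of
    time and chance. *)
Lemma walk_pair_ceil Z X : walk_pair Z X ->
  sqint tm ts (ceil Z) /\ L2norm tm ts (ceil Z) = L2norm P setT X.
Proof.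
move=> pZX; have [Z0 pZ sX cX] := pZX.
have [||sc nc] := @sqint_ceil Z (L2norm P setT X ^+ 2).
- exact: predictable_sq_seq.
- exact: walk_pair_energy.
split=> //; apply/eqP; rewrite -(@eqrXn2 _ 2)// ?nrm_ge0//.
exact/eqP.
Qed.

Lemma walk_integralD Z Y N :
  walk_integral n xi (fun i => Z i + Y i) N = walk_integral n xi Z N + walk_integral n xi Y N.
Proof.
apply/funext => w.
transitivity (walk_integral n xi Z N w + walk_integral n xi Y N w) => //.
by rewrite /walk_integral -big_split; apply: eq_bigr => i _ /=; rewrite -mulrDl.
Qed.

Lemma walk_integralZ (c : R) Z N :
  walk_integral n xi (fun i w => c * Z i w) N = (fun w => c * walk_integral n xi Z N w).
Proof.
apply/funext => w; rewrite /walk_integral mulr_sumr.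
by apply: eq_bigr => i _; rewrite -mulrA.
Qed.

Lemma walk_pairD Z Y X W : walk_pair Z X -> walk_pair Y W ->
  walk_pair (fun i => Z i + Y i) (X + W).
Proof.
have [i1 i2 i3 i4] := xi_std.
move=> [Z0 pZ sX cX] [Y0 pY sW cW].
have sIZ N : sq (walk_integral n xi Z N) by exact: (walk_integral_adapted n i1 i2 i4 N pZ).2.
have sIY N : sq (walk_integral n xi Y N) by exact: (walk_integral_adapted n i1 i2 i4 N pY).2.
split.
- by rewrite Z0 Y0; apply/funext => w; exact: addr0.
- move=> i i_1; have [sZ aZ] := pZ i i_1; have [sY aY] := pY i i_1.
  by split; [exact: sqintD|exact: adaptedD].
- exact: sqintD.
- apply: (squeeze_cvgr (f := cst 0) (h := fun N =>
    L2norm P setT (walk_integral n xi Z N - X) + L2norm P setT (walk_integral n xi Y N - W))).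
  + apply: nearW => N; rewrite nrm_ge0/= walk_integralD opprD addrACA.
    by apply: nrmD => //; exact: sqintB.
  + exact: cvg_cst.
  + by rewrite -[X in _ --> X]addr0; exact: cvgD.
Qed.

Lemma walk_pairZ (c : R) Z X : walk_pair Z X ->
  walk_pair (fun i w => c * Z i w) (fun w => c * X w).
Proof.
have [i1 i2 i3 i4] := xi_std.
move=> [Z0 pZ sX cX].
have sIZ N : sq (walk_integral n xi Z N) by exact: (walk_integral_adapted n i1 i2 i4 N pZ).2.
split.
- by rewrite Z0; apply/funext => w; rewrite mulr0.
- move=> i i_1; have [sZ aZ] := pZ i i_1; split; first exact: sqintZ.
  by apply: adaptedM => //; exact: adapted_cst.
- exact: sqintZ.
- have -> : (fun N => L2norm P setT (walk_integral n xi (fun i w => c * Z i w) N -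
      (fun w => c * X w))) = (fun N => `|c| * L2norm P setT (walk_integral n xi Z N - X)).
    apply/funext => N; rewrite walk_integralZ -nrmZ//; last exact: sqintB.
    by congr L2norm; apply/funext => w; rewrite mulrBr.
  by rewrite -[X in _ --> X](mulr0 `|c|); apply: cvgM => //; exact: cvg_cst.
Qed.

(** Polarisation of the isometry. *)
Lemma walk_pair_ip Z Y X W : walk_pair Z X -> walk_pair Y W ->
  L2inner tm ts (ceil Z) (ceil Y) = L2inner P setT X W.
Proof.
move=> pZ pY.
have [scZ nZ] := walk_pair_ceil pZ; have [scY nY] := walk_pair_ceil pY.
have [scS nS] := walk_pair_ceil (walk_pairD pZ pY).
have [_ _ sX _] := pZ; have [_ _ sW _] := pY.
have := congr1 (fun x => x ^+ 2) nS; have := congr1 (fun x => x ^+ 2) nZ.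
have := congr1 (fun x => x ^+ 2) nY.
rewrite (_ : ceil (fun i => Z i + Y i) = ceil Z + ceil Y)// !nrm_sqr.
rewrite (ipDl mts scZ scY (sqintD mts scZ scY)) !(ipDr mts scZ scY)//.
rewrite (ipDl measurableT sX sW (sqintD measurableT sX sW)) !(ipDr measurableT sX sW)//.
rewrite (ipC _ _ (ceil Y) (ceil Z)) (ipC _ _ W X); lra.
Qed.

Lemma walk_pair_mean Z X : walk_pair Z X -> (\int[P]_w X w)%R = 0.
Proof.
have [i1 i2 i3 i4] := xi_std.
move=> [Z0 pZ sX cX].
have sI N : sq (walk_integral n xi Z N) by exact: (walk_integral_adapted n i1 i2 i4 N pZ).2.
have := cvg_ipl measurableT sI sX (sqint_cst P 1) cX; rewrite ip_cst1 => H.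
apply: (cvg_unique _ H) => //.
rewrite (_ : (fun N => _) = cst 0); first exact: cvg_cst.
apply/funext => N /=; elim: N => [|N IH].
  by rewrite walk_integral0 ip_cst1 Rintegral_prob_cst.
have [sZ aZ] := pZ N.+1 isT.
have [sZX _] := sqint_mul_step i1 i2 i4 aZ sZ.
rewrite walk_integralS ipDl//; [|exact: sqintZ|exact: sqint_cst].
rewrite IH ipZl//; last exact: sqint_cst.
rewrite ipC (ip_step_orth i1 i2 i3)//; first by rewrite mulr0 addr0.
- exact: adapted_cst.
- exact: sqint_cst.
Qed.

Lemma walk_pair_finite Z m : Z 0%N = cst 0 -> predictable_sq xi Z ->
  (forall i, (m < i)%N -> Z i = cst 0) -> walk_pair Z (walk_integral n xi Z m).
Proof.
have [i1 i2 i3 i4] := xi_std.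
move=> Z0 pZ Zm; split=> //.
  exact: (walk_integral_adapted n i1 i2 i4 m pZ).2.
apply: cvg_near_cst; exists m => // N /= mN.
have -> : walk_integral n xi Z N = walk_integral n xi Z m.
  rewrite -(subnK mN); elim: (N - m)%N => [//|k IH].
  rewrite addSn walk_integralS IH Zm; last by rewrite ltnS leq_addl.
  rewrite [X in _ + X](_ : _ = 0) ?addr0//.
  by apply/funext => w; rewrite /cst mul0r mulr0.
by rewrite subrr nrm0.
Qed.

Lemma discrete_ito_walk_pair Z X :
  in_discrete_L2 n xi Z -> discrete_predictable xi Z -> discrete_ito_integral n xi Z X ->
  walk_pair Z X.
Proof.
have [i1 i2 i3 i4] := xi_std.
move=> [Z0 ZL _] pZ [/(in_L2P _ measurableT) sX cX].
have pqZ : predictable_sq xi Z.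
  move=> i i_1; split; first exact/in_L2P/(ZL i i_1).1.
  by apply/adaptedP; exact: pZ.
split=> //.
apply/(@L2_cvgP _ _ _ P setT measurableT (walk_integral n xi Z) X) => //.
by move=> N _; exact: (walk_integral_adapted n i1 i2 i4 N pqZ).2.
Qed.

End walk_pairs.

(** * Trigonometric estimates and infinite products *)

Section trig_bounds.
Context {R : realType}.
Implicit Types x y c : R.

(** A mean value form that does not distinguish the order of x and y. *)
Lemma mvt_lip (f df : R -> R) x y : (forall z : R, is_derive z (1 : R) f (df z)) ->
  exists c, `|c - x| <= `|y - x| /\ f y - f x = df c * (y - x).
Proof.
move=> fdf.
have cf : continuous f.
  by move=> z; apply: differentiable_continuous; apply/derivable1_diffP; case: (fdf z).
have main a b : a <= b -> exists2 c, a <= c <= b & f b - f a = df c * (b - a).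
  move=> ab; have [|c] := @MVT_segment R f df a b ab (fun z _ => fdf z).
    exact: continuous_subspaceT.
  by rewrite in_itv/= => ? ?; exists c.
have [xy|/ltW yx] := leP x y.
  have [c /andP[? ?] e] := main _ _ xy; exists c; split=> //.
  by rewrite !ger0_norm; lra.
have [c /andP[? ?] e] := main _ _ yx; exists c; split; last by lra.
by rewrite !ler0_norm; lra.
Qed.

Lemma sin_mvt x : exists c, `|c| <= `|x| /\ sin x = x * cos c.
Proof.
have [c] := @mvt_lip sin cos 0 x (fun z => is_derive_sin z).
by rewrite sin0 !subr0 mulrC => H; exists c.
Qed.

Lemma norm_cos_le1 x : `|cos x| <= 1.
Proof. by rewrite ler_norml cos_geN1 cos_le1. Qed.

Lemma norm_sin_le1 x : `|sin x| <= 1.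
Proof. by rewrite ler_norml sin_geN1 sin_le1. Qed.

Lemma norm_sin_le x : `|sin x| <= `|x|.
Proof.
by have [c [_ ->]] := sin_mvt x; rewrite normrM ler_piMr// norm_cos_le1.
Qed.

Lemma cos_lip x y : `|cos x - cos y| <= `|x - y|.
Proof.
have [c [_ ->]] := @mvt_lip cos (fun z => - sin z) y x (fun z => is_derive_cos z).
by rewrite normrM normrN ler_piMl// norm_sin_le1.
Qed.

Lemma cos_near1 x : 0 <= 1 - cos x <= 2 /\ 1 - cos x <= x ^+ 2 / 2.
Proof.
have := cos_geN1 x; have := cos_le1 x; split; first by lra.
have -> : 1 - cos x = 2 * sin (x / 2) ^+ 2.
  rewrite {1}(_ : x = x / 2 + x / 2); last by lra.
  by rewrite cosD -!expr2; have := cos2Dsin2 (x / 2); lra.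
have : sin (x / 2) ^+ 2 <= (x / 2) ^+ 2.
  rewrite -(real_normK (num_real (sin _))) -(real_normK (num_real (x / 2))).
  by rewrite ler_sqr ?nnegrE// norm_sin_le.
by rewrite expr_div_n; lra.
Qed.

(** Real and imaginary parts of (1 + ix) e^(-ix): multiplying the Wick
    exponential by e^(-i theta) turns every factor 1 + ix into this one. *)
Definition rot_re x : R := cos x + x * sin x.
Definition rot_im x : R := x * cos x - sin x.

(** The remainder is both O(x^2) and O(x^3). The first bound keeps it integrable
    when x has only two moments, the second makes it negligible for small x. *)
Lemma rot_re_expansion x :
  `|rot_re x - 1 - x ^+ 2 / 2| <= 4 * (x ^+ 2 * Num.min 1 `|x|).
Proof.
have [c [cx E]] := sin_mvt x; have [/andP[h0 h2] h1] := cos_near1 c.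
have [c' [cx' E']] := sin_mvt (x / 2).
have x0 := sqr_ge0 x.
have ax0 := normr_ge0 x.
have csq : c ^+ 2 <= x ^+ 2.
  by rewrite -(real_normK (num_real c)) -(real_normK (num_real x)) ler_sqr ?nnegrE.
have csq' : c' ^+ 2 <= x ^+ 2 / 4.
  rewrite (_ : x ^+ 2 / 4 = (x / 2) ^+ 2); last by field.
  by rewrite -(real_normK (num_real c')) -(real_normK (num_real (x / 2))) ler_sqr ?nnegrE.
have [/andP[k0 k2] k1] := cos_near1 c'.
have -> : rot_re x - 1 - x ^+ 2 / 2 =
    x ^+ 2 / 2 * ((1 - cos c') * (1 + cos c')) - x ^+ 2 * (1 - cos c).
  have -> : rot_re x = 1 - 2 * sin (x / 2) ^+ 2 + x * sin x.
    rewrite /rot_re; congr (_ + _); rewrite {1}(_ : x = x / 2 + x / 2); last by lra.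
    by rewrite cosD -!expr2; have := cos2Dsin2 (x / 2); lra.
  by rewrite E E'; field.
move: (x ^+ 2) (cos c) (cos c') x0 h0 h2 h1 k0 k2 k1 csq csq' (real_normK (num_real x)) =>
  u a b u0 h0 h2 h1 k0 k2 k1 csq csq' ux.
have P1 : 0 <= (1 - b) * (1 + b) <= 2 * Num.min 1 `|x|.
  apply/andP; split; first by apply: mulr_ge0; lra.
  have [x1|/ltW x1] := leP 1 `|x|; first by nra.
  have : 1 - b <= `|x| by nra.
  by nra.
have P2 : 0 <= 1 - a <= 2 * Num.min 1 `|x|.
  apply/andP; split; first by lra.
  by have [x1|/ltW x1] := leP 1 `|x|; nra.
move: ((1 - b) * (1 + b)) (1 - a) (Num.min 1 `|x|) P1 P2 => p q m /andP[p0 pm] /andP[q0 qm].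
by rewrite ler_norml; apply/andP; split; nra.
Qed.

Lemma rot_im_expansion x : `|rot_im x| <= 4 * (x ^+ 2 * Num.min 1 `|x|).
Proof.
have [c [cx E]] := sin_mvt x; have [/andP[h0 h2] h1] := cos_near1 c.
have [/andP[k0 k2] k1] := cos_near1 x.
have csq : c ^+ 2 <= x ^+ 2.
  by rewrite -(real_normK (num_real c)) -(real_normK (num_real x)) ler_sqr ?nnegrE.
have -> : rot_im x = x * ((1 - cos c) - (1 - cos x)) by rewrite /rot_im E; ring.
rewrite normrM; have ax0 := normr_ge0 x.
have B1 : `|(1 - cos c) - (1 - cos x)| <= 2 by rewrite ler_norml; lra.
have B2 : `|(1 - cos c) - (1 - cos x)| <= x ^+ 2 by rewrite ler_norml; lra.
move: (`|_ - _|) B1 B2 => v; rewrite -(real_normK (num_real x)) => B1 B2.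
move: (`|x|) ax0 B2 => w w0 B2.
have [w1|/ltW w1] := leP 1 w; last first.
  by have : w * v <= w * w ^+ 2 by [apply: ler_wpM2l]; have : 0 <= w * w ^+ 2; [exact: mulr_ge0 (sqr_ge0 _)|nra].
by nra.
Qed.

Lemma norm_rot_re x : `|rot_re x| <= 1 + `|x|.
Proof.
apply: le_trans (ler_normD _ _) _; apply: lerD; first exact: norm_cos_le1.
by rewrite normrM ler_piMr// norm_sin_le1.
Qed.

Lemma norm_rot_im x : `|rot_im x| <= 1 + `|x|.
Proof.
rewrite addrC; apply: le_trans (ler_normB _ _) _; apply: lerD; last exact: norm_sin_le1.
by rewrite normrM ler_piMr// norm_cos_le1.
Qed.

Lemma measurable_cosR : measurable_fun setT (@cos R).
Proof. by apply: continuous_measurable_fun; exact: continuous_cos. Qed.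

Lemma measurable_sinR : measurable_fun setT (@sin R).
Proof. by apply: continuous_measurable_fun; exact: continuous_sin. Qed.

Lemma measurable_rot_re : measurable_fun setT rot_re.
Proof.
apply: measurable_funD; first exact: measurable_cosR.
by apply: measurable_funM; [exact: measurable_id|exact: measurable_sinR].
Qed.

Lemma measurable_rot_im : measurable_fun setT rot_im.
Proof.
apply: measurable_funB; last exact: measurable_sinR.
by apply: measurable_funM; [exact: measurable_id|exact: measurable_cosR].
Qed.

End trig_bounds.

Section products.
Context {R : realType}.

Lemma prod1D_expR_le (m : nat) (c : nat -> R) : (forall i, 0 <= c i) ->
  \prod_(1 <= i < m.+1) (1 + c i) <= expR (\sum_(1 <= i < m.+1) c i).
Proof.
move=> c0; elim: m => [|m IH]; first by rewrite !big_geq// expR0.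
rewrite big_nat_recr//= [X in expR X]big_nat_recr//= expRD; apply: ler_pM => //.
- by apply: prodr_ge0 => i _; rewrite addr_ge0.
- by rewrite addr_ge0.
- exact: expR_ge1Dx.
Qed.

Lemma expR_sub_sqr_le (c : R) : 0 <= c -> expR (c - c ^+ 2) <= 1 + c.
Proof.
move=> c0; rewrite -[c - _]opprK expRN.
have h := expR_ge1Dx (- (c - c ^+ 2)).
have p : 0 < 1 - c + c ^+ 2 by nra.
apply: (@le_trans _ _ (1 - c + c ^+ 2)^-1).
  by rewrite lef_pV2 ?posrE ?expR_gt0//; apply: le_trans h; lra.
rewrite -[leLHS]mul1r ler_pdivrMr//.
have : 0 <= c * c ^+ 2 by rewrite mulr_ge0// sqr_ge0.
by nra.
Qed.

Lemma prod1D_expR_ge (m : nat) (c : nat -> R) (k : R) :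
  (forall i, 0 <= c i <= k) ->
  expR (\sum_(1 <= i < m.+1) c i - k * \sum_(1 <= i < m.+1) c i) <=
  \prod_(1 <= i < m.+1) (1 + c i).
Proof.
move=> ck; elim: m => [|m IH]; first by rewrite !big_geq// mulr0 subr0 expR0.
have /andP[c0 cmk] := ck m.+1.
rewrite [X in _ <= X]big_nat_recr//= [X in expR X](_ : _ = (\sum_(1 <= i < m.+1) c i - k * \sum_(1 <= i < m.+1) c i) +
  (c m.+1 - k * c m.+1)); last by rewrite big_nat_recr//=; ring.
rewrite expRD; apply: ler_pM; rewrite ?expR_ge0//.
apply: le_trans (expR_sub_sqr_le c0); rewrite ler_expR lerD2l lerN2 expr2.
exact: ler_wpM2r.
Qed.

(** Squeezed between the exponentials of the sum and of (1 - k_n) times the sum. *)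
Lemma cvg_prod1D (m_ : nat -> nat) (c_ : nat -> nat -> R) (k_ : nat -> R) (q : R) :
  (forall n i, 0 <= c_ n i <= k_ n) -> k_ n @[n --> \oo] --> 0 ->
  \sum_(1 <= i < (m_ n).+1) c_ n i @[n --> \oo] --> q ->
  \prod_(1 <= i < (m_ n).+1) (1 + c_ n i) @[n --> \oo] --> expR q.
Proof.
move=> ck k0 cq.
apply: (squeeze_cvgr
  (f := fun n => expR (\sum_(1 <= i < (m_ n).+1) c_ n i -
                       k_ n * \sum_(1 <= i < (m_ n).+1) c_ n i))
  (h := fun n => expR (\sum_(1 <= i < (m_ n).+1) c_ n i))).
- apply: nearW => n; rewrite prod1D_expR_ge//=.
  by apply: prod1D_expR_le => i; case/andP: (ck n i).
- apply: continuous_cvg; first exact: continuous_expR.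
  rewrite -[X in _ --> X](_ : q - 0 * q = q); last by rewrite mul0r subr0.
  by apply: cvgB => //; apply: cvgM.
- by apply: continuous_cvg => //; exact: continuous_expR.
Qed.

(** Stability of the complex product prod (a_i + i b_i) when the factors are real
    up to errors e: the errors are summed and multiplied by at most the growth
    of the product. It is applied with m e tending to 0. *)
Lemma rotation_recursion_bound (m : nat) (U V a b c : nat -> R) (e k : R) :
  U 0%N = 1 -> V 0%N = 0 -> 0 <= e ->
  (forall i, U i.+1 = U i * a i.+1 - V i * b i.+1) ->
  (forall i, V i.+1 = V i * a i.+1 + U i * b i.+1) ->
  (forall i, 0 <= c i <= k) ->
  (forall i, `|a i - 1 - c i| <= e) -> (forall i, `|b i| <= e) ->
  `|U m - \prod_(1 <= i < m.+1) (1 + c i)| + `|V m| <=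
  2 * e * m%:R * expR ((k + 2 * e) * m%:R).
Proof.
move=> U0 V0 e0 US VS ck ae be.
have k0 : 0 <= k by case/andP: (ck 0%N) => ? ?; lra.
pose p m := \prod_(1 <= i < m.+1) (1 + c i).
have pk j : 0 <= p j <= expR ((k + 2 * e) * j%:R).
  apply/andP; split.
    by apply: prodr_ge0 => i _; case/andP: (ck i) => ? ?; lra.
  apply: le_trans (prod1D_expR_le j (fun i => proj1 (andP (ck i)))) _.
  rewrite ler_expR; elim: j => [|j IH]; first by rewrite big_geq// mulr0.
  rewrite big_nat_recr//= -[j.+1%:R]natr1 mulrDr mulr1; apply: lerD => //.
  by case/andP: (ck j.+1) => ? ?; lra.
rewrite -/(p m); elim: m => [|m IH].
  by rewrite /p big_geq// U0 V0 subrr !normr0 !mulr0 mul0r addr0.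
have -> : p m.+1 = p m * (1 + c m.+1) by rewrite /p big_nat_recr.
have step : `|U m.+1 - p m * (1 + c m.+1)| + `|V m.+1| <=
    (1 + k + 2 * e) * (`|U m - p m| + `|V m|) + 2 * e * p m.
  have -> : U m.+1 - p m * (1 + c m.+1) =
      (U m - p m) * (1 + c m.+1) + U m * (a m.+1 - 1 - c m.+1) - V m * b m.+1.
    by rewrite US; ring.
  have -> : V m.+1 = V m * (1 + c m.+1) + V m * (a m.+1 - 1 - c m.+1) + U m * b m.+1.
    by rewrite VS; ring.
  have Um : `|U m| <= `|U m - p m| + p m.
    have /andP[p0 _] := pk m; rewrite -{2}(ger0_norm p0) -{1}[U m](subrK (p m)).
    exact: ler_normD.
  have cm := ck m.+1; have am := ae m.+1; have bm := be m.+1.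
  have h1 := ler_normD ((U m - p m) * (1 + c m.+1) + U m * (a m.+1 - 1 - c m.+1)) (- (V m * b m.+1)).
  have h2 := ler_normD ((U m - p m) * (1 + c m.+1)) (U m * (a m.+1 - 1 - c m.+1)).
  have h3 := ler_normD (V m * (1 + c m.+1) + V m * (a m.+1 - 1 - c m.+1)) (U m * b m.+1).
  have h4 := ler_normD (V m * (1 + c m.+1)) (V m * (a m.+1 - 1 - c m.+1)).
  rewrite !normrN !normrM in h1 h2 h3 h4.
  have c1 : `|1 + c m.+1| <= 1 + k by case/andP: cm => ? ?; rewrite ger0_norm; lra.
  have z1 := ler_wpM2l (normr_ge0 (U m - p m)) c1.
  have z2 := ler_wpM2l (normr_ge0 (U m)) am.
  have z3 := ler_wpM2l (normr_ge0 (V m)) bm.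
  have z4 := ler_wpM2l (normr_ge0 (V m)) c1.
  have z5 := ler_wpM2l (normr_ge0 (V m)) am.
  have z6 := ler_wpM2l (normr_ge0 (U m)) bm.
  have z7 := ler_wpM2r e0 Um.
  lra.
apply: le_trans step _.
set E := expR ((k + 2 * e) * m%:R) in pk IH *.
have /andP[pm0 pmE] := pk m; rewrite -/E in pmE.
have eS : expR ((k + 2 * e) * m.+1%:R) = E * expR (k + 2 * e).
  by rewrite -[m.+1%:R]natr1 mulrDr mulr1 [LHS]expRD.
have e1 := expR_ge1Dx (k + 2 * e).
have E0 : 0 <= E by exact: expR_ge0.
have EE : E * (1 + (k + 2 * e)) <= E * expR (k + 2 * e) by exact: ler_wpM2l.
have EE' : E <= E * expR (k + 2 * e).
  by apply: le_trans EE; rewrite ler_peMr//; lra.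
rewrite eS; move: (E * expR _) EE EE' => F EE EE'.
rewrite -[m.+1%:R]natr1.
have k1 : 0 <= 1 + k + 2 * e by lra.
have y1 := ler_wpM2l k1 IH.
have y2 : 2 * e * p m <= 2 * e * F.
  by apply: ler_wpM2l; [rewrite mulr_ge0|exact: le_trans pmE EE'].
have y3 : 2 * e * m%:R * (E * (1 + (k + 2 * e))) <= 2 * e * m%:R * F.
  by apply: ler_wpM2l => //; rewrite !mulr_ge0.
lra.
Qed.

End products.

(** * Equality in law and convergence in probability *)

Section same_distribution.
Context {d : measure_display} {T : measurableType d} {R : realType}.
Variable P : probability T R.
Variables (X Y : {RV P >-> R}).
Hypothesis XY : same_distribution X Y.

(** Both sides are the integral of h against the common law. *)
Lemma same_distribution_ge0_integral (h : R -> \bar R) :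
  measurable_fun setT h -> (forall x, 0 <= h x)%E ->
  (\int[P]_w h (X w) = \int[P]_w h (Y w))%E.
Proof.
move=> mh h0.
have := ge0_integral_distribution X mh h0; have := ge0_integral_distribution Y mh h0.
rewrite /comp => <- <-.
by apply: eq_measure_integral => A mA _; exact: XY.
Qed.

Lemma same_distribution_integrable (h : R -> R) : measurable_fun setT h ->
  P.-integrable setT (EFin \o (fun w => h (Y w))) ->
  P.-integrable setT (EFin \o (fun w => h (X w))).
Proof.
move=> mh /integrableP[_ H]; apply/integrableP; split.
  by apply/measurable_EFinP; exact: measurableT_comp.
have := @same_distribution_ge0_integral (fun x => `|h x|%:E).
rewrite /= => -> //.
by apply/measurable_EFinP; exact: measurableT_comp.
Qed.

Lemma same_distribution_Rintegral (h : R -> R) : measurable_fun setT h ->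
  P.-integrable setT (EFin \o (fun w => h (Y w))) ->
  (\int[P]_w h (X w))%R = (\int[P]_w h (Y w))%R.
Proof.
move=> mh iY; have iX := same_distribution_integrable mh iY.
have mh' : measurable_fun setT (EFin \o h) by exact/measurable_EFinP.
rewrite /Rintegral -(@integral_distribution _ _ _ _ _ P X (EFin \o h) mh' iX).
rewrite -(@integral_distribution _ _ _ _ _ P Y (EFin \o h) mh' iY); congr fine.
by apply: eq_measure_integral => A mA _; exact: XY.
Qed.

Lemma same_distribution_sqint (h : R -> R) : measurable_fun setT h ->
  sqint P setT (fun w => h (Y w)) -> sqint P setT (fun w => h (X w)).
Proof.
move=> mh [_ H]; split; first exact: measurableT_comp.
apply: (@same_distribution_integrable (fun x => h x ^+ 2)) => //.
exact: measurable_funX.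
Qed.

End same_distribution.

Section standardized.
Context {d : measure_display} {T : measurableType d} {R : realType}.
Variables (P : probability T R) (xi : {RV P >-> R}).
Hypothesis xi_L2 : (xi : T -> R) \in Lfun P 2%:E.
Hypothesis xi_mean : ('E_P[xi] = 0)%E.
Hypothesis xi_var : ('V_P[xi] = 1)%E.

Lemma std_sqint : sqint P setT xi.
Proof. by apply/in_L2P => //; rewrite /in_L2 patch_setT. Qed.

Lemma std_mean : (\int[P]_w xi w)%R = 0.
Proof. by rewrite /Rintegral -expectation_def xi_mean. Qed.

Lemma std_var : (\int[P]_w (xi w ^+ 2))%R = 1.
Proof.
have := varianceE xi_L2; rewrite xi_var xi_mean expe2 mule0 sube0 => H.
rewrite /Rintegral (_ : (\int[P]_x _)%E = 1%E)//.
by rewrite [RHS]H unlock.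
Qed.

Lemma standard_steps_of (xs : nat -> {RV P >-> R}) :
  mutually_independent P (fun i => xs i.+1 : T -> R) ->
  (forall i, (1 <= i)%N -> same_distribution (xs i) xi) ->
  standard_steps xs.
Proof.
move=> ind sd; split=> // i i1.
- exact: (same_distribution_sqint (sd i i1) (@measurable_id _ R setT) std_sqint).
- rewrite (same_distribution_Rintegral (sd i i1) (@measurable_id _ R setT)) ?std_mean//.
  exact: sqint_integrable std_sqint.
- rewrite (same_distribution_Rintegral (sd i i1) (h := fun x => x ^+ 2)) ?std_var//.
  exact: std_sqint.2.
Qed.

End standardized.

Section probability_distance.
Context {d : measure_display} {T : measurableType d} {R : realType}.
Variable P : probability T R.
Implicit Types X Y : T -> R.
Local Notation nrm := (L2norm P setT).

(** A metric for convergence in probability that lives in L^2, so that the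
    norm inequalities apply to it. *)
Definition pdist X Y : R := nrm (fun w => clip 1 (X w - Y w)).

Lemma clip_bm X (c : R) : 0 <= c -> measurable_fun setT X ->
  bounded_measurable (fun w => clip c (X w)).
Proof.
move=> c0 mX; split; first by apply: measurableT_comp => //; exact: measurable_clip.
by exists c => w; exact: clip_le.
Qed.

(** On the set where X_n and X differ by less than a small amount the integrand is
    small, and elsewhere it is at most 1. *)
Lemma cvg_in_probability_pdist (X_ : nat -> T -> R) X :
  (forall n, measurable_fun setT (X_ n)) -> measurable_fun setT X ->
  cvg_in_probability P X_ X -> pdist (X_ n) X @[n --> \oo] --> 0.
Proof.
move=> mX_ mX cX; apply: nrm_cvg0_sqr.
apply/cvgrPdist_le => e e0.
have e2 : 0 < Num.sqrt (e / 2) by rewrite sqrtr_gt0 divr_gt0.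
have := cX _ e2 => /fine_cvg /cvgrPdist_le /(_ (e / 2)) H.
near=> n.
have PA : fine (P [set w | Num.sqrt (e / 2) <= `|X_ n w - X w|]) <= e / 2.
  rewrite -[leLHS]ger0_norm ?fine_ge0// -normrN -sub0r.
  by near: n; apply: H; rewrite divr_gt0.
rewrite sub0r normrN ger0_norm ?ip_ge0//.
pose A := [set w | Num.sqrt (e / 2) <= `|X_ n w - X w|].
have mA : measurable A.
  rewrite (_ : A = setT `&` (fun w => `|X_ n w - X w|) @^-1` `[Num.sqrt (e / 2), +oo[).
    apply: (measurableT_comp (@normr_measurable R setT)) => //.
    exact: measurable_funB.
  by rewrite setTI; apply/seteqP; split => w /=; rewrite in_itv/= andbT.
rewrite -/A in PA.
rewrite (_ : e = e / 2 + e / 2); last by lra.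
apply: (@le_trans _ _ (\int[P]_w (e / 2 + \1_A w))%R).
  apply: le_Rintegral => //.
  - apply: bm_integrable; apply: bmM;
      by apply: clip_bm => //; exact: measurable_funB.
  - apply: bm_integrable; apply: (@bmD _ _ _ (fun=> e / 2) \1_A).
      exact: bm_cst.
    exact: bm_indic.
  - move=> w _; rewrite -expr2.
    have c1 := clip_le (X_ n w - X w) (@ler01 R).
    have c2 := clip_le_id (X_ n w - X w) (@ler01 R).
    rewrite -(real_normK (num_real (clip _ _))).
    have [wA|nA] := boolP (w \in A).
      rewrite indicE wA; apply: (@le_trans _ _ 1); last by rewrite lerDr divr_ge0// ltW.
      by rewrite expr_le1.
    rewrite indicE (negbTE nA) addr0 -[leRHS]sqr_sqrtr; last by lra.
    rewrite ler_sqr ?nnegrE ?sqrtr_ge0//; apply: le_trans c2 _.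
    by move: nA => /negP; rewrite inE => /negP; rewrite -ltNge => /ltW.
rewrite RintegralD//; last 2 first.
- exact/bm_integrable/bm_cst.
- exact/bm_integrable/bm_indic.
by rewrite Rintegral_prob_cst Rintegral_indic// lerD2l.
Unshelve. all: by end_near. Qed.

Lemma pdist_ge0 X Y : 0 <= pdist X Y.
Proof. exact: nrm_ge0. Qed.

(** Bounded Lipschitz functions turn convergence in probability into convergence
    in L^2. *)
Lemma pdist_lipschitz (h : R -> R) (M : R) X Y : 0 <= M ->
  measurable_fun setT h -> (forall x y, `|h x - h y| <= M * `|clip 1 (x - y)|) ->
  measurable_fun setT X -> measurable_fun setT Y ->
  nrm (fun w => h (X w) - h (Y w)) <= M * pdist X Y.
Proof.
move=> M0 mh hM mX mY.
have sc : sqint P setT (fun w => clip 1 (X w - Y w)).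
  by apply: bm_sqint; apply: clip_bm => //; exact: measurable_funB.
rewrite /pdist -[X in X * nrm _](ger0_norm M0) -nrmZ//.
apply: (sqint_le measurableT _ (sqintZ measurableT M sc) _).2.
- by apply: measurable_funB; exact: measurableT_comp.
- by move=> w _; rewrite normrM (ger0_norm M0).
Qed.

Lemma norm_clip1 (x : R) : `|clip 1 x| = Num.min 1 `|x|.
Proof.
have := ler_norm x; have := ler_norm (- x); rewrite normrN => h1 h2.
rewrite clipE//; have [x1|x1] := ltP x (- 1).
  by rewrite normrN normr1 min_l//; lra.
have [x2|x2] := ltP x 1; last by rewrite normr1 min_l//; lra.
by rewrite min_r// ler_norml; lra.
Qed.

Lemma clipD_le (x y : R) : `|clip 1 (x + y)| <= `|clip 1 x| + `|clip 1 y|.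
Proof.
rewrite !norm_clip1; have := ler_normD x y.
have := normr_ge0 x; have := normr_ge0 y; have := normr_ge0 (x + y).
move: (`|x|) (`|y|) (`|x + y|) => a b c.
by have [] := leP 1 a; have [] := leP 1 b; have [] := leP 1 c; lra.
Qed.

Lemma clipM_le (m x : R) : `|clip 1 (m * x)| <= (1 + `|m|) * `|clip 1 x|.
Proof.
rewrite !norm_clip1 normrM.
have := normr_ge0 x; have := normr_ge0 m; move: (`|x|) (`|m|) => a b b0 a0.
by have [] := leP 1 a; have [] := leP 1 (b * a); nra.
Qed.

Lemma pdistD (X X' Y Y' : T -> R) : measurable_fun setT X -> measurable_fun setT X' ->
  measurable_fun setT Y -> measurable_fun setT Y' ->
  pdist (fun w => X w + X' w) (fun w => Y w + Y' w) <= pdist X Y + pdist X' Y'.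
Proof.
move=> mX mX' mY mY'.
have sc : sqint P setT (fun w => clip 1 (X w - Y w)).
  by apply: bm_sqint; apply: clip_bm => //; exact: measurable_funB.
have sc' : sqint P setT (fun w => clip 1 (X' w - Y' w)).
  by apply: bm_sqint; apply: clip_bm => //; exact: measurable_funB.
have sn := sqint_norm measurableT sc; have sn' := sqint_norm measurableT sc'.
rewrite /pdist -(nrm_norm P setT (fun w => clip 1 (X w - Y w))).
rewrite -(nrm_norm P setT (fun w => clip 1 (X' w - Y' w))).
apply: le_trans (nrmD measurableT sn sn').
apply: (sqint_le measurableT _ (sqintD measurableT sn sn') _).2.
- apply: measurableT_comp; first exact: measurable_clip.
  by apply: measurable_funB; exact: measurable_funD.
- move=> w _; rewrite opprD addrACA; apply: le_trans (clipD_le _ _) _.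
  by rewrite [leRHS]ger0_norm// addr_ge0.
Qed.

Lemma pdistZ (m : R) X Y : measurable_fun setT X -> measurable_fun setT Y ->
  pdist (fun w => m * X w) (fun w => m * Y w) <= (1 + `|m|) * pdist X Y.
Proof.
move=> mX mY.
have sc : sqint P setT (fun w => clip 1 (X w - Y w)).
  by apply: bm_sqint; apply: clip_bm => //; exact: measurable_funB.
rewrite /pdist -[X in X * nrm _](ger0_norm (addr_ge0 ler01 (normr_ge0 m))) -nrmZ//.
apply: (sqint_le measurableT _ (sqintZ measurableT _ sc) _).2.
- apply: measurableT_comp; first exact: measurable_clip.
  by apply: measurable_funB; exact: measurable_funM.
- move=> w _; rewrite -mulrBr normrM (ger0_norm (addr_ge0 ler01 (normr_ge0 m))).
  exact: clipM_le.
Qed.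

Lemma pdist_refl X : pdist X X = 0.
Proof.
rewrite /pdist (_ : (fun w => _) = 0) ?nrm0//; apply/funext => w.
by rewrite subrr clip_id// normr0.
Qed.

Lemma cvg_pdist_sum (I : eqType) (l : seq I) (m : I -> R) (X_ : nat -> I -> T -> R)
    (X : I -> T -> R) :
  (forall n i, measurable_fun setT (X_ n i)) -> (forall i, measurable_fun setT (X i)) ->
  (forall i, i \in l -> pdist (X_ n i) (X i) @[n --> \oo] --> 0) ->
  pdist (fun w => \sum_(i <- l) m i * X_ n i w) (fun w => \sum_(i <- l) m i * X i w)
    @[n --> \oo] --> 0.
Proof.
move=> mX_ mX; elim: l => [|i l IH] cX.
  rewrite (_ : (fun n => _) = cst 0); first exact: cvg_cst.
  apply/funext => n; under eq_fun do rewrite big_nil.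
  by rewrite (_ : (fun w => \sum_(i <- [::]) m i * X i w) = fun=> 0) ?pdist_refl//;
    apply/funext => w; rewrite big_nil.
have mS n : measurable_fun setT (fun w => \sum_(j <- l) m j * X_ n j w).
  by apply: measurable_sum => j; apply: measurable_funM => //; exact: measurable_cst.
have mS' : measurable_fun setT (fun w => \sum_(j <- l) m j * X j w).
  by apply: measurable_sum => j; apply: measurable_funM => //; exact: measurable_cst.
apply: (squeeze_cvgr (f := cst 0) (h := fun n => (1 + `|m i|) * pdist (X_ n i) (X i) +
  pdist (fun w => \sum_(j <- l) m j * X_ n j w) (fun w => \sum_(j <- l) m j * X j w))).
- apply: nearW => n; rewrite pdist_ge0/=.
  under eq_fun do rewrite big_cons.
  under [X in pdist _ X]eq_fun do rewrite big_cons.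
  apply: le_trans (pdistD _ _ _ _) _ => //.
  + by apply: measurable_funM => //; exact: measurable_cst.
  + by apply: measurable_funM => //; exact: measurable_cst.
  + by rewrite lerD2r; exact: pdistZ.
- exact: cvg_cst.
- rewrite -[X in _ --> X](_ : (1 + `|m i|) * 0 + 0 = 0); last by rewrite mulr0 addr0.
  apply: cvgD; last by apply: IH => j jl; apply: cX; rewrite inE jl orbT.
  by apply: cvgM; [exact: cvg_cst|apply: cX; exact: mem_head].
Qed.

End probability_distance.

(** * Discrete Wick exponentials *)

Section rotation_products.
Context {d : measure_display} {T : measurableType d} {R : realType}.
Variables (P : probability T R) (n : nat) (xi : nat -> {RV P >-> R}).
Hypothesis n1 : (1 <= n)%N.
Hypothesis xi_std : standard_steps xi.
Local Notation sq := (sqint P setT).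
Local Notation ip := (L2inner P setT).
Local Notation nrm := (L2norm P setT).
Local Notation adapted := (adapted xi).
Implicit Types (X Y : T -> R) (Z : nat -> T -> R).

Let n0 : 0 < n%:R :> R. Proof. by rewrite ltr0n. Qed.

Lemma sqint_mul_indep i Y (h : R -> R) : adapted i Y -> sq Y ->
  measurable_fun setT h -> sq (fun w => h (xi i.+1 w)) ->
  sq (fun w => Y w * h (xi i.+1 w)).
Proof.
have [i1 i2 i3 i4] := xi_std.
move=> aY sY mh sh; have [mY Y2] := sY.
have [||||iYX _] := @walk_indep _ _ _ P xi i1 i (fun w => Y w ^+ 2) (fun x => h x ^+ 2).
- by apply: (@adapted_comp _ _ _ _ _ _ (fun x => x ^+ 2)) => //; exact: exprn_measurable.
- exact: Y2.
- exact: measurable_funX.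
- exact: sh.2.
split; first by apply: measurable_funM => //; exact: sh.1.
by under eq_fun do rewrite exprMn.
Qed.

(** Telescoping of [ip_step_orth]. *)
Lemma walk_integral_orth Z Y (k m : nat) : predictable_sq xi Z ->
  adapted k Y -> sq Y -> (k <= m)%N ->
  ip Y (walk_integral n xi Z m - walk_integral n xi Z k) = 0.
Proof.
have [i1 i2 i3 i4] := xi_std.
move=> pZ aY sY km; rewrite -(subnK km).
have sI N : sq (walk_integral n xi Z N) by exact: (walk_integral_adapted n i1 i2 i4 N pZ).2.
elim: (m - k)%N => [|j IH]; first by rewrite add0n ipBr// subrr.
have [sZ aZ] := pZ (j + k).+1 isT.
have [sZX _] := sqint_mul_step i1 i2 i4 aZ sZ.
rewrite addSn walk_integralS addrAC ipDr//; last 2 first.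
- exact: sqintB.
- exact: sqintZ.
rewrite IH add0r ipZr// (ip_step_orth i1 i2 i3) ?mulr0//.
by apply: adapted_le aY; rewrite leq_addl.
Qed.

Lemma walk_integral_cut Z (k m : nat) : (k <= m)%N ->
  walk_integral n xi Z m - walk_integral n xi Z k =
  walk_integral n xi (fun i => if (k < i)%N then Z i else 0) m.
Proof.
move=> km; apply/funext => w.
change (walk_integral n xi Z m w - walk_integral n xi Z k w =
  walk_integral n xi (fun i => if (k < i)%N then Z i else 0) m w).
rewrite /walk_integral (big_cat_nat (n := k.+1))//= addrAC subrr add0r.
rewrite [RHS](big_cat_nat (n := k.+1))//= [X in _ = X + _]big_nat_cond.
rewrite [X in _ = X + _]big1 ?add0r; last first.
  by move=> i /andP[/andP[_ ik] _]; rewrite ltnNge -ltnS ik /= mul0r.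
by rewrite big_nat_cond [RHS]big_nat_cond; apply: eq_bigr => i /andP[/andP[-> _] _].
Qed.

(** The isometry applied to the integrand after time k. *)
Lemma walk_integral_increment Z (k m : nat) (b : R) : predictable_sq xi Z ->
  (k <= m)%N -> (forall i, (k < i <= m)%N -> nrm (Z i) ^+ 2 <= b) ->
  nrm (walk_integral n xi Z m - walk_integral n xi Z k) ^+ 2 <= n%:R^-1 * ((m - k)%:R * b).
Proof.
have [i1 i2 i3 i4] := xi_std.
move=> pZ km Zb; rewrite walk_integral_cut// walk_integral_isometry//; last first.
  move=> i i_1; case: ifP => _; first exact: pZ.
  by split; [exact: sqint0|exact: adapted_cst].
rewrite ler_pM2l ?invr_gt0//.
rewrite (big_cat_nat (n := k.+1))//= [X in X + _]big_nat_cond.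
rewrite [X in X + _]big1 ?add0r; last first.
  by move=> i /andP[/andP[_ ik] _]; rewrite ltnNge -ltnS ik /= nrm0// expr0n.
apply: (@le_trans _ _ (\sum_(k.+1 <= i < m.+1) b)).
  rewrite big_nat_cond [leRHS]big_nat_cond; apply: ler_sum => i /andP[/andP[ki im] _].
  by rewrite ki; apply: Zb; rewrite ki -ltnS im.
by rewrite sumr_const_nat subSS mulr_natl.
Qed.

Section rotprod.
Variables (al be : R -> R) (gam : nat -> R).
Hypothesis mal : measurable_fun setT al.
Hypothesis mbe : measurable_fun setT be.

Definition step_angle (i : nat) (y : R) : R := gam i * (y / Num.sqrt n%:R).

Lemma measurable_step_angle i : measurable_fun setT (step_angle i).
Proof.
apply: measurable_funM; first exact: measurable_cst.
by apply: measurable_funM; [exact: measurable_id|exact: measurable_cst].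
Qed.

(** The product of the complex factors al(x_i) + i be(x_i), as the pair of its real
    and imaginary parts. Both the Wick exponential and its rotated form are
    instances. *)
Fixpoint rotprod (j : nat) (w : T) : R * R :=
  if j is k.+1 then
    let x := step_angle k.+1 (xi k.+1 w) in
    ((rotprod k w).1 * al x - (rotprod k w).2 * be x,
     (rotprod k w).2 * al x + (rotprod k w).1 * be x)
  else (1, 0).

Hypothesis sal : forall i, sq (fun w => al (step_angle i.+1 (xi i.+1 w))).
Hypothesis sbe : forall i, sq (fun w => be (step_angle i.+1 (xi i.+1 w))).

Lemma rotprod_adapted_sq j :
  (adapted j (fun w => (rotprod j w).1) /\ sq (fun w => (rotprod j w).1)) /\
  (adapted j (fun w => (rotprod j w).2) /\ sq (fun w => (rotprod j w).2)).
Proof.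
elim: j => [|j [[a1 s1] [a2 s2]]].
  split; (split; [exact: adapted_cst|exact: sqint_cst]).
have ml : measurable_fun setT (fun y => al (step_angle j.+1 y)).
  by apply: measurableT_comp => //; exact: measurable_step_angle.
have mb : measurable_fun setT (fun y => be (step_angle j.+1 y)).
  by apply: measurableT_comp => //; exact: measurable_step_angle.
have ax : adapted j.+1 (xi j.+1) by apply: adapted_step; rewrite leqnn.
have al_ := adapted_comp ml ax; have ab_ := adapted_comp mb ax.
have {}a1' := adapted_le (leqnSn j) a1; have {}a2' := adapted_le (leqnSn j) a2.
have s1a := sqint_mul_indep a1 s1 ml (sal j); have s1b := sqint_mul_indep a1 s1 mb (sbe j).
have s2a := sqint_mul_indep a2 s2 ml (sal j); have s2b := sqint_mul_indep a2 s2 mb (sbe j).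
split; split.
- by apply: measurable_funB; apply: adaptedM.
- exact: (sqintB measurableT s1a s2b).
- by apply: measurable_funD; apply: adaptedM.
- exact: (sqintD measurableT s2a s1b).
Qed.

(** Independence of the last factor from the earlier ones. *)
Lemma rotprod_mean j :
  (\int[P]_w (rotprod j.+1 w).1)%R =
    (\int[P]_w (rotprod j w).1)%R * (\int[P]_w al (step_angle j.+1 (xi j.+1 w)))%R -
    (\int[P]_w (rotprod j w).2)%R * (\int[P]_w be (step_angle j.+1 (xi j.+1 w)))%R /\
  (\int[P]_w (rotprod j.+1 w).2)%R =
    (\int[P]_w (rotprod j w).2)%R * (\int[P]_w al (step_angle j.+1 (xi j.+1 w)))%R +
    (\int[P]_w (rotprod j w).1)%R * (\int[P]_w be (step_angle j.+1 (xi j.+1 w)))%R.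
Proof.
have [i1 i2 i3 i4] := xi_std.
have [[a1 s1] [a2 s2]] := rotprod_adapted_sq j.
have ml : measurable_fun setT (fun y => al (step_angle j.+1 y)).
  by apply: measurableT_comp => //; exact: measurable_step_angle.
have mb : measurable_fun setT (fun y => be (step_angle j.+1 y)).
  by apply: measurableT_comp => //; exact: measurable_step_angle.
have [I1a E1a] := walk_indep i1 a1 (sqint_integrable s1) ml (sqint_integrable (sal j)).
have [I1b E1b] := walk_indep i1 a1 (sqint_integrable s1) mb (sqint_integrable (sbe j)).
have [I2a E2a] := walk_indep i1 a2 (sqint_integrable s2) ml (sqint_integrable (sal j)).
have [I2b E2b] := walk_indep i1 a2 (sqint_integrable s2) mb (sqint_integrable (sbe j)).
by rewrite -E1a -E1b -E2a -E2b; split; rewrite /L2inner -?RintegralB// -RintegralD.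
Qed.

End rotprod.

Variable gam : nat -> R.
Local Notation angle := (step_angle gam).

Lemma sqint_angle i : sq (fun w => angle i.+1 (xi i.+1 w)).
Proof.
have [i1 i2 i3 i4] := xi_std.
rewrite (_ : (fun w => _) = (fun w => (gam i.+1 / Num.sqrt n%:R) * xi i.+1 w)).
  by apply: sqintZ => //; exact: i2.
by apply/funext => w; rewrite /step_angle mulrAC mulrA.
Qed.

Lemma sqint_1norm_angle i (h : R -> R) : measurable_fun setT h ->
  (forall x, `|h x| <= 1 + `|x|) -> sq (fun w => h (angle i.+1 (xi i.+1 w))).
Proof.
move=> mh hx; apply: (sqint_le measurableT _
  (sqintD measurableT (sqint_cst P 1) (sqint_norm measurableT (sqint_angle i))) _).1.
- by apply: measurableT_comp => //; apply: measurableT_comp => //; exact: measurable_step_angle.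
- by move=> w _; apply: le_trans (hx _) _; rewrite [leRHS]ger0_norm// addr_ge0.
Qed.

(** The discrete Wick exponential prod_(i <= j) (1 + i gam_i xi_i / sqrt n). *)
Definition wick (j : nat) (w : T) : R * R := rotprod (fun=> 1) (fun x => x) gam j w.

(** The real part of e^(i phi) times the Wick exponential. Carrying the phase phi makes
    real and imaginary part one family, closed under multiplication by i. *)
Definition wick_phase (phi : R) (j : nat) : T -> R :=
  fun w => cos phi * (wick j w).1 - sin phi * (wick j w).2.

Let sq1 i : sq (fun w => (fun=> 1 : R) (angle i.+1 (xi i.+1 w))).
Proof. exact: sqint_cst. Qed.

Let sqid i : sq (fun w => (fun x => x) (angle i.+1 (xi i.+1 w))).
Proof. exact: sqint_angle. Qed.

Lemma wick_adapted_sq j :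
  (adapted j (fun w => (wick j w).1) /\ sq (fun w => (wick j w).1)) /\
  (adapted j (fun w => (wick j w).2) /\ sq (fun w => (wick j w).2)).
Proof. by apply: rotprod_adapted_sq. Qed.

Lemma wick_phase_adapted_sq phi j :
  adapted j (wick_phase phi j) /\ sq (wick_phase phi j).
Proof.
have [[a1 s1] [a2 s2]] := wick_adapted_sq j; split.
  apply: measurable_funB; apply: adaptedM => //; exact: adapted_cst.
by apply: sqintB => //; exact: sqintZ.
Qed.

(** Multiplication by i is a phase shift by pi/2. *)
Lemma wick_phaseS phi j w : wick_phase phi j.+1 w =
  wick_phase phi j w + wick_phase (phi + pi / 2) j w * angle j.+1 (xi j.+1 w).
Proof.
rewrite /wick_phase /wick /= cosDpihalf sinDpihalf.
ring.
Qed.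

Definition wick_integrand (phi : R) (i : nat) : T -> R :=
  if i is k.+1 then (fun w => gam k.+1 * wick_phase (phi + pi / 2) k w) else cst 0.

Lemma wick_integrand_predictable phi : predictable_sq xi (wick_integrand phi).
Proof.
case=> // i _; have [a s] := wick_phase_adapted_sq (phi + pi / 2) i.
by split; [exact: sqintZ|apply: adaptedM => //; exact: adapted_cst].
Qed.

(** Summing [wick_phaseS]: the Wick exponential is a martingale, the integral of its
    own phase-shifted past. *)
Lemma wick_phase_integral phi j :
  wick_phase phi j = (fun=> cos phi) + walk_integral n xi (wick_integrand phi) j.
Proof.
elim: j => [|j IH]; apply/funext => w.
  rewrite walk_integral0 addr0 /wick_phase /=.
  by rewrite mulr1 mulr0 subr0.
rewrite wick_phaseS IH walk_integralS /step_angle /wick_integrand.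
change ((fun=> cos phi) + walk_integral n xi (wick_integrand phi) j)%R with
  (fun w => cos phi + walk_integral n xi (wick_integrand phi) j w).
change (cos phi + walk_integral n xi (wick_integrand phi) j w +
  wick_phase (phi + pi / 2) j w * (gam j.+1 * (xi j.+1 w / Num.sqrt n%:R)) =
  cos phi + (walk_integral n xi (wick_integrand phi) j w +
   (Num.sqrt n%:R)^-1 * (gam j.+1 * wick_phase (phi + pi / 2) j w * xi j.+1 w))).
ring.
Qed.

(** Each factor has second moment 1 + gam^2 / n and is independent of the past. *)
Lemma wick_norm j :
  nrm (fun w => (wick j w).1) ^+ 2 + nrm (fun w => (wick j w).2) ^+ 2 =
  \prod_(1 <= i < j.+1) (1 + gam i ^+ 2 / n%:R).
Proof.
have [i1 i2 i3 i4] := xi_std.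
have sumE k : nrm (fun w => (wick k w).1) ^+ 2 + nrm (fun w => (wick k w).2) ^+ 2 =
    (\int[P]_w ((wick k w).1 ^+ 2 + (wick k w).2 ^+ 2))%R.
  have [[a1 s1] [a2 s2]] := wick_adapted_sq k.
  by rewrite RintegralD//; [rewrite !nrm_sqr|exact: s1.2|exact: s2.2].
rewrite sumE; elim: j => [|j IH].
  rewrite big_geq//= expr1n expr0n addr0.
  by rewrite Rintegral_prob_cst.
have [[a1 s1] [a2 s2]] := wick_adapted_sq j.
rewrite big_nat_recr//= -IH.
pose Y w := (wick j w).1 ^+ 2 + (wick j w).2 ^+ 2.
have aY : adapted j Y.
  by apply: measurable_funD; apply: measurable_funX.
have iY : P.-integrable setT (EFin \o Y).
  by apply: (integrableD measurableT s1.2 s2.2).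
pose h y := 1 + gam j.+1 ^+ 2 / n%:R * y ^+ 2.
have mh : measurable_fun setT h.
  apply: measurable_funD; first exact: measurable_cst.
  by apply: measurable_funM; [exact: measurable_cst|exact: exprn_measurable].
have iz : P.-integrable setT (EFin \o (fun w => gam j.+1 ^+ 2 / n%:R * xi j.+1 w ^+ 2)).
  apply: eq_integrable (integrableZl measurableT (gam j.+1 ^+ 2 / n%:R) (i2 j.+1 isT).2) => //.
have ih : P.-integrable setT (EFin \o (fun w => h (xi j.+1 w))).
  have ic : P.-integrable setT (EFin \o (fun=> 1 : R)) by exact/bm_integrable/bm_cst.
  exact: (integrableD measurableT ic iz).
have [_] := walk_indep i1 aY iY mh ih.
rewrite (_ : (\int[P]_w h (xi j.+1 w))%R = 1 + gam j.+1 ^+ 2 / n%:R); last first.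
  rewrite RintegralD//; last exact/bm_integrable/bm_cst.
  rewrite Rintegral_prob_cst RintegralZl//; last exact: (i2 j.+1 isT).2.
  by rewrite i4// mulr1.
move=> <-; apply: eq_Rintegral => w _.
rewrite /Y /h /wick /= /step_angle.
have -> : gam j.+1 ^+ 2 / n%:R = (gam j.+1 / Num.sqrt n%:R) ^+ 2.
  by rewrite expr_div_n sqr_sqrtr// ltW.
ring.
Qed.

Lemma wick_phase_norm_le phi j :
  nrm (wick_phase phi j) ^+ 2 <= \prod_(1 <= i < j.+1) (1 + gam i ^+ 2 / n%:R).
Proof.
have [[a1 s1] [a2 s2]] := wick_adapted_sq j.
have [a s] := wick_phase_adapted_sq phi j.
rewrite -wick_norm -[leRHS]addr0 !nrm_sqr -lerBlDl.
have -> : L2inner P setT (wick_phase phi j) (wick_phase phi j) =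
   cos phi ^+ 2 * ip (fun w => (wick j w).1) (fun w => (wick j w).1) +
   sin phi ^+ 2 * ip (fun w => (wick j w).2) (fun w => (wick j w).2) -
   2 * cos phi * sin phi * ip (fun w => (wick j w).1) (fun w => (wick j w).2).
  rewrite /wick_phase.
  have z1 := sqintZ measurableT (cos phi) s1; have z2 := sqintZ measurableT (sin phi) s2.
  rewrite (_ : (fun w => _) = (fun w => cos phi * (wick j w).1) - (fun w => sin phi * (wick j w).2))//.
  rewrite (ipBl measurableT z1 z2 (sqintB measurableT z1 z2)) !(ipBr measurableT z1 z2)//.
  rewrite !(ipZl measurableT, ipZr measurableT)//.
  rewrite (ipC _ _ (fun w => (wick j w).2) (fun w => (wick j w).1)); ring.
have s3 : sq (fun w => sin phi * (wick j w).1 + cos phi * (wick j w).2).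
  by apply: (sqintD measurableT); exact: sqintZ.
have := ip_ge0 P setT ((fun w => sin phi * (wick j w).1) + (fun w => cos phi * (wick j w).2)).
have z1 := sqintZ measurableT (sin phi) s1; have z2 := sqintZ measurableT (cos phi) s2.
rewrite (ipDl measurableT z1 z2 (sqintD measurableT z1 z2)) !(ipDr measurableT z1 z2)//.
rewrite !(ipZl measurableT, ipZr measurableT)//.
rewrite (ipC _ _ (fun w => (wick j w).2) (fun w => (wick j w).1)).
have cs := cos2Dsin2 phi.
have e1 := congr1 (fun x => ip (fun w => (wick j w).1) (fun w => (wick j w).1) * x) cs.
have e2 := congr1 (fun x => ip (fun w => (wick j w).2) (fun w => (wick j w).2) * x) cs.
move: e1 e2; rewrite /= !mulr1; lra.
Qed.

(** e^(-i theta) distributes over the factors because theta is the sum of the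
    angles. *)
Lemma wick_rotated j w :
  let th := walk_integral n xi (fun i => cst (gam i)) j w in
  rotprod (@rot_re R) (@rot_im R) gam j w =
  ((wick j w).1 * cos th + (wick j w).2 * sin th,
   (wick j w).2 * cos th - (wick j w).1 * sin th).
Proof.
elim: j => [|j /= IH] /=.
  by rewrite walk_integral0 /= cos0 sin0 !mulr1 !mul0r addr0 mulr0 subrr.
rewrite IH walk_integralS.
set th := walk_integral _ _ _ _ w.
have -> : (walk_integral n xi (fun i => cst (gam i)) j +
   (fun w => (Num.sqrt n%:R)^-1 * (cst (gam j.+1) w * xi j.+1 w))) w =
   th + angle j.+1 (xi j.+1 w).
  by congr (_ + _); rewrite /step_angle /cst mulrC mulrA.
rewrite cosD sinD /rot_re /rot_im /wick; congr pair => /=; ring.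
Qed.

End rotation_products.

(** * Step functions on the time grid and the approximating walks *)

Section grid.
Context {R : realType}.
Implicit Types (l : seq (R * R)) (t T : R) (n : nat).

(** The number of steps of the n-th walk up to time t. *)
Definition grid n t : nat := Num.truncn (n%:R * t).

Lemma cvg_invn : (n%:R^-1 : R) @[n --> \oo] --> (0 : R).
Proof. by rewrite -cvg_shiftS; exact: cvg_harmonic. Qed.

Lemma grid_bounds n t : (1 <= n)%N -> 0 <= t ->
  t - n%:R^-1 <= (grid n t)%:R / n%:R <= t.
Proof.
move=> n1 t0; have n0 : 0 < n%:R :> R by rewrite ltr0n.
have /truncn_itv/andP[h1 h2] : 0 <= n%:R * t by rewrite mulr_ge0.
rewrite /grid ler_pdivrMr// (mulrC t) h1 andbT ler_pdivlMr// mulrBl mulVf ?gt_eqF//.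
by rewrite (mulrC t) lerBlDr natr1 ltW.
Qed.

Lemma cvg_grid t : 0 <= t -> (grid n t)%:R / n%:R @[n --> \oo] --> t.
Proof.
move=> t0; apply: (squeeze_cvgr (f := fun n => t - n%:R^-1) (h := cst t)).
- by near=> n; apply: grid_bounds => //; near: n; exact: nbhs_infty_ge.
- rewrite -[X in _ --> X]subr0; apply: cvgB; [exact: cvg_cst|exact: cvg_invn].
- exact: cvg_cst.
Unshelve. all: by end_near. Qed.

Lemma le_gridE n i t : (1 <= n)%N -> 0 <= t -> (i%:R / n%:R <= t) = (i <= grid n t)%N.
Proof.
move=> n1 t0; have n0 : 0 < n%:R :> R by rewrite ltr0n.
by rewrite ler_pdivrMr// (mulrC t) -truncn_ge_nat// mulr_ge0.
Qed.

Lemma grid_le n t t' : t <= t' -> (grid n t <= grid n t')%N.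
Proof. by move=> tt'; apply: le_truncn; exact: ler_wpM2l. Qed.

Lemma grid_min n t t' : minn (grid n t) (grid n t') = grid n (Num.min t t').
Proof.
have [tt'|/ltW tt'] := leP t t'.
  by apply/minn_idPl; exact: grid_le.
by apply/minn_idPr; exact: grid_le.
Qed.

Lemma sum_cut (F : nat -> R) (m k : nat) : (k <= m)%N ->
  \sum_(1 <= i < m.+1) F i * (i <= k)%N%:R = \sum_(1 <= i < k.+1) F i.
Proof.
move=> km; rewrite (big_cat_nat (n := k.+1))//= [X in _ + X]big_nat_cond.
rewrite [X in _ + X]big1 ?addr0; last first.
  by move=> i /andP[/andP[ki _] _]; rewrite leqNgt ki mulr0.
rewrite big_nat_cond [RHS]big_nat_cond; apply: eq_bigr => i /andP[/andP[_ ik] _].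
by rewrite -ltnS ik mulr1.
Qed.

Lemma cvg_sum_in (I : eqType) (l : seq I) (f_ : nat -> I -> R) (f : I -> R) :
  (forall i, i \in l -> f_ n i @[n --> \oo] --> f i) ->
  \sum_(i <- l) f_ n i @[n --> \oo] --> \sum_(i <- l) f i.
Proof.
elim: l => [|i l IH] cf.
  rewrite big_nil (_ : (fun n => _) = cst 0); first exact: cvg_cst.
  by apply/funext => n; rewrite big_nil.
rewrite big_cons (_ : (fun n => _) = (fun n => f_ n i + \sum_(j <- l) f_ n j)).
  apply: cvgD; first by apply: cf; exact: mem_head.
  by apply: IH => j jl; apply: cf; rewrite inE jl orbT.
by apply/funext => n; rewrite big_cons.
Qed.

(** A list of pairs (mu, t) encodes the step function sum_k mu_k 1_(s <= t_k), which is
    the integrand of sum_k mu_k B_(t_k). *)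
Definition integrand l (s : R) : R := \sum_(p <- l) p.1 * (s <= p.2)%R%:R.

(** The squared L^2([0, oo[) norm of the step function. *)
Definition energy_form l : R :=
  \sum_(p <- l) \sum_(q <- l) p.1 * q.1 * Num.min p.2 q.2.

Definition integrand_bound l : R := \sum_(p <- l) `|p.1|.

Definition times_within T l : bool := all (fun p => (0 <= p.2) && (p.2 <= T)) l.

Definition grid_integrand n l (i : nat) : R := integrand l (i%:R / n%:R).

Lemma integrand_le l s : `|integrand l s| <= integrand_bound l.
Proof.
apply: le_trans (ler_norm_sum _ _ _) _; apply: ler_sum => p _.
by rewrite normrM; case: (s <= p.2); rewrite ?normr1 ?normr0 ?mulr1// mulr0.
Qed.

Lemma integrand_bound_ge0 l : 0 <= integrand_bound l.
Proof. by apply: sumr_ge0. Qed.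

Lemma integrand_sqr_le l s : integrand l s ^+ 2 <= integrand_bound l ^+ 2.
Proof.
rewrite -(real_normK (num_real (integrand l s))) ler_sqr ?nnegrE ?integrand_le//.
exact: integrand_bound_ge0.
Qed.

Lemma times_withinP T l p : times_within T l -> p \in l -> 0 <= p.2 /\ p.2 <= T.
Proof. by move=> /allP h /h /andP. Qed.

Lemma grid_integrandE n T l i : (1 <= n)%N -> times_within T l ->
  grid_integrand n l i = \sum_(p <- l) p.1 * (i <= grid n p.2)%N%:R.
Proof.
move=> n1 lT; rewrite /grid_integrand /integrand big_seq [RHS]big_seq.
by apply: eq_bigr => p /(times_withinP lT)[p0 _]; rewrite le_gridE.
Qed.

(** Riemann sums of the squared step function, computed exactly on the grid as a
    double sum. *)
Lemma cvg_sum_grid_integrand T l : times_within T l ->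
  \sum_(1 <= i < (grid n T).+1) (grid_integrand n l i ^+ 2 / n%:R) @[n --> \oo] -->
  energy_form l.
Proof.
move=> lT.
have E n : (1 <= n)%N -> \sum_(1 <= i < (grid n T).+1) (grid_integrand n l i ^+ 2 / n%:R) =
    \sum_(p <- l) \sum_(q <- l) p.1 * q.1 * ((grid n (Num.min p.2 q.2))%:R / n%:R).
  move=> n1; under eq_bigr do rewrite (grid_integrandE _ n1 lT) expr2 mulr_suml mulr_suml.
  rewrite exchange_big/= big_seq [RHS]big_seq; apply: eq_bigr => p pl.
  under eq_bigr do rewrite mulr_sumr mulr_suml.
  rewrite exchange_big/= big_seq [RHS]big_seq; apply: eq_bigr => q ql.
  have [p0 pT] := times_withinP lT pl; have [q0 qT] := times_withinP lT ql.
  transitivity (\sum_(1 <= i < (grid n T).+1) (p.1 * q.1 / n%:R) *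
    (i <= grid n (Num.min p.2 q.2))%N%:R).
    apply: eq_bigr => i _; rewrite -grid_min leq_min.
    by case: (i <= grid n p.2)%N; case: (i <= grid n q.2)%N; rewrite /=; ring.
  rewrite (@sum_cut (fun=> p.1 * q.1 / n%:R)); last first.
    by apply: grid_le; rewrite ge_min pT.
  by rewrite sumr_const_nat subn1 /= -mulr_natl; ring.
apply: (@cvg_trans _ (\sum_(p <- l) \sum_(q <- l) p.1 * q.1 *
    ((grid n (Num.min p.2 q.2))%:R / n%:R) @[n --> \oo])).
  apply: near_eq_cvg; near=> n; rewrite E//.
  by near: n; exact: nbhs_infty_ge.
apply: cvg_sum_in => p pl; apply: cvg_sum_in => q ql.
apply: cvgM; first exact: cvg_cst.
apply: cvg_grid.
by rewrite le_min (times_withinP lT pl).1 (times_withinP lT ql).1.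
Unshelve. all: by end_near. Qed.

End grid.

Record walk_approximation {d : measure_display} {T : measurableType d} {R : realType}
    (P : probability T R) (B : R -> {RV P >-> R}) (xi : {RV P >-> R})
    (xi_ : nat -> nat -> {RV P >-> R}) : Prop := WalkApproximation {
  walk_L2 : (xi : T -> R) \in Lfun P 2%:E ;
  walk_mean : ('E_P[xi] = 0)%E ;
  walk_var : ('V_P[xi] = 1)%E ;
  walk_indep_steps : forall n, (1 <= n)%N ->
    mutually_independent P (fun i => xi_ n i.+1 : T -> R) ;
  walk_distr : forall n i, (1 <= n)%N -> (1 <= i)%N -> same_distribution (xi_ n i) xi ;
  walk_limit : forall t : R, 0 <= t ->
    cvg_in_probability P (fun n => random_walk n (xi_ n) t) (B t) }.

Section wick_limits.
Context {d : measure_display} {T : measurableType d} {R : realType}.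
Variables (P : probability T R) (B : R -> {RV P >-> R}) (xi : {RV P >-> R}).
Variable xi_ : nat -> nat -> {RV P >-> R}.
Hypothesis hW : walk_approximation B xi xi_.
Implicit Types (l : seq (R * R)).

Lemma walk_standard n : (1 <= n)%N -> standard_steps (xi_ n).
Proof.
move=> n1; apply: (@standard_steps_of _ _ _ _ xi).
- exact: walk_L2 hW.
- exact: walk_mean hW.
- exact: walk_var hW.
- exact: walk_indep_steps hW n n1.
- by move=> i i1; exact: walk_distr hW n i n1 i1.
Qed.

(** The Wiener integral of the step function l. *)
Definition theta l : T -> R := fun w => \sum_(p <- l) p.1 * B p.2 w.

Definition walk_theta n l : T -> R :=
  fun w => \sum_(p <- l) p.1 * random_walk n (xi_ n) p.2 w.

Lemma measurable_random_walk n t : measurable_fun setT (random_walk n (xi_ n) t).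
Proof.
apply: measurable_funM; first exact: measurable_cst.
by apply: measurable_sum => i.
Qed.

Lemma measurable_theta l : measurable_fun setT (theta l).
Proof.
by apply: measurable_sum => p; apply: measurable_funM => //; exact: measurable_cst.
Qed.

Lemma measurable_walk_theta n l : measurable_fun setT (walk_theta n l).
Proof.
apply: measurable_sum => p; apply: measurable_funM; first exact: measurable_cst.
exact: measurable_random_walk.
Qed.

(** The times of l are at most s, so stopping the sum at step ns loses no term. *)
Lemma walk_theta_integral n (s : R) l : (1 <= n)%N -> times_within s l ->
  walk_integral n (xi_ n) (fun i => cst (grid_integrand n l i)) (grid n s) = walk_theta n l.
Proof.
move=> n1 ls; apply/funext => w; rewrite /walk_integral /walk_theta /cst.
under eq_bigr do rewrite (grid_integrandE _ n1 ls) mulr_suml.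
rewrite exchange_big/= big_seq [RHS]big_seq; apply: eq_bigr => p pl.
have [p0 pT] := times_withinP ls pl.
rewrite /random_walk mulrA mulr_sumr -(sum_cut _ (grid_le n pT)).
by apply: eq_bigr => i _; ring.
Qed.

Lemma cvg_pdist_theta l : (forall p, p \in l -> 0 <= p.2) ->
  pdist P (walk_theta n l) (theta l) @[n --> \oo] --> 0.
Proof.
move=> l0; apply: (@cvg_pdist_sum _ _ _ P _ l (fun p => p.1)
  (fun n p => random_walk n (xi_ n) p.2) (fun p => B p.2)).
- by move=> n p; exact: measurable_random_walk.
- by [].
- move=> p pl; apply: cvg_in_probability_pdist => //.
    by move=> n; exact: measurable_random_walk.
  by apply: walk_limit hW _ _; exact: l0.
Qed.

Lemma bm_cos X : measurable_fun setT X -> bounded_measurable (fun w : T => cos (X w) : R).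
Proof.
move=> mX; split; first by apply: measurableT_comp => //; exact: measurable_cosR.
by exists 1 => w; exact: norm_cos_le1.
Qed.

Lemma bm_sin X : measurable_fun setT X -> bounded_measurable (fun w : T => sin (X w) : R).
Proof.
move=> mX; split; first by apply: measurableT_comp => //; exact: measurable_sinR.
by exists 1 => w; exact: norm_sin_le1.
Qed.

Lemma cos_clip_lip (x y : R) : `|cos x - cos y| <= 2 * `|clip 1 (x - y)|.
Proof.
rewrite norm_clip1; have h1 := cos_lip x y.
have := ler_normB (cos x) (cos y); have := norm_cos_le1 x; have := norm_cos_le1 y.
have [_|_] := leP 1 `|x - y|; last by have := normr_ge0 (x - y); lra.
by lra.
Qed.

Lemma sin_clip_lip (x y : R) : `|sin x - sin y| <= 2 * `|clip 1 (x - y)|.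
Proof.
have := cos_clip_lip (x - pi / 2) (y - pi / 2).
by rewrite !cosBpihalf opprD addrACA subrr addr0.
Qed.

(** The remainder E[xi^2 min(1, c |xi| / sqrt n)] of the second order expansion of
    E[(1 + ix) e^(-ix)] along one step. *)
Definition lindeberg (c : R) (n : nat) : R :=
  (\int[P]_w (xi w ^+ 2 * Num.min 1 (c * `|xi w| / Num.sqrt n%:R)))%R.

(** Dominated convergence: xi has two moments only, so no rate is available. *)
Lemma cvg_lindeberg c : 0 <= c -> lindeberg c n @[n --> \oo] --> 0.
Proof.
move=> c0; have [mxi ixi] := std_sqint (walk_L2 hW).
have min0 n w : 0 <= Num.min 1 (c * `|xi w| / Num.sqrt n%:R).
  by rewrite le_min ler01 divr_ge0 ?mulr_ge0 ?sqrtr_ge0.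
have -> : 0 = (\int[P]_w (fun=> 0 : R) w)%R :> R by rewrite Rintegral_prob_cst.
apply: (@cvg_Rintegral_dominated _ _ _ P setT measurableT _ _ (fun w => xi w ^+ 2)) => //.
- move=> n; apply: measurable_funM; first exact: measurable_funX.
  apply: measurable_minr; first exact: measurable_cst.
  apply: measurable_funM; last exact: measurable_cst.
  by apply: measurable_funM; [exact: measurable_cst|exact: measurableT_comp].
- move=> w.
  have H : c * `|xi w| / Num.sqrt n%:R @[n --> \oo] --> (0 : R).
    rewrite -[X in _ --> X](mulr0 (c * `|xi w|)); apply: cvgM; first exact: cvg_cst.
    have -> : (fun n => (Num.sqrt n%:R)^-1 : R) = (fun n => Num.sqrt (n%:R^-1)).
      by apply/funext => n; rewrite sqrtrV.
    rewrite -[X in _ --> X]sqrtr0; apply: continuous_cvg; first exact: sqrt_continuous.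
    exact: cvg_invn.
  apply: (squeeze_cvgr (f := cst 0)
    (h := fun n => xi w ^+ 2 * (c * `|xi w| / Num.sqrt n%:R))).
  + apply: nearW => n; apply/andP; split; first by rewrite mulr_ge0 ?sqr_ge0.
    by apply: ler_wpM2l; [exact: sqr_ge0|rewrite ge_min lexx orbT].
  + exact: cvg_cst.
  + by rewrite -[X in _ --> X](mulr0 (xi w ^+ 2)); apply: cvgM => //; exact: cvg_cst.
- move=> n w; rewrite normrM (ger0_norm (sqr_ge0 _)) (ger0_norm (min0 n w)).
  by rewrite ler_piMr ?sqr_ge0// ge_min lexx.
Qed.

Lemma lindeberg_bound n (gam : nat -> R) (c : R) i (h : R -> R) :
  (1 <= n)%N -> measurable_fun setT h -> `|gam i| <= c ->
  (forall x, `|h x| <= 4 * (x ^+ 2 * Num.min 1 `|x|)) ->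
  `|(\int[P]_w h (step_angle n gam i (xi w)))%R| <= 4 * c ^+ 2 * lindeberg c n / n%:R.
Proof.
move=> n1 mh gc hx; have [mxi ixi] := std_sqint (walk_L2 hW).
have c0 : 0 <= c by exact: le_trans gc.
have n0 : 0 < n%:R :> R by rewrite ltr0n.
have s0 : 0 < Num.sqrt n%:R :> R by rewrite sqrtr_gt0.
have min0 w : 0 <= Num.min 1 (c * `|xi w| / Num.sqrt n%:R).
  by rewrite le_min ler01 divr_ge0 ?mulr_ge0 ?sqrtr_ge0.
have iL : P.-integrable setT (EFin \o
    (fun w => xi w ^+ 2 * Num.min 1 (c * `|xi w| / Num.sqrt n%:R))).
  apply: le_integrable ixi => //.
    apply/measurable_EFinP; apply: measurable_funM; first exact: measurable_funX.
    apply: measurable_minr; first exact: measurable_cst.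
    apply: measurable_funM; last exact: measurable_cst.
    by apply: measurable_funM; [exact: measurable_cst|exact: measurableT_comp].
  move=> w _; rewrite /= lee_fin normrM (ger0_norm (sqr_ge0 _)) (ger0_norm (min0 w)).
  by rewrite ler_piMr ?sqr_ge0// ge_min lexx.
pose q := 4 * c ^+ 2 / n%:R.
have hw w : `|h (step_angle n gam i (xi w))| <=
    q * (xi w ^+ 2 * Num.min 1 (c * `|xi w| / Num.sqrt n%:R)).
  apply: le_trans (hx _) _; rewrite /q.
  set x := step_angle _ _ _ _.
  have xc : `|x| <= c * `|xi w| / Num.sqrt n%:R.
    rewrite /x /step_angle !normrM normfV (ger0_norm (ltW s0)) mulrA.
    by rewrite ler_pM2r ?invr_gt0//; exact: ler_wpM2r.
  have x2 : x ^+ 2 <= c ^+ 2 / n%:R * xi w ^+ 2.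
    rewrite -(real_normK (num_real x)).
    rewrite (_ : _ / _ * _ = (c * `|xi w| / Num.sqrt n%:R) ^+ 2).
      by rewrite ler_sqr ?nnegrE// divr_ge0 ?mulr_ge0 ?sqrtr_ge0.
    by rewrite expr_div_n exprMn real_normK ?num_real// sqr_sqrtr; [ring|exact: ltW].
  rewrite (_ : _ / _ * _ = 4 * ((c ^+ 2 / n%:R * xi w ^+ 2) *
     Num.min 1 (c * `|xi w| / Num.sqrt n%:R))); last by ring.
  have mn0 : 0 <= Num.min 1 `|x| by rewrite le_min ler01 normr_ge0.
  have mnle : Num.min 1 `|x| <= Num.min 1 (c * `|xi w| / Num.sqrt n%:R).
    by rewrite le_min ge_min lexx/= ge_min xc orbT.
  by apply: ler_wpM2l => //; exact: ler_pM (sqr_ge0 _) mn0 x2 mnle.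
have iq := integrableZl measurableT q iL.
have ih : P.-integrable setT (EFin \o (fun w => h (step_angle n gam i (xi w)))).
  apply: le_integrable iq => //.
    apply/measurable_EFinP; apply: measurableT_comp => //; apply: measurableT_comp => //.
    exact: measurable_step_angle.
  move=> w _; rewrite /= lee_fin; apply: le_trans (hw w) _.
  exact: ler_norm.
apply: le_trans (le_normr_Rintegral _ ih) _ => //.
rewrite (_ : _ / _ = q * lindeberg c n); last by rewrite /q; ring.
rewrite /lindeberg -RintegralZl//; apply: le_Rintegral => //.
exact: integrable_norm.
Qed.

End wick_limits.

(** * Convergence of the Wick exponentials *)

Section wick_convergence.
Context {d : measure_display} {T : measurableType d} {R : realType}.
Variables (P : probability T R) (B : R -> {RV P >-> R}) (xi : {RV P >-> R}).
Variable xi_ : nat -> nat -> {RV P >-> R}.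
Hypothesis hW : walk_approximation B xi xi_.
Local Notation sq := (sqint P setT).
Local Notation ip := (L2inner P setT).
Local Notation nrm := (L2norm P setT).
Implicit Types (l : seq (R * R)).

Let rot n l := rotprod n (xi_ n) (@rot_re R) (@rot_im R) (grid_integrand n l).

Definition walk_wick n l := wick n (xi_ n) (grid_integrand n l).

Lemma sqint_xi_angle n (gam : nat -> R) i : sq (fun w => step_angle n gam i (xi w)).
Proof.
rewrite (_ : (fun w => _) = (fun w => (gam i / Num.sqrt n%:R) * xi w)).
  by apply: sqintZ => //; exact: (std_sqint (walk_L2 hW)).
by apply/funext => w; rewrite /step_angle mulrAC mulrA.
Qed.

Lemma integrable_xi_angle n (gam : nat -> R) i (h : R -> R) : measurable_fun setT h ->
  (forall x, `|h x| <= 1 + `|x|) ->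
  P.-integrable setT (EFin \o (fun w => h (step_angle n gam i (xi w)))).
Proof.
move=> mh hx; apply: sqint_integrable.
apply: (sqint_le measurableT _
  (sqintD measurableT (sqint_cst P 1) (sqint_norm measurableT (sqint_xi_angle n gam i))) _).1.
- by apply: measurableT_comp => //; apply: measurableT_comp => //; exact: measurable_step_angle.
- by move=> w _; apply: le_trans (hx _) _; rewrite [leRHS]ger0_norm// addr_ge0.
Qed.

(** The linear term vanishes because steps are centred, and the quadratic term is
    exact because they have variance one. *)
Lemma rot_re_mean n (gam : nat -> R) (c : R) i : (1 <= n)%N -> `|gam i| <= c ->
  `|(\int[P]_w rot_re (step_angle n gam i (xi w)))%R - 1 - gam i ^+ 2 / (2 * n%:R)| <=
  4 * c ^+ 2 * lindeberg xi c n / n%:R.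
Proof.
move=> n1 gc; have n0 : 0 < n%:R :> R by rewrite ltr0n.
have mh : measurable_fun setT (fun x : R => rot_re x - 1 - x ^+ 2 / 2).
  apply: measurable_funB.
    by apply: measurable_funB; [exact: measurable_rot_re|exact: measurable_cst].
  by apply: measurable_funM; [exact: exprn_measurable|exact: measurable_cst].
have := lindeberg_bound hW n1 mh gc (@rot_re_expansion R).
have ire := integrable_xi_angle n gam i (@measurable_rot_re R) (@norm_rot_re R).
have i1 : P.-integrable setT (EFin \o (fun=> 1 : R)) by exact/bm_integrable/bm_cst.
have ix := (std_sqint (walk_L2 hW)).2.
have ix2 := integrableZl measurableT (gam i ^+ 2 / (2 * n%:R)) ix.
rewrite (_ : (\int[P]_w _)%R = (\int[P]_w rot_re (step_angle n gam i (xi w)))%R - 1 -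
  gam i ^+ 2 / (2 * n%:R))//.
rewrite (_ : (\int[P]_w _)%R = (\int[P]_w ((rot_re (step_angle n gam i (xi w)) - 1) -
   gam i ^+ 2 / (2 * n%:R) * xi w ^+ 2))%R); last first.
  apply: eq_Rintegral => w _; congr (_ - _).
  rewrite /step_angle exprMn expr_div_n sqr_sqrtr; last exact: ltW.
  by field; rewrite gt_eqF.
rewrite RintegralB//; last exact: (integrableB measurableT ire i1).
rewrite RintegralB// Rintegral_prob_cst RintegralZl//.
by rewrite (std_var (walk_L2 hW) (walk_mean hW) (walk_var hW)) mulr1.
Qed.

(** By independence this is a product of factors 1 + g(i/n)^2 / (2n) up to o(1/n),
    and there are O(n) of them. *)
Lemma cvg_rot_mean (s : R) l : 0 <= s -> times_within s l ->
  (\int[P]_w (rot n l (grid n s) w).1)%R @[n --> \oo] --> expR (energy_form l / 2).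
Proof.
move=> s0 ls; pose c := integrand_bound l.
have c0 : 0 <= c by exact: integrand_bound_ge0.
pose L n := lindeberg xi c n.
have cL : L n @[n --> \oo] --> (0 : R) := cvg_lindeberg hW c0.
pose p n := \prod_(1 <= i < (grid n s).+1) (1 + grid_integrand n l i ^+ 2 / (2 * n%:R)).
have cp : p n @[n --> \oo] --> expR (energy_form l / 2).
  apply: (@cvg_prod1D _ (fun n => grid n s)
    (fun n i => grid_integrand n l i ^+ 2 / (2 * n%:R)) (fun n => c ^+ 2 / 2 * n%:R^-1)).
  - move=> n i; rewrite mulr_ge0 ?sqr_ge0 ?invr_ge0 ?mulr_ge0//=.
    rewrite invfM mulrA ler_wpM2r ?invr_ge0// ler_wpM2r ?invr_ge0//.
    exact: integrand_sqr_le.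
  - rewrite -[X in _ --> X](mulr0 (c ^+ 2 / 2)).
    by apply: cvgM; [exact: cvg_cst|exact: cvg_invn].
  - have -> : (fun n => \sum_(1 <= i < (grid n s).+1) (grid_integrand n l i ^+ 2 / (2 * n%:R))) =
      (fun n => (\sum_(1 <= i < (grid n s).+1) (grid_integrand n l i ^+ 2 / n%:R)) * 2^-1).
      apply/funext => n; rewrite mulr_suml; apply: eq_bigr => i _.
      by rewrite invfM mulrCA mulrC.
    by apply: cvgM; [exact: cvg_sum_grid_integrand|exact: cvg_cst].
have L0 n : 0 <= L n.
  apply: Rintegral_ge0 => w _; rewrite mulr_ge0 ?sqr_ge0// le_min ler01.
  by rewrite divr_ge0 ?mulr_ge0 ?sqrtr_ge0.
pose err n := 8 * c ^+ 2 * s * L n * expR ((c ^+ 2 / 2 + 8 * c ^+ 2 * L n) * s).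
have cerr : err n @[n --> \oo] --> 0.
  rewrite -[X in _ --> X](_ : 8 * c ^+ 2 * s * 0 *
     expR ((c ^+ 2 / 2 + 8 * c ^+ 2 * 0) * s) = 0); last by rewrite mulr0 mul0r.
  apply: cvgM; first by apply: cvgM => //; exact: cvg_cst.
  apply: continuous_cvg; first exact: continuous_expR.
  apply: cvgM; last exact: cvg_cst.
  apply: cvgD; first exact: cvg_cst.
  by apply: cvgM => //; exact: cvg_cst.
suff H : \forall n \near \oo, `|(\int[P]_w (rot n l (grid n s) w).1)%R - p n| <= err n.
  have c1 : (\int[P]_w (rot n l (grid n s) w).1)%R - p n @[n --> \oo] --> 0.
    apply/norm_cvg0P; apply: (squeeze_cvgr (f := cst 0) (h := err)) => //.
      by apply: filterS H => n Hn; rewrite normr_ge0.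
    exact: cvg_cst.
  rewrite -[X in _ --> X]add0r.
  have -> : (fun n => (\int[P]_w (rot n l (grid n s) w).1)%R) =
      (fun n => ((\int[P]_w (rot n l (grid n s) w).1)%R - p n) + p n).
    by apply/funext => n; rewrite subrK.
  exact: cvgD.
near=> n; have n1 : (1 <= n)%N by near: n; exact: nbhs_infty_ge.
have n0 : 0 < n%:R :> R by rewrite ltr0n.
have std := walk_standard hW n1.
pose gam := grid_integrand n l.
have gc i : `|gam i| <= c by exact: integrand_le.
pose e := 4 * c ^+ 2 * L n / n%:R.
have e0 : 0 <= e by rewrite divr_ge0// !mulr_ge0 ?sqr_ge0.
pose k := c ^+ 2 / (2 * n%:R).
pose a i := (\int[P]_w rot_re (step_angle n gam i (xi w)))%R.
pose b i := (\int[P]_w rot_im (step_angle n gam i (xi w)))%R.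
have sre i : sq (fun w => rot_re (step_angle n gam i.+1 (xi_ n i.+1 w))).
  by apply: sqint_1norm_angle => //; [exact: measurable_rot_re|exact: norm_rot_re].
have sim i : sq (fun w => rot_im (step_angle n gam i.+1 (xi_ n i.+1 w))).
  by apply: sqint_1norm_angle => //; [exact: measurable_rot_im|exact: norm_rot_im].
have aE i : (\int[P]_w rot_re (step_angle n gam i.+1 (xi_ n i.+1 w)))%R = a i.+1.
  apply: (same_distribution_Rintegral (walk_distr hW n1 (ltn0Sn i))
     (h := fun y => rot_re (step_angle n gam i.+1 y))).
    by apply: measurableT_comp; [exact: measurable_rot_re|exact: measurable_step_angle].
  by apply: integrable_xi_angle; [exact: measurable_rot_re|exact: norm_rot_re].
have bE i : (\int[P]_w rot_im (step_angle n gam i.+1 (xi_ n i.+1 w)))%R = b i.+1.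
  apply: (same_distribution_Rintegral (walk_distr hW n1 (ltn0Sn i))
     (h := fun y => rot_im (step_angle n gam i.+1 y))).
    by apply: measurableT_comp; [exact: measurable_rot_im|exact: measurable_step_angle].
  by apply: integrable_xi_angle; [exact: measurable_rot_im|exact: norm_rot_im].
have mean j := rotprod_mean std (@measurable_rot_re R) (@measurable_rot_im R) sre sim j.
have := @rotation_recursion_bound R (grid n s)
  (fun j => (\int[P]_w (rot n l j w).1)%R) (fun j => (\int[P]_w (rot n l j w).2)%R)
  a b (fun i => gam i ^+ 2 / (2 * n%:R)) e k.
move=> /(_ _ _ e0) H; apply: le_trans (_ : _ <= 2 * e * (grid n s)%:R *
    expR ((k + 2 * e) * (grid n s)%:R)) _.
  apply: le_trans (H _ _ _ _ _ _ _).
  - by rewrite lerDl.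
  - by rewrite /rot /= Rintegral_prob_cst.
  - by rewrite /rot /= Rintegral_prob_cst.
  - by move=> j; rewrite (mean j).1 aE bE.
  - by move=> j; rewrite (mean j).2 aE bE.
  - move=> i; rewrite mulr_ge0 ?sqr_ge0 ?invr_ge0 ?mulr_ge0//=.
    by rewrite ler_wpM2r ?invr_ge0 ?mulr_ge0//; exact: integrand_sqr_le.
  - by move=> i; exact: rot_re_mean.
  - move=> i; apply: (lindeberg_bound hW n1 _ (gc i)); first exact: measurable_rot_im.
    exact: rot_im_expansion.
have /andP[_ ms] := grid_bounds n1 s0.
have E1 : 2 * e * (grid n s)%:R <= 8 * c ^+ 2 * s * L n.
  rewrite (_ : _ * _ = 8 * c ^+ 2 * L n * ((grid n s)%:R / n%:R)); last by rewrite /e; ring.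
  rewrite (_ : 8 * _ * s * _ = 8 * c ^+ 2 * L n * s); last by ring.
  by apply: ler_wpM2l => //; rewrite !mulr_ge0 ?sqr_ge0.
apply: ler_pM => //.
- by rewrite !mulr_ge0.
- rewrite ler_expR (_ : _ * _ = (c ^+ 2 / 2 + 8 * c ^+ 2 * L n) * ((grid n s)%:R / n%:R)).
    by apply: ler_wpM2l => //; rewrite addr_ge0 ?divr_ge0 ?mulr_ge0 ?sqr_ge0.
  by rewrite /k /e; field; rewrite gt_eqF.
Unshelve. all: by end_near. Qed.

Lemma walk_wick_adapted_sq n l j : (1 <= n)%N ->
  (adapted (xi_ n) j (fun w => (walk_wick n l j w).1) /\
   sq (fun w => (walk_wick n l j w).1)) /\
  (adapted (xi_ n) j (fun w => (walk_wick n l j w).2) /\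
   sq (fun w => (walk_wick n l j w).2)).
Proof. by move=> n1; apply: wick_adapted_sq; exact: (walk_standard hW n1). Qed.

Lemma cvg_walk_wick_norm (s : R) l : times_within s l ->
  nrm (fun w => (walk_wick n l (grid n s) w).1) ^+ 2 +
  nrm (fun w => (walk_wick n l (grid n s) w).2) ^+ 2 @[n --> \oo] --> expR (energy_form l).
Proof.
move=> ls; pose c := integrand_bound l.
apply: (@cvg_trans _ ((\prod_(1 <= i < (grid n s).+1)
    (1 + grid_integrand n l i ^+ 2 / n%:R)) @[n --> \oo])).
  apply: near_eq_cvg; near=> n.
  have n1 : (1 <= n)%N by near: n; exact: nbhs_infty_ge.
  by rewrite /walk_wick wick_norm//; exact: (walk_standard hW n1).
apply: (@cvg_prod1D _ (fun n => grid n s)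
    (fun n i => grid_integrand n l i ^+ 2 / n%:R) (fun n => c ^+ 2 * n%:R^-1)).
- move=> n i; rewrite mulr_ge0 ?sqr_ge0 ?invr_ge0//=.
  by rewrite ler_wpM2r ?invr_ge0//; exact: integrand_sqr_le.
- rewrite -[X in _ --> X](mulr0 (c ^+ 2)).
  by apply: cvgM; [exact: cvg_cst|exact: cvg_invn].
- exact: cvg_sum_grid_integrand.
Unshelve. all: by end_near. Qed.

Definition wick_cos l : T -> R := fun w => expR (energy_form l / 2) * cos (theta B l w).
Definition wick_sin l : T -> R := fun w => expR (energy_form l / 2) * sin (theta B l w).

Lemma bm_wick_cos l : bounded_measurable (wick_cos l).
Proof. by apply: (@bmM _ _ _ (fun=> _)); [exact: bm_cst|exact/bm_cos/measurable_theta]. Qed.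

Lemma bm_wick_sin l : bounded_measurable (wick_sin l).
Proof. by apply: (@bmM _ _ _ (fun=> _)); [exact: bm_cst|exact/bm_sin/measurable_theta]. Qed.

(** Against exp(i theta) of the walk this is [cvg_rot_mean]; replacing it by
    the theta of B costs the distance in probability times the bounded norms. *)
Lemma cvg_walk_wick_ip (s : R) l : 0 <= s -> times_within s l ->
  ip (fun w => (walk_wick n l (grid n s) w).1) (fun w => cos (theta B l w)) +
  ip (fun w => (walk_wick n l (grid n s) w).2) (fun w => sin (theta B l w)) @[n --> \oo] -->
  expR (energy_form l / 2).
Proof.
move=> s0 ls.
pose C n : T -> R := fun w => (walk_wick n l (grid n s) w).1.
pose S n : T -> R := fun w => (walk_wick n l (grid n s) w).2.
pose err n := 4 * (1 + (nrm (C n) ^+ 2 + nrm (S n) ^+ 2)) *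
  pdist P (walk_theta xi_ n l) (theta B l).
have l0 p : p \in l -> 0 <= p.2 by move=> pl; case: (times_withinP ls pl).
have cerr : err n @[n --> \oo] --> 0.
  rewrite -[X in _ --> X](mulr0 (4 * (1 + expR (energy_form l)))).
  apply: cvgM; last exact: (cvg_pdist_theta hW l0).
  apply: cvgM; first exact: cvg_cst.
  apply: cvgD; first exact: cvg_cst.
  exact: cvg_walk_wick_norm.
have cU := cvg_rot_mean s0 ls.
pose U n := (\int[P]_w (rot n l (grid n s) w).1)%R.
suff H : \forall n \near \oo, `|(ip (C n) (fun w => cos (theta B l w)) +
    ip (S n) (fun w => sin (theta B l w))) - U n| <= err n.
  have c1 : (ip (C n) (fun w => cos (theta B l w)) +
    ip (S n) (fun w => sin (theta B l w))) - U n @[n --> \oo] --> 0.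
    apply/norm_cvg0P; apply: (squeeze_cvgr (f := cst 0) (h := err)) => //.
      by apply: filterS H => n Hn; rewrite normr_ge0.
    exact: cvg_cst.
  rewrite -[X in _ --> X]add0r.
  have -> : (fun n => ip (C n) (fun w => cos (theta B l w)) +
     ip (S n) (fun w => sin (theta B l w))) =
      (fun n => ((ip (C n) (fun w => cos (theta B l w)) +
    ip (S n) (fun w => sin (theta B l w))) - U n) + U n).
    by apply/funext => n; rewrite subrK.
  exact: cvgD.
near=> n; have n1 : (1 <= n)%N by near: n; exact: nbhs_infty_ge.
have [[aC sC] [aS sS]] := @walk_wick_adapted_sq n l (grid n s) n1.
have mt := measurable_theta B l; have mt' := measurable_walk_theta xi_ n l.
have sc : sq (fun w => cos (theta B l w)) by exact/bm_sqint/bm_cos.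
have ss : sq (fun w => sin (theta B l w)) by exact/bm_sqint/bm_sin.
have sc' : sq (fun w => cos (walk_theta xi_ n l w)) by exact/bm_sqint/bm_cos.
have ss' : sq (fun w => sin (walk_theta xi_ n l w)) by exact/bm_sqint/bm_sin.
have -> : U n = ip (C n) (fun w => cos (walk_theta xi_ n l w)) +
    ip (S n) (fun w => sin (walk_theta xi_ n l w)).
  rewrite /L2inner -RintegralD//; try exact: sqint_integrableM.
  apply: eq_Rintegral => w _.
  by rewrite /rot wick_rotated (walk_theta_integral _ n1 ls).
rewrite opprD addrACA -!ipBr//.
have dc : nrm (fun w => cos (theta B l w) - cos (walk_theta xi_ n l w)) <=
    2 * pdist P (walk_theta xi_ n l) (theta B l).
  rewrite -[leLHS](nrm_distC P setT (fun w => cos (walk_theta xi_ n l w))).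
  by apply: pdist_lipschitz => //; [exact: measurable_cosR|exact: cos_clip_lip].
have ds : nrm (fun w => sin (theta B l w) - sin (walk_theta xi_ n l w)) <=
    2 * pdist P (walk_theta xi_ n l) (theta B l).
  rewrite -[leLHS](nrm_distC P setT (fun w => sin (walk_theta xi_ n l w))).
  by apply: pdist_lipschitz => //; [exact: measurable_sinR|exact: sin_clip_lip].
have h1 := ip_le measurableT sC (sqintB measurableT sc sc').
have h2 := ip_le measurableT sS (sqintB measurableT ss ss').
apply: le_trans (ler_normD _ _) _; apply: le_trans (lerD h1 h2) _.
have k1 := ler_wpM2l (nrm_ge0 P setT (C n)) dc.
have k2 := ler_wpM2l (nrm_ge0 P setT (S n)) ds.
apply: le_trans (lerD k1 k2) _; rewrite /err.
have := pdist_ge0 P (walk_theta xi_ n l) (theta B l).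
have := sqr_ge0 (nrm (C n) - 1); have := sqr_ge0 (nrm (S n) - 1).
move: (nrm (C n)) (nrm (S n)) (pdist _ _ _) => x y z; nra.
Unshelve. all: by end_near. Qed.

(** Expanding the squared distance, the norm tends to exp q and the correlation
    to exp(q/2), so that exp q - 2 exp(q/2) exp(q/2) + exp q = 0 remains: uniform
    integrability and central limit theorems are bypassed. *)
Lemma cvg_walk_wick (s : R) l : 0 <= s -> times_within s l ->
  nrm ((fun w => (walk_wick n l (grid n s) w).1) - wick_cos l) @[n --> \oo] --> 0 /\
  nrm ((fun w => (walk_wick n l (grid n s) w).2) - wick_sin l) @[n --> \oo] --> 0.
Proof.
move=> s0 ls; pose E := expR (energy_form l / 2).
pose C n : T -> R := fun w => (walk_wick n l (grid n s) w).1.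
pose S n : T -> R := fun w => (walk_wick n l (grid n s) w).2.
have EE : expR (energy_form l) = E ^+ 2.
  by rewrite expr2 -expRD; congr expR; lra.
have mt := measurable_theta B l.
have sc : sq (fun w => cos (theta B l w)) by exact/bm_sqint/bm_cos.
have ss : sq (fun w => sin (theta B l w)) by exact/bm_sqint/bm_sin.
have swc : sq (wick_cos l) by exact/bm_sqint/bm_wick_cos.
have sws : sq (wick_sin l) by exact/bm_sqint/bm_wick_sin.
pose tot n := (nrm (C n) ^+ 2 + nrm (S n) ^+ 2) -
  2 * E * (ip (C n) (fun w => cos (theta B l w)) + ip (S n) (fun w => sin (theta B l w))) +
  E ^+ 2.
have ctot : tot n @[n --> \oo] --> 0.
  rewrite -[X in _ --> X](_ : expR (energy_form l) - 2 * E * E + E ^+ 2 = 0); last first.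
    by rewrite EE; ring.
  apply: cvgD; last exact: cvg_cst.
  apply: cvgB; first exact: cvg_walk_wick_norm.
  by apply: cvgM; [exact: cvg_cst|exact: cvg_walk_wick_ip].
have Etot n : (1 <= n)%N ->
    nrm (C n - wick_cos l) ^+ 2 + nrm (S n - wick_sin l) ^+ 2 = tot n.
  move=> n1; have [[aC sC] [aS sS]] := @walk_wick_adapted_sq n l (grid n s) n1.
  rewrite /tot !nrm_sqr.
  have eC : ip (C n - wick_cos l) (C n - wick_cos l) = ip (C n) (C n) -
      2 * E * ip (C n) (fun w => cos (theta B l w)) +
      E ^+ 2 * ip (fun w => cos (theta B l w)) (fun w => cos (theta B l w)).
    rewrite (ipBl measurableT sC swc (sqintB measurableT sC swc)) !(ipBr measurableT sC swc)//.
    rewrite (ipC _ _ (wick_cos l) (C n)) /wick_cos -/E !(ipZl measurableT, ipZr measurableT)//; ring.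
  have eS : ip (S n - wick_sin l) (S n - wick_sin l) = ip (S n) (S n) -
      2 * E * ip (S n) (fun w => sin (theta B l w)) +
      E ^+ 2 * ip (fun w => sin (theta B l w)) (fun w => sin (theta B l w)).
    rewrite (ipBl measurableT sS sws (sqintB measurableT sS sws)) !(ipBr measurableT sS sws)//.
    rewrite (ipC _ _ (wick_sin l) (S n)) /wick_sin -/E !(ipZl measurableT, ipZr measurableT)//; ring.
  have e1 : ip (fun w => cos (theta B l w)) (fun w => cos (theta B l w)) +
     ip (fun w => sin (theta B l w)) (fun w => sin (theta B l w)) = 1.
    rewrite /L2inner -RintegralD//; try exact: sqint_integrableM.
    rewrite -[RHS](Rintegral_prob_cst P 1); apply: eq_Rintegral => w _.
    by rewrite -!expr2 cos2Dsin2.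
  rewrite eC eS -[X in _ = _ + X]mulr1 -e1; ring.
have sqr_cvg (f : nat -> R) : (forall n, 0 <= f n) ->
    (forall n, (1 <= n)%N -> f n ^+ 2 <= tot n) -> f n @[n --> \oo] --> 0.
  move=> f0 ft; apply: (squeeze_cvgr (f := cst 0) (h := fun n => Num.sqrt (tot n))).
  - near=> n; rewrite f0/= -[leLHS]ger0_norm// -sqrtr_sqr ler_wsqrtr// ft//.
    by near: n; exact: nbhs_infty_ge.
  - exact: cvg_cst.
  - rewrite -[X in _ --> X]sqrtr0; apply: continuous_cvg => //; exact: sqrt_continuous.
split; apply: sqr_cvg => n; rewrite ?nrm_ge0// => n1; rewrite -Etot//.
- by rewrite lerDl sqr_ge0.
- by rewrite lerDr sqr_ge0.
Unshelve. all: by end_near. Qed.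

End wick_convergence.

(** * Convergence of the walk in L^2 *)

Section walk_L2_limit.
Context {d : measure_display} {T : measurableType d} {R : realType}.
Variables (P : probability T R) (B : R -> {RV P >-> R}) (xi : {RV P >-> R}).
Variable xi_ : nat -> nat -> {RV P >-> R}.
Hypothesis hW : walk_approximation B xi xi_.
Local Notation sq := (sqint P setT).
Local Notation nrm := (L2norm P setT).
Implicit Types (l : seq (R * R)).

(** Fatou along truncations: [clip] is bounded and Lipschitz, so it passes from
    convergence in probability to L^2, and the truncation level is then removed. *)
Lemma fatou_pdist (f_ : nat -> T -> R) (f : T -> R) (c : R) : 0 <= c ->
  (forall n, measurable_fun setT (f_ n)) -> measurable_fun setT f ->
  pdist P (f_ n) f @[n --> \oo] --> 0 ->
  (\forall n \near \oo, sq (f_ n) /\ nrm (f_ n) <= c) ->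
  sq f /\ nrm f <= c.
Proof.
move=> c0 mf_ mf cf fc.
have clipK (K : nat) : nrm (fun w => clip K%:R (f w)) <= c.
  apply/ler_addgt0Pr => e e0.
  have M0 : 0 <= 1 + 2 * K%:R :> R by rewrite addr_ge0// mulr_ge0.
  (* for |x - y| >= 1 the difference of the truncations is at most 2K *)
  have lip (x y : R) : `|clip K%:R x - clip K%:R y| <= (1 + 2 * K%:R) * `|clip 1 (x - y)|.
    have K0 : 0 <= K%:R :> R by [].
    rewrite norm_clip1; have h1 := clip_lip x y K0.
    have h2 := ler_normB (clip K%:R x) (clip K%:R y).
    have h3 := clip_le x K0; have h4 := clip_le y K0.
    have h5 := normr_ge0 (x - y); move: (`|x - y|) h1 h5 => z h1 h5.
    by have [_|_] := leP 1 z; nra.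
  have c1 : (1 + 2 * K%:R) * pdist P (f_ n) f @[n --> \oo] --> (0 : R).
    rewrite -[X in _ --> X](mulr0 (1 + 2 * K%:R)).
    by apply: cvgM => //; exact: cvg_cst.
  have H : \forall n \near \oo, (1 + 2 * K%:R) * pdist P (f_ n) f <= e.
    move/cvgrPdist_le : c1 => /(_ _ e0); apply: filterS => n.
    rewrite sub0r normrN; apply: le_trans; exact: ler_norm.
  have [n [[sn fn] Hn]] := filter_ex (filterI fc H).
  have K0 : 0 <= K%:R :> R by [].
  have scn : sq (fun w => clip K%:R (f_ n w)) by apply: bm_sqint; exact: clip_bm.
  have sc : sq (fun w => clip K%:R (f w)) by apply: bm_sqint; exact: clip_bm.
  have h1 : nrm (fun w => clip K%:R (f_ n w)) <= nrm (f_ n).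
    apply: (sqint_le measurableT _ sn _).2.
      by apply: measurableT_comp => //; exact: measurable_clip.
    by move=> w _; exact: clip_le_id.
  have h2 : nrm ((fun w => clip K%:R (f_ n w)) - (fun w => clip K%:R (f w))) <= e.
    apply: le_trans Hn.
    by apply: pdist_lipschitz => //; exact: measurable_clip.
  have h3 := nrm_lip measurableT sc scn; rewrite nrm_distC in h3.
  have h4 := ler_norm (nrm (fun w => clip K%:R (f w)) - nrm (fun w => clip K%:R (f_ n w))).
  lra.
have : (\int[P]_w (f w ^+ 2)%:E <= (c ^+ 2)%:E)%E.
  have cl w : ((clip n%:R (f w) ^+ 2)%:E @[n --> \oo] --> (f w ^+ 2)%:E)%E.
    apply: cvg_EFin; first exact: nearW.
    have h := @cvg_clip R (f w).
    rewrite (_ : fine \o _ = (fun n => clip n%:R (f w) * clip n%:R (f w))); last first.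
      by apply/funext => k /=; rewrite expr2.
    by rewrite /= expr2; exact: (cvgM h h).
  have mcl n : measurable_fun setT (fun w => (clip n%:R (f w) ^+ 2)%:E).
    apply/measurable_EFinP; apply: measurable_funX.
    by apply: measurableT_comp => //; exact: measurable_clip.
  have H := @fatou _ _ _ P setT measurableT (fun n w => (clip n%:R (f w) ^+ 2)%:E) mcl.
  have -> : (\int[P]_w (f w ^+ 2)%:E =
     \int[P]_w limn_einf (fun n => (clip n%:R (f w) ^+ 2)%:E))%E.
    apply: eq_integral => w _; rewrite is_cvg_limn_einfE.
      exact/esym/cvg_lim.
    by apply/cvg_ex; eexists; exact: cl.
  apply: le_trans (H _) _; first by move=> n w _; rewrite lee_fin sqr_ge0.
  rewrite limn_einf_lim; apply: lime_le; first exact: is_cvg_einfs.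
  apply: nearW => n; apply: (@le_trans _ _ (\int[P]_w (clip n%:R (f w) ^+ 2)%:E)%E).
    by apply: ereal_inf_lbound; exists n => /=.
  have sc : sq (fun w => clip n%:R (f w)) by apply: bm_sqint; exact: clip_bm.
  by rewrite -(nrm_sqrE measurableT sc) lee_fin ler_sqr ?nnegrE ?nrm_ge0.
move=> /(sqint_int_le measurableT mf)[sf nf]; split=> //.
by move: nf; rewrite ler_sqr ?nnegrE ?nrm_ge0.
Qed.

Definition walk_phase n l phi (j : nat) : T -> R :=
  wick_phase n (xi_ n) (grid_integrand n l) phi j.

(** Bound for the second moments of the Wick exponentials up to time s. *)
Definition growth (s : R) l : R := expR (integrand_bound l ^+ 2 * s).

(** 1 + x <= exp x in [wick_norm]. *)
Lemma walk_phase_norm_le n l phi j (s : R) : (1 <= n)%N -> 0 <= s -> (j <= grid n s)%N ->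
  nrm (walk_phase n l phi j) ^+ 2 <= growth s l.
Proof.
move=> n1 s0 js; have n0 : 0 < n%:R :> R by rewrite ltr0n.
apply: le_trans (wick_phase_norm_le n (walk_standard hW n1) _ phi j) _.
apply: le_trans (prod1D_expR_le _ _) _.
  by move=> i; rewrite divr_ge0 ?sqr_ge0.
rewrite ler_expR; apply: (@le_trans _ _ (\sum_(1 <= i < j.+1) integrand_bound l ^+ 2 / n%:R)).
  by apply: ler_sum => i _; rewrite ler_wpM2r ?invr_ge0//; exact: integrand_sqr_le.
rewrite sumr_const_nat subn1 /= -[X in X <= _]mulr_natr -mulrA; apply: ler_wpM2l; first exact: sqr_ge0.
rewrite mulrC; apply: (@le_trans _ _ ((grid n s)%:R / n%:R)).
  by rewrite ler_wpM2r ?invr_ge0// ler_nat.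
by case/andP: (grid_bounds n1 s0).
Qed.

Lemma walk_phase_increment n l phi i j (s : R) : (1 <= n)%N -> 0 <= s ->
  (i <= j)%N -> (j <= grid n s)%N ->
  nrm (walk_phase n l phi j - walk_phase n l phi i) ^+ 2 <=
  (j - i)%:R / n%:R * (integrand_bound l ^+ 2 * growth s l).
Proof.
move=> n1 s0 ij js; have std := walk_standard hW n1.
rewrite /walk_phase !wick_phase_integral opprD addrACA subrr add0r.
apply: le_trans (walk_integral_increment (b := integrand_bound l ^+ 2 * growth s l) n1 std _ ij _) _.
- exact: wick_integrand_predictable.
- case=> // k /andP[ik kj]; rewrite /wick_integrand nrmZ//; last first.
    by case: (@wick_phase_adapted_sq _ _ _ P n (xi_ n) std (grid_integrand n l) (phi + pi / 2) k).
  rewrite exprMn; apply: ler_pM; rewrite ?sqr_ge0//.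
    by rewrite real_normK ?num_real//; exact: integrand_sqr_le.
  apply: walk_phase_norm_le => //.
  exact: leq_trans (ltnW kj) js.
- by rewrite mulrCA mulrA.
Qed.

(** Convergence in probability is upgraded through the Wick exponentials. For a
    small frequency mu, Im prod (1 + i mu xi_i / sqrt n) / mu differs from the
    walk by O(mu) in L^2, uniformly in n, and converges in L^2 as n grows;
    by Fatou its limit is then O(mu)-close to B_t. *)
Lemma cvg_random_walk t : 0 <= t ->
  sq (B t) /\ nrm (random_walk n (xi_ n) t - B t) @[n --> \oo] --> 0.
Proof.
move=> t0.
have mB : measurable_fun setT (B t) by [].
have mrw n : measurable_fun setT (random_walk n (xi_ n) t) by exact: measurable_random_walk.
pose S mu n : T -> R := fun w => mu^-1 * (walk_wick xi_ n [:: (mu, t)] (grid n t) w).2.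
have tw mu : times_within t [:: (mu, t)] by rewrite /times_within /= t0 lexx.
have Sphase mu n w : 0 < mu -> S mu n w = mu^-1 * walk_phase n [:: (mu, t)] (- (pi / 2)) (grid n t) w.
  move=> mu0; rewrite /S /walk_phase /wick_phase cosN sinN cos_pihalf sin_pihalf.
  by congr (_ * _); rewrite /walk_wick; ring.
have cpd : pdist P (random_walk n (xi_ n) t) (B t) @[n --> \oo] --> 0.
  by apply: cvg_in_probability_pdist => //; exact: walk_limit hW t t0.
have rwE n : (1 <= n)%N ->
    random_walk n (xi_ n) t = walk_integral n (xi_ n) (fun=> cst 1) (grid n t).
  move=> n1; apply/funext => w; rewrite /random_walk /walk_integral mulr_sumr.
  by apply: eq_bigr => i _; rewrite /cst; ring.
(* the difference with the walk is the integral of M_(j-1) - 1, and M_0 = 1 *)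
have key mu n : 0 < mu -> mu <= 1 -> (1 <= n)%N -> sq (random_walk n (xi_ n) t) /\
    sq (S mu n) /\ nrm (S mu n - random_walk n (xi_ n) t) ^+ 2 <= (t * mu) ^+ 2 * expR t.
  move=> mu0 mu1 n1; have std := walk_standard hW n1.
  have [i1 i2 i3 i4] := std.
  have n0 : 0 < n%:R :> R by rewrite ltr0n.
  have p1 : predictable_sq (xi_ n) (fun=> cst 1).
    by move=> i i_1; split; [exact: sqint_cst|exact: adapted_cst].
  have s1 : sq (random_walk n (xi_ n) t).
    by rewrite rwE//; exact: (walk_integral_adapted n i1 i2 i4 _ p1).2.
  pose l := [:: (mu, t)].
  have gl i : (i <= grid n t)%N -> grid_integrand n l i = mu.
    by move=> it; rewrite (grid_integrandE _ n1 (tw mu)) big_seq1/= it mulr1.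
  have bl : integrand_bound l = mu by rewrite /integrand_bound big_seq1 gtr0_norm.
  have ph j : sq (walk_phase n l 0 j).
    by case: (@wick_phase_adapted_sq _ _ _ P n (xi_ n) std (grid_integrand n l) 0 j).
  pose Y (i : nat) : T -> R :=
    if i is k.+1 then (if (k < grid n t)%N then walk_phase n l 0 k - cst 1 else 0) else 0.
  have adph j : adapted (xi_ n) j (walk_phase n l 0 j).
    by case: (@wick_phase_adapted_sq _ _ _ P n (xi_ n) std (grid_integrand n l) 0 j).
  have pY : predictable_sq (xi_ n) Y.
    case=> // k _; rewrite /Y; case: ifP => _; last by split; [exact: sqint0|exact: adapted_cst].
    split; first by apply: sqintB => //; exact: sqint_cst.
    by apply: adaptedB; [exact: adph|exact: adapted_cst].
  have SY : S mu n - random_walk n (xi_ n) t = walk_integral n (xi_ n) Y (grid n t).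
    apply/funext => w; change (S mu n w - random_walk n (xi_ n) t w =
      walk_integral n (xi_ n) Y (grid n t) w).
    rewrite Sphase// /walk_phase wick_phase_integral cosN cos_pihalf rwE//.
    change (mu^-1 * (0 + walk_integral n (xi_ n) (wick_integrand n (xi_ n) (grid_integrand n l) (- (pi / 2))) (grid n t) w) -
      walk_integral n (xi_ n) (fun=> cst 1) (grid n t) w = walk_integral n (xi_ n) Y (grid n t) w).
    rewrite add0r /walk_integral mulr_sumr -sumrB big_nat_cond [RHS]big_nat_cond.
    apply: eq_bigr => -[|k] /andP[/andP[k0 kt] _] //.
    rewrite /Y -ltnS kt /wick_integrand gl// addNr.
    change (mu^-1 * (mu * walk_phase n l 0 k w * (xi_ n k.+1 w / Num.sqrt n%:R)) -
      1 * (xi_ n k.+1 w / Num.sqrt n%:R) =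
      (walk_phase n l 0 k w - 1) * (xi_ n k.+1 w / Num.sqrt n%:R)).
    by field; rewrite !gt_eqF ?sqrtr_gt0.
  split=> //; split.
    rewrite -[S mu n](subrK (random_walk n (xi_ n) t)); apply: sqintD => //.
    by rewrite SY; exact: (walk_integral_adapted n i1 i2 i4 _ pY).2.
  have G : growth t l <= expR t.
    by rewrite /growth bl ler_expR; have : mu ^+ 2 <= 1; nra.
  rewrite SY walk_integral_isometry//.
  have Yb k : (1 <= k < (grid n t).+1)%N -> nrm (Y k) ^+ 2 <= t * (mu ^+ 2 * expR t).
    case: k => // k /andP[_ kt]; rewrite /Y -ltnS kt.
    rewrite ltnS in kt.
    have -> : cst 1 = walk_phase n l 0 0.
      by apply/funext => w; rewrite /walk_phase /wick_phase cos0 sin0 /= /cst; ring.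
    apply: le_trans (@walk_phase_increment n l 0 0 k t n1 t0 (leq0n k) (ltnW kt)) _.
    rewrite bl subn0; apply: ler_pM; rewrite ?mulr_ge0 ?sqr_ge0 ?invr_ge0 ?expR_ge0 ?(ltW mu0)//.
      by rewrite le_gridE// ltnW.
    by rewrite ler_wpM2l ?sqr_ge0.
  apply: (@le_trans _ _ (n%:R^-1 * \sum_(1 <= i < (grid n t).+1) t * (mu ^+ 2 * expR t))).
    by rewrite ler_wpM2l ?invr_ge0//; apply: ler_sum_nat => k kt; exact: Yb.
  rewrite sumr_const_nat subn1 /= -[X in _ * X]mulr_natl mulrA.
  have : n%:R^-1 * (grid n t)%:R <= t by rewrite mulrC le_gridE.
  have : 0 <= t * (mu ^+ 2 * expR t) by rewrite !mulr_ge0 ?sqr_ge0 ?expR_ge0// ltW.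
  rewrite exprMn; nra.
pose Y mu : T -> R := fun w => mu^-1 * wick_sin B [:: (mu, t)] w.
have sY mu : sq (Y mu) by apply: sqintZ => //; apply: bm_sqint; exact: bm_wick_sin.
have cS mu : 0 < mu -> nrm (S mu n - Y mu) @[n --> \oo] --> 0.
  move=> mu0.
  have [_ cs] := cvg_walk_wick hW t0 (tw mu).
  have H : `|mu^-1| * nrm ((fun w => (walk_wick xi_ n [:: (mu, t)] (grid n t) w).2) -
      wick_sin B [:: (mu, t)]) @[n --> \oo] --> 0.
    by rewrite -[X in _ --> X](mulr0 `|mu^-1|); apply: cvgM => //; exact: cvg_cst.
  apply: cvg_trans H; apply: near_eq_cvg; near=> n.
  have n1 : (1 <= n)%N by near: n; exact: nbhs_infty_ge.
  rewrite -nrmZ//.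
    by congr nrm; apply/funext => w; rewrite /S /Y /= mulrBr.
  apply: sqintB => //; last by apply: bm_sqint; exact: bm_wick_sin.
  by case: (@walk_wick_adapted_sq _ _ _ P B xi xi_ hW n [:: (mu, t)] (grid n t) n1) => _ [].
have fat mu : 0 < mu -> mu <= 1 -> sq (Y mu - B t) /\ nrm (Y mu - B t) <= t * mu * expR t.
  move=> mu0 mu1.
  have mY : measurable_fun setT (Y mu) by case: (sY mu).
  have mS n : measurable_fun setT (S mu n.+1) by case: (key mu n.+1 mu0 mu1 isT) => _ [[]].
  apply: (@fatou_pdist (fun n => S mu n.+1 - random_walk n.+1 (xi_ n.+1) t)).
  - by rewrite !mulr_ge0 ?expR_ge0// ltW.
  - by move=> n; exact: measurable_funB.
  - exact: measurable_funB.
  - apply: (squeeze_cvgr (f := cst 0) (h := fun n => nrm (S mu n.+1 - Y mu) +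
      (1 + `|-1 : R|) * pdist P (random_walk n.+1 (xi_ n.+1) t) (B t))).
    + apply: nearW => n; rewrite pdist_ge0/=.
      have mNr (X : T -> R) : measurable_fun setT X -> measurable_fun setT (fun w => -1 * X w).
        by move=> mX; apply: measurable_funM => //; exact: measurable_cst.
      have -> : S mu n.+1 - random_walk n.+1 (xi_ n.+1) t =
          (fun w => S mu n.+1 w + -1 * random_walk n.+1 (xi_ n.+1) t w).
        by apply/funext => w; rewrite mulN1r.
      have -> : Y mu - B t = (fun w => Y mu w + -1 * B t w).
        by apply/funext => w; rewrite mulN1r.
      have H := @pdistD _ _ _ P _ _ _ _ (mS n) (mNr _ (mrw n.+1)) mY (mNr _ mB).
      apply: le_trans H _.
      apply: lerD; last exact: pdistZ.
      have sSY : sq (S mu n.+1 - Y mu).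
        by apply: sqintB => //; case: (key mu n.+1 mu0 mu1 isT) => _ [].
      apply: (sqint_le measurableT _ sSY _).2.
        by case: (clip_bm ler01 (measurable_funB (mS n) mY)).
      by move=> w _; exact: clip_le_id.
    + exact: cvg_cst.
    + have c1 : nrm (S mu n.+1 - Y mu) @[n --> \oo] --> 0.
        by rewrite (cvg_shiftS (fun n => nrm (S mu n - Y mu))); exact: cS.
      have c2 : (1 + `|-1 : R|) * pdist P (random_walk n.+1 (xi_ n.+1) t) (B t) @[n --> \oo] -->
          (1 + `|-1 : R|) * 0.
        apply: cvgM; first exact: cvg_cst.
        by rewrite (cvg_shiftS (fun n => pdist P (random_walk n (xi_ n) t) (B t))).
      have c3 := cvgD c1 c2; rewrite mulr0 addr0 in c3; exact: c3.
  - apply: nearW => n; have [s1 [sS nS]] := key mu n.+1 mu0 mu1 isT.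
    split; first exact: sqintB.
    have c0 : 0 <= t * mu * expR t by rewrite !mulr_ge0 ?expR_ge0// ltW.
    rewrite -(@ler_pXn2r _ 2)// ?nnegrE ?nrm_ge0//.
    apply: le_trans nS _; rewrite [leRHS]exprMn ler_wpM2l ?sqr_ge0// expr2.
    by rewrite ler_peMl ?expR_ge0// -expR0 ler_expR.
have sB : sq (B t).
  have [s1 _] := fat 1 ltr01 (lexx _).
  by rewrite -[(B t : T -> R)](subKr (Y 1)); exact: sqintB.
split=> //; apply/cvgrPdist_le => e e0.
pose c := 1 + t * expR t; have c1 : 1 <= c by rewrite lerDl mulr_ge0 ?expR_ge0.
have c0 : 0 < c by apply: lt_le_trans c1.
pose mu := Num.min 1 (e / (4 * c)).
have mu0 : 0 < mu by rewrite lt_min ltr01 divr_gt0// mulr_gt0.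
have mu1 : mu <= 1 by rewrite ge_min lexx.
have muc : t * expR t * mu <= e / 4.
  have h : mu <= e / (4 * c) by rewrite ge_min lexx orbT.
  have : c * mu <= e / 4.
    apply: (@le_trans _ _ (c * (e / (4 * c)))); first by rewrite ler_wpM2l// ltW.
    by rewrite le_eqVlt; apply/orP; left; apply/eqP; field; rewrite gt_eqF.
  by rewrite /c; nra.
have [sYB nYB] := fat mu mu0 mu1.
have e2 : 0 < e / 2 by lra.
have /cvgrPdist_le/(_ _ e2) H := cS mu mu0.
near=> n.
have n1 : (1 <= n)%N by near: n; exact: nbhs_infty_ge.
have [s1 [sS nS]] := key mu n mu0 mu1 n1.
rewrite sub0r normrN ger0_norm ?nrm_ge0//.
have h1 := nrm_dist_trans measurableT s1 sS sB.
have h2 := nrm_dist_trans measurableT sS (sY mu) sB.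
have h3 : nrm (S mu n - Y mu) <= e / 2.
  have : `|0 - nrm (S mu n - Y mu)| <= e / 2 by near: n; exact: H.
  by rewrite sub0r normrN ger0_norm ?nrm_ge0.
have h4 : nrm (S mu n - random_walk n (xi_ n) t) <= t * mu * expR t.
  have cc0 : 0 <= t * mu * expR t by rewrite !mulr_ge0 ?expR_ge0// ltW.
  rewrite -(@ler_pXn2r _ 2)// ?nnegrE ?nrm_ge0//.
  apply: le_trans nS _; rewrite [leRHS]exprMn ler_wpM2l ?sqr_ge0// expr2.
  by rewrite ler_peMl ?expR_ge0// -expR0 ler_expR.
rewrite nrm_distC in h4.
have : t * mu * expR t = t * expR t * mu by ring.
lra.
Unshelve. all: by end_near. Qed.

End walk_L2_limit.

(** * Convergence of elementary integrands *)

Section blocks.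
Context {d : measure_display} {T : measurableType d} {R : realType}.
Variable P : probability T R.
Local Notation tm := (time_measure P).
Local Notation ts := (@time_space d T R).
Local Notation mts := (@measurable_time_space d T R).
Local Notation sq := (sqint P setT).
Local Notation nrm := (L2norm P setT).
Local Notation tnrm := (L2norm tm ts).
Implicit Types (a : T -> R) (s t : R).

(** The integrand that holds the position a during the steps k+1, ..., m. *)
Definition block a (k m : nat) (i : nat) : T -> R := if (k < i <= m)%N then a else cst 0.

Lemma sqint_tensor_itv a s t : sq a -> 0 <= s -> s <= t ->
  sqint tm ts (tensor a `]s, t]) /\ tnrm (tensor a `]s, t]) ^+ 2 = nrm a ^+ 2 * (t - s).
Proof.
move=> sa s0 st; apply: sqint_tensor => //; first exact: itvoc_pos.
exact: lebesgue_itvoc.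
Qed.

Lemma ceil_leE n k (u : R) : (1 <= n)%N -> 0 <= u ->
  (`|Num.ceil (n%:R * u)|%N <= k)%N = (u <= k%:R / n%:R).
Proof.
move=> n1 u0; have n0 : 0 < n%:R :> R by rewrite ltr0n.
have c0 : 0 <= n%:R * u by rewrite mulr_ge0.
rewrite ler_pdivlMr// (mulrC u) -[k%:R]/(k%:Z%:~R) -ceil_le_int.
have : (0 <= Num.ceil (n%:R * u))%R by rewrite ceil_ge0 (lt_le_trans _ c0) ?ltrN10.
by case: (Num.ceil _).
Qed.

Lemma ceil_block n a k m x : (1 <= n)%N -> ts x ->
  ceil_process n (block a k m) x = tensor a `]k%:R / n%:R, m%:R / n%:R] x.
Proof.
move=> n1 /ts_pos x0; rewrite /ceil_process /block /tensor ltnNge !ceil_leE// -ltNge.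
rewrite indicE /=.
have -> : (x.2 \in `]k%:R / n%:R, m%:R / n%:R]%classic) = (k%:R / n%:R < x.2 <= m%:R / n%:R).
  by apply/idP/idP; rewrite inE /= in_itv.
by case: ifP => _; rewrite ?mulr1 ?mulr0.
Qed.

(** Both sides count the same indicator differences: moving the two endpoints of
    ]x, y] separately. *)
Lemma tensor_shift a (x x' y y' : R) p : x' <= x -> y' <= y -> x <= y -> x' <= y' ->
  tensor a `]x', y'] p - tensor a `]x, y] p = tensor a `]x', x] p - tensor a `]y', y] p.
Proof.
move=> h1 h2 h3 h4; rewrite /tensor !indicE.
have E (u v : R) : (p.2 \in `]u, v]%classic) = (u < p.2 <= v).
  by apply/idP/idP; rewrite inE /= in_itv.
rewrite !E -!mulrBr; congr (_ * _).
case: (ltP x' p.2) => c1; case: (ltP x p.2) => c2; case: (leP p.2 y) => c3;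
  case: (leP p.2 y') => c4 /=; rewrite ?subr0 ?subrr ?sub0r//; lra.
Qed.

Lemma sqr_le_sum3 (x y z e : R) : 0 <= e -> e <= x + y + z ->
  e ^+ 2 <= 3 * (x ^+ 2 + y ^+ 2 + z ^+ 2).
Proof.
move=> e0 exyz; have : e ^+ 2 <= (x + y + z) ^+ 2.
  by rewrite ler_sqr ?nnegrE// (le_trans e0).
have := sqr_ge0 (x - y); have := sqr_ge0 (x - z); have := sqr_ge0 (y - z); nra.
Qed.

(** The error splits into the change of the coefficient and the change of the two
    endpoints by less than one step. *)
Lemma cvg_ceil_block (a_ : nat -> T -> R) a s t : 0 <= s -> s <= t ->
  (\forall n \near \oo, sq (a_ n)) -> sq a ->
  nrm (a_ n - a) @[n --> \oo] --> 0 ->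
  tnrm (ceil_process n (block (a_ n) (grid n s) (grid n t)) - tensor a `]s, t])
    @[n --> \oo] --> 0.
Proof.
move=> s0 st sa_ sa ca; have t0 := le_trans s0 st.
apply: nrm_cvg0_sqr.
pose h n := 3 * (nrm (a_ n - a) ^+ 2 * (t + 1) + nrm a ^+ 2 * (s - (grid n s)%:R / n%:R) +
  nrm a ^+ 2 * (t - (grid n t)%:R / n%:R)).
apply: (squeeze_cvgr (f := cst 0) (h := h)).
- near=> n; rewrite -nrm_sqr sqr_ge0/=.
  have n1 : (1 <= n)%N by near: n; exact: nbhs_infty_ge.
  have n0 : 0 < n%:R :> R by rewrite ltr0n.
  have san : sq (a_ n) by near: n; exact: sa_.
  have /andP[gs1 gs2] := grid_bounds n1 s0; have /andP[gt1 gt2] := grid_bounds n1 t0.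
  have gst : (grid n s)%:R / n%:R <= (grid n t)%:R / n%:R :> R.
    by rewrite ler_wpM2r ?invr_ge0// ler_nat grid_le.
  have gs0 : 0 <= (grid n s)%:R / n%:R :> R by rewrite divr_ge0.
  have gt0 : 0 <= (grid n t)%:R / n%:R :> R by rewrite divr_ge0.
  have sd := sqintB measurableT san sa.
  have [s1 n1'] := sqint_tensor_itv sd gs0 gst.
  have [s2 n2] := sqint_tensor_itv sa gs0 gs2.
  have [s3 n3] := sqint_tensor_itv sa gt0 gt2.
  set u1 := tensor _ _ in s1 n1'; set u2 := tensor _ _ in s2 n2; set u3 := tensor _ _ in s3 n3.
  rewrite (@eq_nrm _ _ _ tm ts _ (u1 + u2 - u3)); last first.
    move=> x /[!inE] xts; change (ceil_process n (block (a_ n) (grid n s) (grid n t)) x -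
      tensor a `]s, t] x = u1 x + u2 x - u3 x).
    rewrite ceil_block// -addrA -(tensor_shift _ _ gs2 gt2 st gst) /u1 /tensor.
    change ((a_ n - a) x.1) with (a_ n x.1 - a x.1); ring.
  have s12 := sqintD mts s1 s2.
  have h1 := nrmB mts s12 s3; have h2 := nrmD mts s1 s2.
  have h3 : tnrm (u1 + u2 - u3) <= tnrm u1 + tnrm u2 + tnrm u3.
    by apply: le_trans h1 _; rewrite lerD2r.
  apply: le_trans (sqr_le_sum3 (nrm_ge0 tm ts _) h3) _.
  rewrite n1' n2 n3 /h; apply: ler_wpM2l; first exact: ler0n.
  rewrite !lerD2r; apply: ler_wpM2l; first exact: sqr_ge0.
  have t1 : (grid n t)%:R / n%:R <= t + 1 by apply: le_trans gt2 _; rewrite lerDl.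
  by apply: le_trans t1; rewrite gerBl.
- exact: cvg_cst.
- have c0 : (0 : R) = 3 * (0 ^+ 2 * (t + 1) + nrm a ^+ 2 * (s - s) + nrm a ^+ 2 * (t - t)).
    by ring.
  rewrite [X in _ --> X]c0; apply: cvgM; first exact: cvg_cst.
  apply: cvgD; first apply: cvgD.
  + by apply: cvgM; [rewrite expr2; under eq_fun do rewrite expr2; exact: cvgM|exact: cvg_cst].
  + apply: cvgM; first exact: cvg_cst.
    by apply: cvgB; [exact: cvg_cst|exact: cvg_grid].
  + apply: cvgM; first exact: cvg_cst.
    by apply: cvgB; [exact: cvg_cst|exact: cvg_grid].
Unshelve. all: by end_near. Qed.

Lemma cvg_clip_nrm X : sq X -> nrm ((fun w => clip n%:R (X w)) - X) @[n --> \oo] --> 0.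
Proof.
move=> sX; have mX : measurable_fun setT X by case: sX.
apply: (sqint_dominated measurableT _ mX (sqint_norm measurableT sX) _ _).2.
- by move=> n; apply: measurableT_comp => //; exact: measurable_clip.
- by apply: aeW => w _; exact: cvg_clip.
- by apply: aeW => w n _; exact: clip_le_id.
Qed.

(** The factor X is first truncated, since a_n only converges in L^2. *)
Lemma bounded_mul_cvg (a_ X_ : nat -> T -> R) a X (M : R) :
  (forall n, measurable_fun setT (a_ n)) -> (forall n w, `|a_ n w| <= M) ->
  measurable_fun setT a -> (forall w, `|a w| <= M) ->
  nrm (a_ n - a) @[n --> \oo] --> 0 ->
  (\forall n \near \oo, sq (X_ n)) -> sq X -> nrm (X_ n - X) @[n --> \oo] --> 0 ->
  nrm ((fun w => a_ n w * X_ n w) - (fun w => a w * X w)) @[n --> \oo] --> 0.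
Proof.
move=> ma_ aM_ ma aM ca sX_ sX cX.
have sa : sq a by apply: bm_sqint; split=> //; exists M.
have sa_ n : sq (a_ n) by apply: bm_sqint; split=> //; exists M.
have M0 : 0 <= M by apply: le_trans (normr_ge0 _) (aM (point : T)).
have mul (b Y : T -> R) (c : R) : measurable_fun setT b -> 0 <= c -> (forall w, `|b w| <= c) ->
    sq Y -> sq (fun w => b w * Y w) /\ nrm (fun w => b w * Y w) <= c * nrm Y.
  move=> mb c0 bc sY; have [mY _] := sY.
  rewrite -{1}(ger0_norm c0) -nrmZ//.
  apply: sqint_le => //; [exact: measurable_funM|exact: sqintZ|move=> w _].
  by rewrite !normrM (ger0_norm c0) ler_wpM2r.
apply/cvgrPdist_le => e e0.
have d0 : 0 < e / (6 * (M + 1)) by rewrite divr_gt0// mulr_gt0//; lra.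
have /cvgrPdist_le/(_ _ d0) hK := cvg_clip_nrm sX.
have [K HK] := filter_ex hK.
pose XK : T -> R := fun w => clip K%:R (X w).
have K0 : 0 <= K%:R :> R by [].
have [mX _] := sX.
have bXK : bounded_measurable XK by exact: clip_bm.
have sXK : sq XK by exact: bm_sqint.
have nXK : nrm (XK - X) <= e / (6 * (M + 1)).
  by move: HK; rewrite sub0r normrN ger0_norm ?nrm_ge0.
have e3 : 0 < e / (3 * (K%:R + 1)) by rewrite divr_gt0// mulr_gt0// ltr_wpDl.
have /cvgrPdist_le/(_ _ e3) ha := ca.
have /cvgrPdist_le/(_ _ d0) hX := cX.
near=> n.
have sXn : sq (X_ n) by near: n; exact: sX_.
have na : nrm (a_ n - a) <= e / (3 * (K%:R + 1)).
  have : `|0 - nrm (a_ n - a)| <= e / (3 * (K%:R + 1)) by near: n; exact: ha.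
  by rewrite sub0r normrN ger0_norm ?nrm_ge0.
have nX : nrm (X_ n - X) <= e / (6 * (M + 1)).
  have : `|0 - nrm (X_ n - X)| <= e / (6 * (M + 1)) by near: n; exact: hX.
  by rewrite sub0r normrN ger0_norm ?nrm_ge0.
rewrite sub0r normrN ger0_norm ?nrm_ge0//.
have sXX := sqintB measurableT sXn sX.
have sKX := sqintB measurableT sXK sX.
have saa := sqintB measurableT (sa_ n) sa.
have [s1 n1] := mul (a_ n) (X_ n - X) M (ma_ n) M0 (aM_ n) sXX.
have [s2 n2] := mul (a - a_ n) (XK - X) (M + M) (measurable_funB ma (ma_ n)) (addr_ge0 M0 M0)
  (fun w => le_trans (ler_normB _ _) (lerD (aM w) (aM_ n w))) sKX.
have [s3 n3] : sq (fun w => XK w * (a_ n - a) w) /\ nrm (fun w => XK w * (a_ n - a) w) <= K%:R * nrm (a_ n - a).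
  by apply: mul => //; [case: bXK|move=> w; exact: clip_le].
have -> : (fun w => a_ n w * X_ n w) - (fun w => a w * X w) =
    (fun w => a_ n w * (X_ n - X) w) + (fun w => (a - a_ n) w * (XK - X) w) +
    (fun w => XK w * (a_ n - a) w).
  apply/funext => w; change (a_ n w * X_ n w - a w * X w = a_ n w * (X_ n w - X w) +
    (a w - a_ n w) * (XK w - X w) + XK w * (a_ n w - a w)); ring.
apply: le_trans (nrmD measurableT (sqintD measurableT s1 s2) s3) _.
have h := nrmD measurableT s1 s2.
have b1 : M * nrm (X_ n - X) <= e / 6.
  apply: (@le_trans _ _ ((M + 1) * (e / (6 * (M + 1))))).
    by apply: ler_pM => //; [exact: nrm_ge0|rewrite lerDl].
  by rewrite le_eqVlt; apply/orP; left; apply/eqP; field; rewrite gt_eqF//; lra.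
have b2 : M * nrm (XK - X) <= e / 6.
  apply: (@le_trans _ _ ((M + 1) * (e / (6 * (M + 1))))).
    by apply: ler_pM => //; [exact: nrm_ge0|rewrite lerDl].
  by rewrite le_eqVlt; apply/orP; left; apply/eqP; field; rewrite gt_eqF//; lra.
have b3 : K%:R * nrm (a_ n - a) <= e / 3.
  apply: (@le_trans _ _ ((K%:R + 1) * (e / (3 * (K%:R + 1))))).
    by apply: ler_pM => //; [exact: nrm_ge0|rewrite lerDl].
  by rewrite le_eqVlt; apply/orP; left; apply/eqP; field; rewrite gt_eqF//; lra.
lra.
Unshelve. all: by end_near. Qed.

End blocks.

(** * Density of the trigonometric functionals of Brownian motion *)

Section brownian_density.
Context {d : measure_display} {T : measurableType d} {R : realType}.
Variables (P : probability T R) (B : R -> {RV P >-> R}).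
Hypothesis hF : d.-measurable = completion P (brownian_sigma_algebra B).
Local Notation bm := bounded_measurable.
Implicit Types (l : seq (R * R)) (Tm : set R).

(** A null set lies in a measurable null set, hence in a null set of the
    uncompleted sigma-field. *)
Lemma completion_negligible : P.-negligible `<=` @measurable d T.
Proof.
move=> N [A [mA A0 NA]]; move: (mA); rewrite hF => -[A1 [N1 [GA1 GN1 N10 AA1]]].
have sub : brownian_sigma_algebra B `<=` @measurable d T.
  apply: smallest_sub; first exact: sigma_algebra_measurable.
  by move=> E [s _ [C mC <-]]; exact: measurable_funP.
exists set0, (A1 `|` N1); split.
- exact: (@measurable0 _ (g_sigma_algebraType (\bigcup_(s in `[0, +oo[) g_sigma_algebra_preimage (B s)))).
- exact: (@measurableU _ (g_sigma_algebraType (\bigcup_(s in `[0, +oo[) g_sigma_algebra_preimage (B s)))).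
- apply/eqP; rewrite eq_le measure_ge0 andbT.
  apply: (@le_trans _ _ (P (A `|` N1))).
    apply: le_measure; rewrite ?inE; do ?apply: measurableU => //; try exact: sub.
    move=> w [wA1|]; last by right.
    have [wA|wA] := pselect (A w); first by left.
    by right; apply: AA1; right; split.
  by have -> : P (A `|` N1) = 0%E by rewrite measureU0//; exact: sub.
- move=> w [[wN _]|[]//]; have wA := NA _ wN.
  have [wA1|wA1] := pselect (A1 w); first by left.
  by right; apply: AA1; left; split.
Qed.

(** Trigonometric functionals of B at times in Tm. They are bounded and, up to linear
    combinations, closed under products, and their generated sigma-field is full. *)
Definition cos_class Tm (k : T -> R) : Prop :=
  exists phi l, (forall p, p \in l -> Tm p.2) /\ k = fun w => cos (phi + theta B l w).

Lemma cos_class_bm Tm k : cos_class Tm k -> bm k.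
Proof.
move=> [phi [l [_ ->]]]; apply: bm_cos; apply: measurable_funD; first exact: measurable_cst.
exact: measurable_theta.
Qed.

Lemma cos_class1 Tm : cos_class Tm (fun=> 1).
Proof.
exists 0, [::]; split=> //; apply/funext => w.
by rewrite /theta big_nil addr0 cos0.
Qed.

Lemma theta_cat l l' w : theta B (l ++ l') w = theta B l w + theta B l' w.
Proof. by rewrite /theta big_cat. Qed.

Lemma theta_scale (c : R) l w :
  theta B [seq (c * p.1, p.2) | p <- l] w = c * theta B l w.
Proof. by rewrite /theta big_map mulr_sumr; apply: eq_bigr => p _; rewrite mulrA. Qed.

Lemma cos_classM Tm k k' : cos_class Tm k -> cos_class Tm k' -> exists a b k1 k2,
  [/\ cos_class Tm k1, cos_class Tm k2 & forall w, k w * k' w = a * k1 w + b * k2 w].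
Proof.
move=> [phi [l [lT ->]]] [psi [l' [lT' ->]]].
exists 2^-1, 2^-1, (fun w => cos (phi + psi + theta B (l ++ l') w)),
  (fun w => cos (phi - psi + theta B (l ++ [seq (-1 * p.1, p.2) | p <- l']) w)); split.
- exists (phi + psi), (l ++ l'); split=> // p; rewrite mem_cat => /orP[]; [exact: lT|exact: lT'].
- exists (phi - psi), (l ++ [seq (-1 * p.1, p.2) | p <- l']); split=> // p.
  by rewrite mem_cat => /orP[|/mapP[q ql ->]]; [exact: lT|exact: (lT' _ ql)].
- move=> w; rewrite !theta_cat theta_scale.
  rewrite (_ : phi + psi + _ = (phi + theta B l w) + (psi + theta B l' w)); last by ring.
  rewrite (_ : phi - psi + _ = (phi + theta B l w) - (psi + theta B l' w)); last by ring.
  move: (phi + theta B l w) (psi + theta B l' w) => x y.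
  by rewrite cosD cosB; field.
Qed.

Definition times_sigma_algebra Tm : set (set T) :=
  <<s (\bigcup_(r in Tm) g_sigma_algebra_preimage (B r)) `|` P.-negligible >>.

Definition cos_generators Tm : set (set T) :=
  [set E | (exists k A, [/\ cos_class Tm k, measurable A & E = k @^-1` A]) \/
           (measurable E /\ P E = 0%E)].

Lemma cvg_msin (x : R) : m.+1%:R * sin (x / m.+1%:R) @[m --> \oo] --> x.
Proof.
apply/cvgrPdist_le => e e0.
have c0 : x ^+ 2 * m.+1%:R^-1 @[m --> \oo] --> (0 : R).
  rewrite -[X in _ --> X](mulr0 (x ^+ 2)); apply: cvgM; first exact: cvg_cst.
  exact: cvg_harmonic.
move/cvgrPdist_le : c0 => /(_ _ e0); apply: filterS => m.
have x2 : 0 <= x ^+ 2 / m.+1%:R by rewrite divr_ge0 ?sqr_ge0.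
rewrite sub0r normrN (ger0_norm x2); apply: le_trans.
have m0 : 0 < m.+1%:R :> R by [].
have [c [cx ->]] := sin_mvt (x / m.+1%:R).
rewrite mulrA (mulrC m.+1%:R) divfK ?gt_eqF// -[X in X - _]mulr1 -mulrBr normrM distrC.
have := cos_lip c 0; rewrite cos0 subr0 => h.
have : `|c| <= `|x| / m.+1%:R by rewrite (le_trans cx)// normrM normfV (ger0_norm (ltW m0)).
move=> h2; rewrite -(real_normK (num_real x)) expr2 -mulrA ler_wpM2l//; exact: le_trans h h2.
Qed.

(** B_r is recovered as the limit of m sin(B_r / m). *)
Lemma times_sigma_algebra_cos Tm : times_sigma_algebra Tm `<=` <<s cos_generators Tm >>.
Proof.
apply: smallest_sub; first exact: smallest_sigma_algebra.
move=> E [[r Tr [C mC <-]]|]; last first.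
  move=> nE; apply: sub_sigma_algebra; right; split; first exact: completion_negligible.
  case: nE => A [mA A0 EA]; apply/eqP; rewrite eq_le measure_ge0 andbT -A0.
  apply: le_measure; rewrite ?inE//; apply: completion_negligible.
  by exists A; split.
suff : @measurable_fun _ _ (g_sigma_algebraType (cos_generators Tm)) R setT (B r).
  by move=> /(_ measurableT _ mC).
refine (@measurable_fun_cvg _ (g_sigma_algebraType (cos_generators Tm)) R setT
  (fun m w => m.+1%:R * sin (B r w / m.+1%:R)) _ _ _).
  move=> m; apply: measurable_funM; first exact: measurable_cst.
  move=> _ A mA; apply: sub_sigma_algebra; left.
  exists (fun w => cos (- (pi / 2) + theta B [:: (m.+1%:R^-1, r)] w)), A; split=> //.
    by exists (- (pi / 2)), [:: (m.+1%:R^-1, r)]; split=> // p; rewrite inE => /eqP ->.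
  rewrite setTI (_ : (fun w => cos _) = (fun w => sin (B r w / m.+1%:R)))//.
  by apply/funext => w; rewrite /theta big_seq1 /= addrC cosBpihalf mulrC.
by move=> w _; exact: cvg_msin.
Qed.

(** Any property that is linear and stable under bounded limits passes from the
    trigonometric functionals to all bounded functionals. It is used with Tm = [0, s]
    for the filtration and with Tm = [0, oo[ for the whole sigma-field. *)
Lemma brownian_density Tm (V : (T -> R) -> Prop) (f : T -> R) :
  (forall k, cos_class Tm k -> V k) ->
  (forall f g, V f -> V g -> V (f + g)) ->
  (forall (c : R) f, V f -> V (fun x => c * f x)) ->
  (forall (f_ : nat -> T -> R) f (M : R),
    (forall n, V (f_ n)) -> (forall n, measurable_fun setT (f_ n)) ->
    (forall n x, `|f_ n x| <= M) -> bm f ->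
    {ae P, forall x, f_ n x @[n --> \oo] --> f x} -> V f) ->
  bm f -> measurable_wrt setT (times_sigma_algebra Tm) f -> V f.
Proof.
move=> KV VD VZ Vl bf mf.
apply: (@functional_monotone_class _ _ R P (cos_class Tm) V _ _ _ KV VD VZ _ (cos_generators Tm)) => //.
- exact: cos_class_bm.
- exact: cos_class1.
- exact: cos_classM.
- by move=> _ C mC; apply: times_sigma_algebra_cos; apply: mf; exists C.
Qed.

(** Measurable sets differ by null sets from sets of the sigma-field generated by
    B, and null sets are among the generators. *)
Lemma measurable_brownian_times (f : T -> R) : measurable_fun setT f ->
  measurable_wrt setT (times_sigma_algebra `[0, +oo[%classic) f.
Proof.
move=> mf _ [C mC <-]; have := mf measurableT C mC; rewrite {1}hF => -[A [N [GA GN N0 AN]]].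
set E := setT `&` _ in AN *.
have nN : P.-negligible N.
  exists N; split=> //.
  suff sub : brownian_sigma_algebra B `<=` @measurable d T by exact: sub.
  apply: smallest_sub; first exact: sigma_algebra_measurable.
  by move=> F [s _ [D mD <-]]; exact: measurable_funP.
pose G := (\bigcup_(r in `[0, +oo[) g_sigma_algebra_preimage (B r)) `|` P.-negligible.
have nul F : F `<=` N -> times_sigma_algebra `[0, +oo[%classic F.
  move=> FN; apply: sub_sigma_algebra; right; exact: negligibleS nN.
have -> : E = (A `\` (A `\` E)) `|` (E `\` A).
  apply/seteqP; split=> w.
    by move=> wE; have [wA|wA] := pselect (A w); [left; split=> // -[]|right].
  by move=> [[wA /not_andP[]//]|[]//] /contrapT.
apply: (@measurableU _ (g_sigma_algebraType G)).
  apply: (@measurableD _ (g_sigma_algebraType G)).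
    apply: sub_smallest2r GA; first exact: smallest_sigma_algebra.
    by move=> F; left.
  by apply: nul => w [wA wE]; apply: AN; right; split.
by apply: nul => w [wA wE]; apply: AN; left; split.
Qed.

End brownian_density.

(** * Limits of discrete integral pairs *)

Section limit_pairs.
Context {d : measure_display} {T : measurableType d} {R : realType}.
Variables (P : probability T R) (B : R -> {RV P >-> R}) (xi : {RV P >-> R}).
Variable xi_ : nat -> nat -> {RV P >-> R}.
Hypothesis hW : walk_approximation B xi xi_.
Local Notation tm := (time_measure P).
Local Notation ts := (@time_space d T R).
Local Notation mts := (@measurable_time_space d T R).
Local Notation sq := (sqint P setT).
Local Notation tsq := (sqint tm ts).
Local Notation tnrm := (L2norm tm ts).
Local Notation tip := (L2inner tm ts).
Local Notation ip := (L2inner P setT).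
Local Notation nrm := (L2norm P setT).
Local Notation mT := measurableT.
Implicit Types (H : T * measurableTypeR R -> R) (G X : T -> R) (l : seq (R * R)) (s t : R).

Lemma near_small {mu : nat -> R} (e : R) : 0 < e -> (forall n, 0 <= mu n) ->
  mu n @[n --> \oo] --> 0 -> \forall n \near \oo, mu n <= e.
Proof.
move=> e0 mu0 /cvgrPdist_le/(_ _ e0); apply: filterS => n.
by rewrite sub0r normrN ger0_norm.
Qed.

(** The approximants may depend on the error, which makes closedness immediate;
    a single convergent sequence would need a diagonal argument. *)
Definition limit_pair H G : Prop :=
  [/\ tsq H, sq G & forall e : R, 0 < e -> exists (Z_ : nat -> nat -> T -> R) (X_ : nat -> T -> R), \forall n \near \oo,
    [/\ walk_pair n (xi_ n) (Z_ n) (X_ n), tnrm (ceil_process n (Z_ n) - H) <= e &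
        nrm (X_ n - G) <= e]].

Lemma limit_pair_seq (Z_ : nat -> nat -> T -> R) (X_ : nat -> T -> R) H G : tsq H -> sq G ->
  (\forall n \near \oo, walk_pair n (xi_ n) (Z_ n) (X_ n)) ->
  tnrm (ceil_process n (Z_ n) - H) @[n --> \oo] --> 0 ->
  nrm (X_ n - G) @[n --> \oo] --> 0 -> limit_pair H G.
Proof.
move=> sH sG pZ cZ cX; split=> // e e0; exists Z_, X_.
have h1 := near_small e0 (fun n => nrm_ge0 _ _ _) cZ.
have h2 := near_small e0 (fun n => nrm_ge0 _ _ _) cX.
by near=> n; split; near: n.
Unshelve. all: by end_near. Qed.

Lemma walk_pair_sq n Z X : (1 <= n)%N -> walk_pair n (xi_ n) Z X ->
  [/\ tsq (ceil_process n Z), sq X & tnrm (ceil_process n Z) = nrm X].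
Proof.
move=> n1 pZ; have [s1 s2] := walk_pair_ceil n1 (walk_standard hW n1) pZ.
by split=> //; case: pZ.
Qed.

Lemma limit_pairD H G H' G' : limit_pair H G -> limit_pair H' G' ->
  limit_pair (H + H') (G + G').
Proof.
move=> [sH sG a] [sH' sG' a']; split; [exact: (sqintD mts)|exact: sqintD|move=> e e0].
have e2 : 0 < e / 2 by lra.
have [Z_ [X_ h]] := a _ e2; have [Y_ [W_ h']] := a' _ e2.
exists (fun n i => Z_ n i + Y_ n i), (fun n => X_ n + W_ n); near=> n.
have n1 : (1 <= n)%N by near: n; exact: nbhs_infty_ge.
have [p1 p2 p3] : [/\ walk_pair n (xi_ n) (Z_ n) (X_ n),
  tnrm (ceil_process n (Z_ n) - H) <= e / 2 & nrm (X_ n - G) <= e / 2] by near: n; exact: h.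
have [q1 q2 q3] : [/\ walk_pair n (xi_ n) (Y_ n) (W_ n),
  tnrm (ceil_process n (Y_ n) - H') <= e / 2 & nrm (W_ n - G') <= e / 2] by near: n; exact: h'.
have [u1 u2 _] := walk_pair_sq n1 p1; have [v1 v2 _] := walk_pair_sq n1 q1.
split; first exact: (walk_pairD (walk_standard hW n1)).
- rewrite (_ : ceil_process n _ = ceil_process n (Z_ n) + ceil_process n (Y_ n))//.
  rewrite opprD addrACA.
  by have := nrmD mts (sqintB mts u1 sH) (sqintB mts v1 sH'); lra.
- rewrite opprD addrACA.
  by have := nrmD mT (sqintB mT u2 sG) (sqintB mT v2 sG'); lra.
Unshelve. all: by end_near. Qed.

Lemma limit_pairZ (c : R) H G : limit_pair H G ->
  limit_pair (fun x => c * H x) (fun w => c * G w).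
Proof.
move=> [sH sG a]; split; [exact: (sqintZ mts)|exact: sqintZ|move=> e e0].
have c1 : 0 < `|c| + 1 by rewrite ltr_wpDl.
have e2 : 0 < e / (`|c| + 1) by rewrite divr_gt0.
have [Z_ [X_ h]] := a _ e2.
exists (fun n i w => c * Z_ n i w), (fun n w => c * X_ n w); near=> n.
have n1 : (1 <= n)%N by near: n; exact: nbhs_infty_ge.
have [p1 p2 p3] : [/\ walk_pair n (xi_ n) (Z_ n) (X_ n),
  tnrm (ceil_process n (Z_ n) - H) <= e / (`|c| + 1) & nrm (X_ n - G) <= e / (`|c| + 1)] by near: n; exact: h.
have [u1 u2 _] := walk_pair_sq n1 p1.
have le_e (y : R) : 0 <= y -> y <= e / (`|c| + 1) -> `|c| * y <= e.
  move=> y0; rewrite ler_pdivlMr// => ye; have := normr_ge0 c; nra.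
split; first exact: (walk_pairZ (walk_standard hW n1)).
- rewrite (_ : _ - _ = fun x => c * (ceil_process n (Z_ n) - H) x).
    by rewrite (nrmZ mts _ (sqintB mts u1 sH)) le_e// nrm_ge0.
  by apply/funext => x; rewrite [RHS]mulrBr.
- rewrite (_ : _ - _ = fun x => c * (X_ n - G) x).
    by rewrite (nrmZ mT _ (sqintB mT u2 sG)) le_e// nrm_ge0.
  by apply/funext => x; rewrite [RHS]mulrBr.
Unshelve. all: by end_near. Qed.

Lemma limit_pair0 : limit_pair 0 0.
Proof.
apply: (@limit_pair_seq (fun _ _ => cst 0) (fun _ => walk_integral 0 (xi_ 0) (fun=> cst 0) 0)).
- exact: (@sqint0 _ _ _ tm ts mts).
- exact: sqint0.
- near=> n; have n1 : (1 <= n)%N by near: n; exact: nbhs_infty_ge.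
  have -> : walk_integral 0 (xi_ 0) (fun=> cst 0) 0 = walk_integral n (xi_ n) (fun=> cst 0) 0.
    by rewrite !walk_integral0.
  apply: (@walk_pair_finite _ _ _ P n (xi_ n) (walk_standard hW n1) (fun=> cst 0) 0) => // i i1.
  by split; [exact: sqint0|exact: adapted_cst].
- rewrite (_ : (fun n => _) = cst 0); first exact: cvg_cst.
  by apply/funext => n; rewrite subr0; exact: (@nrm0 _ _ _ tm ts mts).
- rewrite (_ : (fun n => _) = cst 0); first exact: cvg_cst.
  by apply/funext => n; rewrite walk_integral0 subrr nrm0.
Unshelve. all: by end_near. Qed.

Lemma limit_pair_sum (J : eqType) (r : seq J) (H_ : J -> T * measurableTypeR R -> R)
    (G_ : J -> T -> R) : (forall i, i \in r -> limit_pair (H_ i) (G_ i)) ->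
  limit_pair (\sum_(i <- r) H_ i) (\sum_(i <- r) G_ i).
Proof.
elim: r => [|i r IH] h; first by rewrite !big_nil; exact: limit_pair0.
rewrite !big_cons; apply: limit_pairD; first by apply: h; exact: mem_head.
by apply: IH => j jr; apply: h; rewrite inE jr orbT.
Qed.

Lemma limit_pair_closed H G : tsq H -> sq G ->
  (forall e : R, 0 < e -> exists H' G', [/\ limit_pair H' G', tnrm (H' - H) <= e &
    nrm (G' - G) <= e]) -> limit_pair H G.
Proof.
move=> sH sG a; split=> // e e0; have e2 : 0 < e / 2 by lra.
have [H' [G' [[sH' sG' b] h1 h2]]] := a _ e2.
have [Z_ [X_ h]] := b _ e2; exists Z_, X_; near=> n.
have n1 : (1 <= n)%N by near: n; exact: nbhs_infty_ge.
have [p1 p2 p3] : [/\ walk_pair n (xi_ n) (Z_ n) (X_ n),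
  tnrm (ceil_process n (Z_ n) - H') <= e / 2 & nrm (X_ n - G') <= e / 2] by near: n; exact: h.
have [u1 u2 _] := walk_pair_sq n1 p1; split=> //.
- by have := nrm_dist_trans mts u1 sH' sH; lra.
- by have := nrm_dist_trans mT u2 sG' sG; lra.
Unshelve. all: by end_near. Qed.

(** The isometry holds for the approximants. *)
Lemma limit_pair_nrm H G : limit_pair H G -> tnrm H = nrm G.
Proof.
move=> [sH sG a]; apply/eqP; rewrite -subr_eq0 -normr_le0; apply/ler_addgt0Pr => e e0.
have e2 : 0 < e / 2 by lra.
have [Z_ [X_ h]] := a _ e2.
have [n [[p1 p2 p3] n1]] := filter_ex (filterI h (nbhs_infty_ge 1)).
have [u1 u2 u3] := walk_pair_sq n1 p1.
have h1 := nrm_lip mts u1 sH; have h2 := nrm_lip mT u2 sG.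
rewrite add0r; move: h1 h2; rewrite u3 !ler_norml => /andP[h1 h2] /andP[h3 h4].
by apply/andP; split; lra.
Qed.

Lemma limit_pair_ip H G H' G' : limit_pair H G -> limit_pair H' G' -> tip H H' = ip G G'.
Proof.
move=> p p'; have [sH sG _] := p; have [sH' sG' _] := p'.
have := congr1 (fun x => x ^+ 2) (limit_pair_nrm (limit_pairD p p')).
have := congr1 (fun x => x ^+ 2) (limit_pair_nrm p).
have := congr1 (fun x => x ^+ 2) (limit_pair_nrm p').
rewrite !nrm_sqr (ipDl mts sH sH' (sqintD mts sH sH')) !(ipDr mts sH sH')//.
rewrite (ipDl mT sG sG' (sqintD mT sG sG')) !(ipDr mT sG sG')//.
rewrite (ipC _ _ H' H) (ipC _ _ G' G); lra.
Qed.

Lemma limit_pair_mean H G : limit_pair H G -> (\int[P]_w G w)%R = 0.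
Proof.
move=> [sH sG a]; apply/eqP; rewrite -normr_le0; apply/ler_addgt0Pr => e e0.
have [Z_ [X_ h]] := a _ e0.
have [n [[p1 p2 p3] n1]] := filter_ex (filterI h (nbhs_infty_ge 1)).
have [u1 u2 u3] := walk_pair_sq n1 p1.
have := walk_pair_mean (walk_standard hW n1) p1.
have s1 : sq (fun=> 1) by exact: sqint_cst.
rewrite -!ip_cst1 => m0; rewrite add0r.
rewrite -normrN -(add0r (- _)) -m0 -(ipBl mT u2 sG s1).
apply: le_trans (ip_le mT (sqintB mT u2 sG) s1) _.
by rewrite nrm_cst normr1 mulr1.
Qed.

(** The polarised isometry against the approximants of (H, G), with an error
    that is uniform because the X_n are bounded. *)
Lemma limit_pair_transfer (Z_ : nat -> nat -> T -> R) (X_ : nat -> T -> R) (C : R) H G :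
  (forall n, (1 <= n)%N -> walk_pair n (xi_ n) (Z_ n) (X_ n)) ->
  (forall n, (1 <= n)%N -> nrm (X_ n) <= C) -> limit_pair H G ->
  ip (X_ n) G - tip (ceil_process n (Z_ n)) H @[n --> \oo] --> 0.
Proof.
move=> pX XC [sH sG a].
have C0 : 0 <= C by apply: le_trans (nrm_ge0 _ _ _) (XC 1%N isT).
apply/cvgrPdist_le => e e0.
have e2 : 0 < e / (2 * (C + 1)) by rewrite divr_gt0//; lra.
have [Y_ [W_ h]] := a _ e2; near=> n.
have n1 : (1 <= n)%N by near: n; exact: nbhs_infty_ge.
have [p1 p2 p3] : [/\ walk_pair n (xi_ n) (Y_ n) (W_ n),
  tnrm (ceil_process n (Y_ n) - H) <= e / (2 * (C + 1)) &
  nrm (W_ n - G) <= e / (2 * (C + 1))] by near: n; exact: h.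
have [u1 u2 u3] := walk_pair_sq n1 p1; have [v1 v2 v3] := walk_pair_sq n1 (pX n n1).
have E := walk_pair_ip n1 (walk_standard hW n1) (pX n n1) p1.
have h1 := ip_le mT v2 (sqintB mT u2 sG); have h2 := ip_le mts v1 (sqintB mts u1 sH).
have b (y : R) : 0 <= y -> y <= e / (2 * (C + 1)) -> nrm (X_ n) * y <= e / 2.
  move=> y0 ye; apply: (@le_trans _ _ ((C + 1) * (e / (2 * (C + 1))))).
    apply: ler_pM => //; first exact: nrm_ge0.
    by apply: (le_trans (XC n n1)); rewrite lerDl.
  by rewrite le_eqVlt; apply/orP; left; apply/eqP; field; rewrite gt_eqF//; lra.
have b1 := b _ (nrm_ge0 _ _ _) p3; have b2 := b _ (nrm_ge0 _ _ _) p2.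
rewrite v3 in h2; move: h1 h2.
rewrite (ipBr mT u2 sG v2) (ipBr mts u1 sH v1) E => h1 h2.
have := le_trans h1 b1; have := le_trans h2 b2; rewrite !ler_norml => /andP[? ?] /andP[? ?].
by apply/andP; split; lra.
Unshelve. all: by end_near. Qed.

End limit_pairs.

(** * The Ito integral as a limit of discrete integrals *)

Section ito_pairs.
Context {d : measure_display} {T : measurableType d} {R : realType}.
Variables (P : probability T R) (B : R -> {RV P >-> R}) (xi : {RV P >-> R}).
Variable xi_ : nat -> nat -> {RV P >-> R}.
Hypothesis hW : walk_approximation B xi xi_.
Hypothesis hF : d.-measurable = completion P (brownian_sigma_algebra B).
Local Notation tm := (time_measure P).
Local Notation ts := (@time_space d T R).
Local Notation mts := (@measurable_time_space d T R).
Local Notation sq := (sqint P setT).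
Local Notation tnrm := (L2norm tm ts).
Local Notation nrm := (L2norm P setT).
Local Notation mT := measurableT.
Local Notation limit_pair := (limit_pair xi_).
Implicit Types (l : seq (R * R)) (s t : R).

Lemma random_walk_integral n t :
  random_walk n (xi_ n) t = walk_integral n (xi_ n) (fun=> cst 1) (grid n t).
Proof.
apply/funext => w; rewrite /random_walk /walk_integral mulr_sumr.
by apply: eq_bigr => i _; rewrite /cst; ring.
Qed.

(** The integral of a block is the coefficient times the increment of the walk. *)
Lemma block_pair n a k m : (1 <= n)%N -> (k <= m)%N -> adapted (xi_ n) k a -> sq a ->
  walk_pair n (xi_ n) (block a k m) (fun w => a w *
    (walk_integral n (xi_ n) (fun=> cst 1) m - walk_integral n (xi_ n) (fun=> cst 1) k) w).
Proof.
move=> n1 km aa sa; rewrite walk_integral_cut//.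
rewrite (_ : (fun w => _) = walk_integral n (xi_ n) (block a k m) m).
  apply: (@walk_pair_finite _ _ _ P n (xi_ n) (walk_standard hW n1) (block a k m) m) => //.
    move=> i i1; rewrite /block; case: ifP => [/andP[ki im]|_].
      by split=> //; apply: adapted_le aa; rewrite -ltnS prednK.
    by split; [exact: sqint0|exact: adapted_cst].
  by move=> i mi; rewrite /block (leqNgt i m) mi andbF.
apply/funext => w; rewrite /walk_integral mulr_sumr big_nat_cond [RHS]big_nat_cond.
apply: eq_bigr => i /andP[/andP[i1 im] _]; rewrite ltnS in im; rewrite /block im andbT.
case: ifP => _; first by rewrite mulrA mulr1.
by rewrite [(0 : T -> R) w]/(0) !mul0r mulr0.
Qed.

Lemma walk_theta_adapted n l s : (1 <= n)%N -> times_within s l ->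
  adapted (xi_ n) (grid n s) (walk_theta xi_ n l).
Proof.
move=> n1 ls; have [i1 i2 i3 i4] := walk_standard hW n1.
rewrite -(walk_theta_integral _ n1 ls).
apply: (walk_integral_adapted n i1 i2 i4 _ _).1 => i i_1.
by split; [exact: sqint_cst|exact: adapted_cst].
Qed.

Lemma cvg_cos_theta phi l s : times_within s l ->
  nrm ((fun w => cos (phi + walk_theta xi_ n l w)) - (fun w => cos (phi + theta B l w)))
    @[n --> \oo] --> 0.
Proof.
move=> ls.
have H : 2 * pdist P (walk_theta xi_ n l) (theta B l) @[n --> \oo] --> (0 : R).
  rewrite -[X in _ --> X](mulr0 (2 : R)); apply: cvgM; first exact: cvg_cst.
  by apply: (cvg_pdist_theta hW) => p /(times_withinP ls)[].
apply: (squeeze_cvgr (f := cst 0) (h := fun n => 2 * pdist P (walk_theta xi_ n l) (theta B l))) => //.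
  apply: nearW => n; rewrite nrm_ge0/=.
  apply: (@pdist_lipschitz _ _ _ P (fun x => cos (phi + x)) 2) => //.
  - by apply: measurableT_comp; [exact: measurable_cosR|exact: measurable_funD].
  - by move=> x y; apply: le_trans (cos_clip_lip _ _) _; rewrite opprD addrACA subrr add0r.
  - exact: measurable_walk_theta.
  - exact: measurable_theta.
exact: cvg_cst.
Qed.

(** Cosines are the coefficients of choice: the discrete cosines are bounded, so
    their product with the increment of the walk still converges in L^2. *)
Lemma cos_limit_pair phi l s t : 0 <= s -> s <= t -> times_within s l ->
  limit_pair (tensor (fun w => cos (phi + theta B l w)) `]s, t])
    (fun w => cos (phi + theta B l w) * (B t w - B s w)).
Proof.
move=> s0 st ls; have t0 := le_trans s0 st.
pose a : T -> R := fun w => cos (phi + theta B l w).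
pose a_ n : T -> R := fun w => cos (phi + walk_theta xi_ n l w).
have ba : bounded_measurable a.
  by apply: bm_cos; apply: measurable_funD => //; exact: measurable_theta.
have ba_ n : bounded_measurable (a_ n).
  by apply: bm_cos; apply: measurable_funD => //; exact: measurable_walk_theta.
have sa := bm_sqint P ba.
have [st' ct] := cvg_random_walk hW t0; have [ss' cs] := cvg_random_walk hW s0.
have a1 w : `|a w| <= 1 by exact: norm_cos_le1.
pose D n := random_walk n (xi_ n) t - random_walk n (xi_ n) s.
have srw r n : (1 <= n)%N -> sq (random_walk n (xi_ n) r).
  move=> n1; have [i1 i2 i3 i4] := walk_standard hW n1.
  rewrite random_walk_integral; apply: (walk_integral_adapted n i1 i2 i4 _ _).2 => i i_1.
  by split; [exact: sqint_cst|exact: adapted_cst].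
have sD n : (1 <= n)%N -> sq (D n) by move=> n1; apply: sqintB => //; exact: srw.
have sB : sq (fun w => B t w - B s w) by exact: (@sqintB _ _ _ P setT mT (B t) (B s)).
have cD : nrm (D n - (fun w => B t w - B s w)) @[n --> \oo] --> 0.
  apply: (squeeze_cvgr (f := cst 0) (h := fun n => nrm (random_walk n (xi_ n) t - B t) +
    nrm (random_walk n (xi_ n) s - B s))).
  - near=> n; rewrite nrm_ge0/=.
    have n1 : (1 <= n)%N by near: n; exact: nbhs_infty_ge.
    rewrite (_ : D n - _ = (random_walk n (xi_ n) t - B t) - (random_walk n (xi_ n) s - B s)).
      by apply: nrmB => //; apply: sqintB => //; exact: srw.
    apply/funext => w; change (random_walk n (xi_ n) t w - random_walk n (xi_ n) s w -
      (B t w - B s w) = (random_walk n (xi_ n) t w - B t w) - (random_walk n (xi_ n) s w - B s w)).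
    ring.
  - exact: cvg_cst.
  - by rewrite -[X in _ --> X](addr0 (0 : R)); exact: cvgD.
have ca : nrm (a_ n - a) @[n --> \oo] --> 0 by exact: cvg_cos_theta ls.
apply: (@limit_pair_seq _ _ _ P xi_ (fun n => block (a_ n) (grid n s) (grid n t))
  (fun n w => a_ n w * D n w)).
- exact: (sqint_tensor_itv sa s0 st).1.
- apply: (sqint_le mT _ sB _).1.
    by apply: measurable_funM; [case: ba|case: sB].
  by move=> w _; rewrite normrM ler_piMl//; exact: a1.
- near=> n; have n1 : (1 <= n)%N by near: n; exact: nbhs_infty_ge.
  rewrite /D !random_walk_integral; apply: block_pair => //; first exact: grid_le.
    apply: (@adapted_comp _ _ _ P (xi_ n) _ (fun x => cos (phi + x))).
      by apply: measurableT_comp; [exact: measurable_cosR|exact: measurable_funD].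
    exact: walk_theta_adapted.
  exact: (bm_sqint P (ba_ n)).
- by apply: cvg_ceil_block => //; apply: nearW => n; exact: (bm_sqint P (ba_ n)).
- apply: (@bounded_mul_cvg _ _ _ P _ _ _ _ 1) => //.
  + by move=> n; case: (ba_ n).
  + by move=> n w; exact: norm_cos_le1.
  + by case: ba.
  + by near=> n; apply: sD; near: n; exact: nbhs_infty_ge.
Unshelve. all: by end_near. Qed.

Lemma tensorD (a b : T -> R) (I : set R) : tensor (a + b) I = tensor a I + tensor b I.
Proof. by apply/funext => x; rewrite /tensor [LHS]mulrDl. Qed.

Lemma tensorZ (c : R) (a : T -> R) (I : set R) :
  tensor (fun w => c * a w) I = (fun x => c * tensor a I x).
Proof. by apply/funext => x; rewrite /tensor mulrA. Qed.

Lemma tensorB (a b : T -> R) (I : set R) : tensor (a - b) I = tensor a I - tensor b I.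
Proof. by apply/funext => x; rewrite /tensor [LHS]mulrBl. Qed.

(** Monotone class from [cos_limit_pair] over the augmented sigma-field at time s. *)
Lemma bounded_limit_pair a s t : 0 <= s -> s <= t -> bounded_measurable a ->
  measurable_wrt setT (augmented_filtration B s) a ->
  limit_pair (tensor a `]s, t]) (fun w => a w * (B t w - B s w)).
Proof.
move=> s0 st ba ma; have t0 := le_trans s0 st.
have [st' _] := cvg_random_walk hW t0; have [ss' _] := cvg_random_walk hW s0.
have sB : sq (fun w => B t w - B s w) by exact: (@sqintB _ _ _ P setT mT (B t) (B s)).
apply: (@brownian_density _ _ _ P B hF `[0, s]%classic
  (fun a => limit_pair (tensor a `]s, t]) (fun w => a w * (B t w - B s w)))) => //.
- move=> _ [phi [l [lT ->]]]; apply: cos_limit_pair => //.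
  by apply/allP => p /lT /=; rewrite in_itv.
- move=> f g pf pg; rewrite tensorD.
  rewrite (_ : (fun w => _) = (fun w => f w * (B t w - B s w)) + (fun w => g w * (B t w - B s w))).
    exact: (limit_pairD hW).
  by apply/funext => w; rewrite [LHS]mulrDl.
- move=> c f pf; rewrite tensorZ.
  rewrite (_ : (fun w => _) = (fun w => c * (f w * (B t w - B s w)))).
    exact: (limit_pairZ hW).
  by apply/funext => w; rewrite mulrA.
- move=> f_ f M pf mf_ fM bf cf.
  have [mf [N fN]] := bf.
  have sf := bm_sqint P bf.
  have sf_ n : sq (f_ n) by apply: bm_sqint; split=> //; exists M.
  have M0 : 0 <= M by apply: le_trans (normr_ge0 _) (fM 0%N (point : T)).
  have c1 := bounded_cvg_nrm mf_ fM mf cf.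
  have c2 : nrm ((fun w => f_ n w * (B t w - B s w)) - (fun w => f w * (B t w - B s w)))
      @[n --> \oo] --> 0.
    apply: (@bounded_mul_cvg _ _ _ P f_ (fun _ w => B t w - B s w) f _ (M + N)) => //.
    + by move=> n w; rewrite (le_trans (fM n w))// lerDl (le_trans (normr_ge0 _) (fN w)).
    + by move=> w; rewrite (le_trans (fN w))// lerDr.
    + exact: nearW.
    + rewrite (_ : (fun n => _) = cst 0); first exact: cvg_cst.
      by apply/funext => n; rewrite subrr nrm0.
  apply: (limit_pair_closed hW) => //.
  + exact: (sqint_tensor_itv sf s0 st).1.
  + have N0 : 0 <= N by apply: le_trans (normr_ge0 _) (fN (point : T)).
    apply: (sqint_le mT _ (sqintZ mT N sB) _).1.
      by apply: measurable_funM => //; case: sB.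
    by move=> w _; rewrite !normrM ler_wpM2r// (ger0_norm N0).
  + move=> e e0.
    have c1' : nrm (f_ n - f) ^+ 2 * (t - s) @[n --> \oo] --> (0 : R).
      have z : (0 : R) = 0 * 0 * (t - s) by rewrite !mul0r.
      rewrite [X in _ --> X]z.
      by apply: cvgM; [under eq_fun do rewrite expr2; exact: cvgM|exact: cvg_cst].
    have e2 : 0 < e ^+ 2 by rewrite exprn_gt0.
    have ts0 : 0 <= t - s by rewrite subr_ge0.
    have p0 n : 0 <= nrm (f_ n - f) ^+ 2 * (t - s) by rewrite mulr_ge0 ?sqr_ge0.
    have h1 := near_small e2 p0 c1'.
    have h2 := near_small e0 (fun n => nrm_ge0 _ _ _) c2.
    have [n [h3 h4]] := filter_ex (filterI h1 h2).
    exists (tensor (f_ n) `]s, t]), (fun w => f_ n w * (B t w - B s w)); split; [exact: pf| |exact: h4].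
    have E : tnrm (tensor (f_ n) `]s, t] - tensor f `]s, t]) ^+ 2 = nrm (f_ n - f) ^+ 2 * (t - s).
      by rewrite -tensorB; exact: (sqint_tensor_itv (sqintB mT (sf_ n) sf) s0 st).2.
    move: h3; rewrite -E ler_sqr ?nnegrE ?nrm_ge0//; exact: ltW.
Qed.

(** Simple processes are finite sums of elementary ones, and limit pairs are
    closed. *)
Lemma ito_limit_pair (Z : T * measurableTypeR R -> R) I : in_L2 tm ts Z ->
  ito_integral B Z I -> limit_pair Z I.
Proof.
move=> /(in_L2P _ mts) sZ [/(in_L2P _ mT) sI [H [pH cH cI]]].
have pair k : limit_pair (step_value (H k)) (step_integral B (H k)).
  have [t0 tH mH bH] := pH k.
  have tpos j : (j <= step_size (H k))%N -> 0 <= step_time (H k) j.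
    by elim: j => // j IH jm; apply: le_trans (tH j jm); exact/IH/ltnW.
  have -> : step_value (H k) = \sum_(j < step_size (H k))
      tensor (step_coef (H k) j) `]step_time (H k) j, step_time (H k) j.+1].
    by apply/funext => x; rewrite fct_sumE.
  have -> : step_integral B (H k) = \sum_(j < step_size (H k))
      (fun w => step_coef (H k) j w * (B (step_time (H k) j.+1) w - B (step_time (H k) j) w)).
    by apply/funext => x; rewrite fct_sumE.
  apply: (@limit_pair_sum _ _ _ P B xi xi_ hW _ (index_enum 'I_(step_size (H k)))
    (fun j => tensor (step_coef (H k) j) `]step_time (H k) j, step_time (H k) j.+1])
    (fun j w => step_coef (H k) j w * (B (step_time (H k) j.+1) w - B (step_time (H k) j) w))).
  move=> j _; have jm := ltn_ord j; apply: bounded_limit_pair.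
  - exact: tpos (ltnW jm).
  - exact: tH.
  - split; last exact: bH.
    move=> _ C mC; have : augmented_filtration B (step_time (H k) j) (setT `&` step_coef (H k) j @^-1` C).
      by apply: mH => //; exists C.
    apply: smallest_sub; first exact: sigma_algebra_measurable.
    move=> E [[r _ [D mD <-]]|]; first exact: measurable_funP.
    exact: (completion_negligible hF).
  - exact: mH.
have c1 : tnrm (step_value (H n) - Z) @[n --> \oo] --> 0.
  by apply/(@L2_cvgP _ _ _ tm ts mts (fun k => step_value (H k)) Z) => // n _; case: (pair n).
have c2 : nrm (step_integral B (H n) - I) @[n --> \oo] --> 0.
  by apply/(@L2_cvgP _ _ _ P setT mT (fun k => step_integral B (H k)) I) => // n _; case: (pair n).
apply: (limit_pair_closed hW) => // e e0.
have h1 := near_small e0 (fun n => nrm_ge0 _ _ _) c1.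
have h2 := near_small e0 (fun n => nrm_ge0 _ _ _) c2.
have [n [h3 h4]] := filter_ex (filterI h1 h2).
exists (step_value (H n)), (step_integral B (H n)).
by split; [exact: pair|exact: h3|exact: h4].
Qed.

End ito_pairs.

(** * Block approximation of the Wick martingales *)

Section wick_process.
Context {d : measure_display} {T : measurableType d} {R : realType}.
Variables (P : probability T R) (B : R -> {RV P >-> R}) (xi : {RV P >-> R}).
Variable xi_ : nat -> nat -> {RV P >-> R}.
Hypothesis hW : walk_approximation B xi xi_.
Local Notation tm := (time_measure P).
Local Notation ts := (@time_space d T R).
Local Notation sq := (sqint P setT).
Local Notation tnrm := (L2norm tm ts).
Local Notation nrm := (L2norm P setT).
Local Notation walk_phase := (walk_phase xi_).
Implicit Types (l : seq (R * R)) (s t phi : R).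

Lemma walk_phase_adapted_sq n l phi j : (1 <= n)%N ->
  adapted (xi_ n) j (walk_phase n l phi j) /\ sq (walk_phase n l phi j).
Proof. by move=> n1; exact: (@wick_phase_adapted_sq _ _ _ P n (xi_ n) (walk_standard hW n1) (grid_integrand n l) phi j). Qed.

(** Re (e^(i phi) Wick exponential of B), that is exp(q/2) cos(phi + theta). *)
Definition wick_limit phi l : T -> R :=
  fun w => expR (energy_form l / 2) * cos (phi + theta B l w).

Lemma bm_wick_limit phi l : bounded_measurable (wick_limit phi l).
Proof.
apply: (@bmM _ _ _ (fun=> _)); first exact: bm_cst.
by apply: bm_cos; apply: measurable_funD => //; exact: measurable_theta.
Qed.

Lemma cvg_walk_phase phi l s : 0 <= s -> times_within s l ->
  nrm (walk_phase n l phi (grid n s) - wick_limit phi l) @[n --> \oo] --> 0.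
Proof.
move=> s0 ls; have [cC cS] := cvg_walk_wick hW s0 ls.
pose C n w := (walk_wick xi_ n l (grid n s) w).1.
pose S n w := (walk_wick xi_ n l (grid n s) w).2.
apply: (squeeze_cvgr (f := cst 0) (h := fun n => `|cos phi| * nrm (C n - wick_cos B l) +
  `|sin phi| * nrm (S n - wick_sin B l))).
- near=> n; rewrite nrm_ge0/=.
  have n1 : (1 <= n)%N by near: n; exact: nbhs_infty_ge.
  have [[_ sC] [_ sS]] := walk_wick_adapted_sq hW l (grid n s) n1.
  have s1 : sq (C n - wick_cos B l) by apply: sqintB => //; exact/bm_sqint/bm_wick_cos.
  have s2 : sq (S n - wick_sin B l) by apply: sqintB => //; exact/bm_sqint/bm_wick_sin.
  rewrite -!nrmZ//.
  rewrite (_ : _ - _ = (fun w => cos phi * (C n - wick_cos B l) w) -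
      (fun w => sin phi * (S n - wick_sin B l) w)).
    by apply: nrmB => //; exact: sqintZ.
  apply/funext => w; change (walk_phase n l phi (grid n s) w - wick_limit phi l w =
    cos phi * (C n w - wick_cos B l w) - sin phi * (S n w - wick_sin B l w)).
  rewrite /wick_limit /wick_cos /wick_sin cosD.
  change (walk_phase n l phi (grid n s) w) with (cos phi * C n w - sin phi * S n w).
  ring.
- exact: cvg_cst.
- rewrite -[X in _ --> X](addr0 (0 : R)); apply: cvgD.
    by rewrite -[X in _ --> X](mulr0 `|cos phi|); apply: cvgM => //; exact: cvg_cst.
  by rewrite -[X in _ --> X](mulr0 `|sin phi|); apply: cvgM => //; exact: cvg_cst.
Unshelve. all: by end_near. Qed.

(** The Wick martingale at time s is the Wick exponential of the integrand cut at s;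
    for lists this is a truncation of the times. *)
Definition stopped s l : seq (R * R) := [seq (p.1, Num.min p.2 s) | p <- l].

Lemma stopped_within s l : 0 <= s -> (forall p, p \in l -> 0 <= p.2) ->
  times_within s (stopped s l).
Proof.
move=> s0 l0; apply/allP => _ /mapP[p pl ->] /=.
by rewrite le_min l0//= s0 ge_min lexx orbT.
Qed.

Lemma walk_phase_stopped n l phi j s : (1 <= n)%N -> 0 <= s -> (j <= grid n s)%N ->
  walk_phase n l phi j = walk_phase n (stopped s l) phi j.
Proof.
move=> n1 s0 js.
suff E w : wick n (xi_ n) (grid_integrand n l) j w =
    wick n (xi_ n) (grid_integrand n (stopped s l)) j w.
  by apply/funext => w; rewrite /walk_phase /wick_phase E.
elim: j js => // j IH js; rewrite /wick /=.
have := IH (ltnW js); rewrite /wick => ->.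
suff -> : step_angle n (grid_integrand n l) j.+1 (xi_ n j.+1 w) =
    step_angle n (grid_integrand n (stopped s l)) j.+1 (xi_ n j.+1 w) by [].
congr (_ * _); rewrite /grid_integrand /integrand big_map; apply: eq_bigr => p _ /=.
by rewrite le_min (le_gridE _ n1 s0) js andbT.
Qed.

(** The integrand j |-> M_(j-1) 1_(j <= nt), shifted by one to be predictable. *)
Definition wick_process n l phi t (i : nat) : T -> R :=
  if (0 < i <= grid n t)%N then walk_phase n l phi i.-1 else cst 0.

Lemma interval_find (g : nat -> nat) m j : (g 0 < j <= g m)%N ->
  exists2 k, (k < m)%N & (g k < j <= g k.+1)%N.
Proof.
elim: m => [|m IH]; first by case/andP => h1 h2; have := leq_trans h1 h2; rewrite ltnn.
move=> /andP[h1 h2]; have [jm|jm] := leqP j (g m).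
  by have [|k km kj] := IH; [rewrite h1|exists k => //; exact: ltnW].
by exists m => //; rewrite jm.
Qed.

Lemma block_sum (a : nat -> T -> R) (g : nat -> nat) m j k0 :
  {homo g : i k / (i <= k)%N} -> (k0 < m)%N -> (g k0 < j <= g k0.+1)%N ->
  \sum_(k < m) block (a k) (g k) (g k.+1) j = a k0.
Proof.
move=> hg km /andP[h1 h2]; rewrite (bigD1 (Ordinal km))//= big1 ?addr0.
  by rewrite /block h1 h2.
move=> k kk; rewrite /block; case: ifP => // /andP[h3 h4].
have kn : (k : nat) != k0 by apply: contra kk => /eqP kk0; apply/eqP/val_inj.
have [kl|kl] : (k < k0)%N \/ (k0 < k)%N by apply/orP; rewrite -neq_ltn.
- by have := leq_trans (leq_ltn_trans (hg _ _ kl) h1) h4; rewrite ltnn.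
- by have := leq_trans (leq_ltn_trans (hg _ _ kl) h3) h2; rewrite ltnn.
Qed.

Definition subgrid t (m i : nat) : R := i%:R * t / m%:R.

(** The Wick martingale sampled at the m times k t / m. *)
Definition wick_blocks n l phi t m (i : nat) : T -> R :=
  \sum_(k < m) block (walk_phase n l phi (grid n (subgrid t m k)))
    (grid n (subgrid t m k)) (grid n (subgrid t m k.+1)) i.

Lemma wick_process_sq n l phi t : (1 <= n)%N -> sq_seq P (wick_process n l phi t).
Proof.
move=> n1; split=> // i i1; rewrite /wick_process; case: ifP => _; last exact: sqint0.
by case: (walk_phase_adapted_sq l phi i.-1 n1).
Qed.

Lemma wick_blocks_sq n l phi t m : (1 <= n)%N -> sq_seq P (wick_blocks n l phi t m).
Proof.
move=> n1; split.
  by rewrite /wick_blocks big1.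
move=> i i1; apply: sqint_sum => // k _; rewrite /block; case: ifP => _; last exact: sqint0.
by case: (walk_phase_adapted_sq l phi (grid n (subgrid t m k)) n1).
Qed.

(** Within a block of length t/m the squared increment of the martingale is
    O(t/m + 1/n). *)
Lemma wick_block_dist n l phi t m : (1 <= n)%N -> 0 <= t -> (0 < m)%N ->
  tnrm (ceil_process n (wick_process n l phi t) - ceil_process n (wick_blocks n l phi t m)) ^+ 2
    <= t * ((t / m%:R + n%:R^-1) * (integrand_bound l ^+ 2 * growth t l)).
Proof.
move=> n1 t0 m0; have m0' : 0 < m%:R :> R by rewrite ltr0n.
have n0 : 0 < n%:R :> R by rewrite ltr0n.
set K := integrand_bound l ^+ 2 * growth t l.
have K0 : 0 <= K by rewrite mulr_ge0 ?sqr_ge0 ?expR_ge0.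
pose g i := grid n (subgrid t m i).
have sg0 i : 0 <= subgrid t m i by rewrite divr_ge0 ?mulr_ge0// ltW.
have hs i k : (i <= k)%N -> subgrid t m i <= subgrid t m k.
  by move=> ik; rewrite ler_wpM2r ?invr_ge0 ?(ltW m0')// ler_wpM2r// ler_nat.
have hg : {homo g : i k / (i <= k)%N} by move=> i k ik; exact/grid_le/hs.
have gm : g m = grid n t by rewrite /g /subgrid mulrAC divff ?mul1r// gt_eqF.
have g0 : g 0%N = 0%N by rewrite /g /subgrid !mul0r /grid mulr0 truncn0.
pose D i := wick_process n l phi t i - wick_blocks n l phi t m i.
have sD : sq_seq P D.
  have [a1 a2] := wick_process_sq l phi t n1; have [b1 b2] := wick_blocks_sq l phi t m n1.
  split; first by rewrite /D a1 b1; exact: subrr.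
  by move=> i i1; apply: sqintB => //; [exact: a2|exact: b2].
have Dm i : (grid n t < i)%N -> D i = cst 0.
  move=> ti; rewrite /D /wick_process [(i <= _)%N]leqNgt ti andbF.
  rewrite /wick_blocks big1 ?subr0// => k _; rewrite /block -/(g k) -/(g k.+1).
  have gk : (g k.+1 < i)%N by apply: leq_ltn_trans ti; rewrite -gm; exact: hg.
  by rewrite [(i <= _)%N]leqNgt gk andbF.
have Db i : (1 <= i < (grid n t).+1)%N -> nrm (D i) ^+ 2 <= (t / m%:R + n%:R^-1) * K.
  move=> /andP[i1 it]; rewrite ltnS in it.
  have [|k km ki] := @interval_find g m i; first by rewrite g0 i1 gm.
  have /andP[k1 k2] := ki.
  rewrite /D /wick_process i1 it /wick_blocks.
  rewrite (@block_sum (fun k => walk_phase n l phi (g k)) g m i k hg km ki).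
  have ki' : (g k <= i.-1)%N by rewrite -ltnS prednK.
  have it' : (i.-1 <= grid n t)%N by rewrite (leq_trans (leq_pred _)).
  apply: le_trans (walk_phase_increment hW l phi n1 t0 ki' it') _.
  apply: ler_wpM2r => //.
  have h1 : (i.-1 - g k)%:R <= (g k.+1)%:R - (g k)%:R :> R.
    rewrite natrB// lerD2r ler_nat; exact: leq_trans (leq_pred _) k2.
  have /andP[u1 u2] := grid_bounds n1 (sg0 k); have /andP[v1 v2] := grid_bounds n1 (sg0 k.+1).
  apply: (@le_trans _ _ (((g k.+1)%:R - (g k)%:R) / n%:R)).
    by rewrite ler_wpM2r ?invr_ge0 ?(ltW n0).
  rewrite mulrBl; have : subgrid t m k.+1 - subgrid t m k = t / m%:R.
    by rewrite /subgrid -[k.+1%:R]natr1; ring.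
  move: u1 v2; rewrite -/(g k) -/(g k.+1); lra.
have eD := energy_finite P n Dm.
have [_] := sqint_ceil n1 sD eD.
rewrite (_ : ceil_process n D = ceil_process n (wick_process n l phi t) -
  ceil_process n (wick_blocks n l phi t m))// => ->.
apply: (@le_trans _ _ (n%:R^-1 * \sum_(1 <= i < (grid n t).+1) (t / m%:R + n%:R^-1) * K)).
  by rewrite ler_wpM2l ?invr_ge0 ?(ltW n0)//; exact: ler_sum_nat.
rewrite sumr_const_nat subn1 /= -[X in _ * X]mulr_natl mulrA.
rewrite -mulrA [leLHS]mulrA; apply: ler_wpM2r; first by rewrite mulr_ge0// addr_ge0 ?divr_ge0 ?invr_ge0// ltW.
by rewrite mulrC le_gridE.
Qed.

End wick_process.

(** * Wick martingales and limit pairs *)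

Section wick_approximation.
Context {d : measure_display} {T : measurableType d} {R : realType}.
Variables (P : probability T R) (B : R -> {RV P >-> R}) (xi : {RV P >-> R}).
Variable xi_ : nat -> nat -> {RV P >-> R}.
Hypothesis hW : walk_approximation B xi xi_.
Local Notation tm := (time_measure P).
Local Notation ts := (@time_space d T R).
Local Notation mts := (@measurable_time_space d T R).
Local Notation sq := (sqint P setT).
Local Notation tsq := (sqint tm ts).
Local Notation tnrm := (L2norm tm ts).
Local Notation tip := (L2inner tm ts).
Local Notation nrm := (L2norm P setT).
Local Notation mT := measurableT.
Local Notation limit_pair := (limit_pair xi_).
Local Notation walk_phase := (walk_phase xi_).
Local Notation wick_process := (wick_process xi_).
Local Notation wick_blocks := (wick_blocks xi_).
Local Notation wick_limit := (wick_limit B).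
Implicit Types (l : seq (R * R)) (s t phi : R).

Lemma wick_limit_pair phi l s t : 0 <= s -> s <= t -> times_within s l ->
  exists G, limit_pair (tensor (wick_limit phi l) `]s, t]) G.
Proof.
move=> s0 st ls; eexists; rewrite /wick_limit tensorZ.
exact: (limit_pairZ hW _ (cos_limit_pair hW phi s0 st ls)).
Qed.

(** The number m of blocks is fixed first, by [wick_block_dist]; then n grows and each
    block has its limit pair. *)
Lemma wick_process_approx phi l t e : (forall p, p \in l -> 0 <= p.2) -> 0 <= t -> 0 < e ->
  exists H G, limit_pair H G /\
    \forall n \near \oo, tnrm (ceil_process n (wick_process n l phi t) - H) <= e.
Proof.
move=> l0 t0 e0; set K := integrand_bound l ^+ 2 * growth t l.
have K0 : 0 <= K by rewrite mulr_ge0 ?sqr_ge0 ?expR_ge0.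
have e8 : 0 < e ^+ 2 / 8 by rewrite divr_gt0// exprn_gt0.
have tK0 : 0 <= t * K by rewrite mulr_ge0.
pose m := (Num.truncn (t * (t * K) / (e ^+ 2 / 8))).+1.
have m0 : (0 < m)%N by [].
have m0' : 0 < m%:R :> R by rewrite ltr0n.
have mK : t * (t * K) / m%:R <= e ^+ 2 / 8.
  have := truncnS_gt (t * (t * K) / (e ^+ 2 / 8)); rewrite -/m ltr_pdivrMr// => h.
  by rewrite ler_pdivrMr// [leRHS]mulrC ltW.
pose s_ i := subgrid t m i.
have sg0 i : 0 <= s_ i by rewrite /s_ divr_ge0 ?mulr_ge0// ltW.
have hs i : s_ i <= s_ i.+1.
  by rewrite /s_ /subgrid ler_wpM2r ?invr_ge0 ?(ltW m0')// ler_wpM2r// ler_nat.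
pose H_ (i : 'I_m) := tensor (wick_limit phi (stopped (s_ i) l)) `]s_ i, s_ i.+1].
have HG i : exists G, limit_pair (H_ i) G.
  by apply: wick_limit_pair => //; exact: stopped_within.
have [G_ pG] := @choice _ _ _ HG.
exists (\sum_(i < m) H_ i), (\sum_(i < m) G_ i); split.
  by apply: (@limit_pair_sum _ _ _ P B xi xi_ hW _ (index_enum 'I_m) H_ G_) => i _; exact: pG.
have sH i : tsq (H_ i) by case: (pG i).
pose blk n (i : 'I_m) := block (walk_phase n l phi (grid n (s_ i))) (grid n (s_ i)) (grid n (s_ i.+1)).
have cblk i : tnrm (ceil_process n (blk n i) - H_ i) @[n --> \oo] --> 0.
  apply: cvg_ceil_block => //.
  - near=> n; have n1 : (1 <= n)%N by near: n; exact: nbhs_infty_ge.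
    by case: (walk_phase_adapted_sq hW l phi (grid n (s_ i)) n1).
  - exact/bm_sqint/bm_wick_limit.
  - have c := cvg_walk_phase hW phi (sg0 i) (stopped_within (sg0 i) l0).
    apply: cvg_trans c; apply: near_eq_cvg; near=> n.
    have n1 : (1 <= n)%N by near: n; exact: nbhs_infty_ge.
    by rewrite (walk_phase_stopped _ l phi n1 (sg0 i) (leqnn _)).
have cs : \sum_(i < m) tnrm (ceil_process n (blk n i) - H_ i) @[n --> \oo] --> 0.
  have c := @cvg_sum_in R 'I_m (index_enum 'I_m)
    (fun n i => tnrm (ceil_process n (blk n i) - H_ i)) (fun=> 0) (fun i _ => cblk i).
  by rewrite big1 in c.
have e2 : 0 < e / 2 by lra.
have h1 := near_small e2 (fun n => sumr_ge0 _ (fun i _ => nrm_ge0 _ _ _)) cs.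
have cn : t * K * n%:R^-1 @[n --> \oo] --> (0 : R).
  by rewrite -[X in _ --> X](mulr0 (t * K)); apply: cvgM; [exact: cvg_cst|exact: cvg_invn].
have tKn n : 0 <= t * K * n%:R^-1 by rewrite mulr_ge0 ?invr_ge0.
have h2 := near_small e8 tKn cn.
near=> n.
have n1 : (1 <= n)%N by near: n; exact: nbhs_infty_ge.
have g1 : \sum_(i < m) tnrm (ceil_process n (blk n i) - H_ i) <= e / 2 by near: n; exact: h1.
have g2 : t * K * n%:R^-1 <= e ^+ 2 / 8.
  by near: n; exact: h2.
have std := walk_standard hW n1.
have sblk i : tsq (ceil_process n (blk n i)).
  have sa := (walk_phase_adapted_sq hW l phi (grid n (s_ i)) n1).2.
  apply: (eq_sqint mts (f := tensor (walk_phase n l phi (grid n (s_ i)))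
    `](grid n (s_ i))%:R / n%:R, (grid n (s_ i.+1))%:R / n%:R])).
    by move=> x /[!inE] xts; rewrite ceil_block.
  apply: (sqint_tensor_itv sa _ _).1; first by rewrite divr_ge0.
  by rewrite ler_wpM2r ?invr_ge0// ler_nat grid_le.
have d1 : tnrm (ceil_process n (wick_process n l phi t) - ceil_process n (wick_blocks n l phi t m)) <= e / 2.
  rewrite -(@ler_pXn2r _ 2)// ?nnegrE ?nrm_ge0 ?(ltW e2)//.
  apply: le_trans (wick_block_dist hW l phi n1 t0 m0) _; rewrite -/K.
  have -> : t * ((t / m%:R + n%:R^-1) * K) = t * (t * K) / m%:R + t * K * n%:R^-1 by ring.
  have -> : (e / 2) ^+ 2 = e ^+ 2 / 8 + e ^+ 2 / 8 by field.
  exact: lerD.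
have wE : ceil_process n (wick_blocks n l phi t m) = \sum_(i < m) ceil_process n (blk n i).
  by apply/funext => x; rewrite fct_sumE /ceil_process /wick_blocks fct_sumE.
have d2 : tnrm (ceil_process n (wick_blocks n l phi t m) - \sum_(i < m) H_ i) <= e / 2.
  rewrite wE -sumrB; apply: le_trans g1; apply: (nrm_sum mts) => i _.
  exact: (sqintB mts (sblk i) (sH i)).
have sw : tsq (ceil_process n (wick_process n l phi t)).
  apply: (sqint_ceil n1 (wick_process_sq hW l phi t n1) (energy_finite P n (m := grid n t) _)).1.
  by move=> i ti; rewrite /wick_process [(i <= _)%N]leqNgt ti andbF.
have sb : tsq (ceil_process n (wick_blocks n l phi t m)).
  by rewrite wE; apply: (sqint_sum mts) => i _; exact: sblk.
have sHH : tsq (\sum_(i < m) H_ i) by apply: (sqint_sum mts) => i _; exact: sH.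
have := nrm_dist_trans mts sw sb sHH; lra.
Unshelve. all: by end_near. Qed.

(** At step j the martingale difference M_T - M_(j-1) is orthogonal to every
    predictable coefficient, so M_T 1_(]0, t]) may be replaced by the Wick process.
    The bound is uniform in the discrete integrand, as it is used both for the sequence of the
    theorem and for the approximants of its limit. *)
Lemma wick_tensor_approx T0 phi l t e : times_within T0 l -> 0 <= t -> t <= T0 -> 0 < e ->
  exists H G, limit_pair H G /\ \forall n \near \oo, forall Z X, walk_pair n (xi_ n) Z X ->
    `|tip (ceil_process n Z) (tensor (wick_limit phi l) `]0, t] - H)| <= nrm X * e.
Proof.
move=> lT t0 tT e0; have T00 := le_trans t0 tT.
have l0 p : p \in l -> 0 <= p.2 by move=> /(times_withinP lT)[].
have e2 : 0 < e / 2 by lra.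
have [H [G [pHG hH]]] := wick_process_approx phi l0 t0 e2.
exists H, G; split=> //; have [sH _ _] := pHG.
have g0 n : grid n (0 : R) = 0%N by rewrite /grid mulr0 truncn0.
pose blk n := block (walk_phase n l phi (grid n T0)) 0 (grid n t).
pose Q := tensor (wick_limit phi l) `]0, t].
have sQ : tsq Q by apply: (sqint_tensor_itv _ (lexx 0) t0).1; exact/bm_sqint/bm_wick_limit.
have cblk : tnrm (ceil_process n (blk n) - Q) @[n --> \oo] --> 0.
  have E : (fun n => tnrm (ceil_process n (blk n) - Q)) = (fun n => tnrm (ceil_process n
      (block (walk_phase n l phi (grid n T0)) (grid n (0 : R)) (grid n t)) - Q)).
    by apply/funext => n; rewrite g0.
  rewrite E; apply: (@cvg_ceil_block _ _ _ P (fun n => walk_phase n l phi (grid n T0))); [exact: lexx|exact: t0| | |].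
  - near=> n; have n1 : (1 <= n)%N by near: n; exact: nbhs_infty_ge.
    by case: (walk_phase_adapted_sq hW l phi (grid n T0) n1).
  - exact/bm_sqint/bm_wick_limit.
  - exact: (cvg_walk_phase hW phi T00 lT).
have hb := near_small e2 (fun n => nrm_ge0 _ _ _) cblk.
near=> n => Z X pZX.
have n1 : (1 <= n)%N by near: n; exact: nbhs_infty_ge.
have g1 : tnrm (ceil_process n (blk n) - Q) <= e / 2 by near: n; exact: hb.
have g2 : tnrm (ceil_process n (wick_process n l phi t) - H) <= e / 2 by near: n; exact: hH.
have std := walk_standard hW n1.
have [sZ sX nZX] := walk_pair_sq hW n1 pZX.
have [Z0 pZ _ _] := pZX.
have sphi j : sq (walk_phase n l phi j) by case: (walk_phase_adapted_sq hW l phi j n1).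
have sbq : sq_seq P (blk n).
  by split=> // i i1; rewrite /blk /block; case: ifP => _ //; exact: sqint0.
have [bw0 bws] := wick_process_sq hW l phi t n1.
have eb : forall i, (grid n t < i)%N -> blk n i = cst 0.
  by move=> i ti; rewrite /blk /block [(i <= _)%N]leqNgt ti andbF.
have ew : forall i, (grid n t < i)%N -> wick_process n l phi t i = cst 0.
  by move=> i ti; rewrite /wick_process [(i <= _)%N]leqNgt ti andbF.
have sb := (sqint_ceil n1 sbq (energy_finite P n eb)).1.
have sw := (sqint_ceil n1 (conj bw0 bws) (energy_finite P n ew)).1.
pose Y i := blk n i - wick_process n l phi t i.
have sYq : sq_seq P Y.
  split; first by rewrite /Y bw0 (_ : blk n 0%N = cst 0)//; exact: subrr.
  by move=> i i1; apply: sqintB => //; [exact: sbq.2|exact: bws].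
have eY : forall i, (grid n t < i)%N -> Y i = cst 0.
  by move=> i ti; rewrite /Y eb// ew//; exact: subrr.
have orth : tip (ceil_process n Z) (ceil_process n Y) = 0.
  apply: (ceil_orth n1 (walk_pair_energy std pZX) (energy_finite P n eY)
    (predictable_sq_seq Z0 pZ) sYq) => i i1.
  have [sZi aZi] := pZ i i1.
  rewrite /Y /blk /block /wick_process; case: ifP => [/andP[_ it]|_]; last first.
    by rewrite subrr -(subrr (Z i)) (ipBr mT sZi sZi sZi) subrr.
  rewrite /walk_phase !wick_phase_integral opprD addrACA subrr add0r.
  apply: (walk_integral_orth n std) => //.
    exact: (wick_integrand_predictable n std).
  by rewrite (leq_trans (leq_pred _))// (leq_trans it)// grid_le.
have dY : ceil_process n Y = ceil_process n (blk n) - ceil_process n (wick_process n l phi t) by [].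
(* tensor to block, block to Wick process, Wick process to H *)
have Qd : Q - H = (ceil_process n Y + (ceil_process n (wick_process n l phi t) - H)) -
    (ceil_process n (blk n) - Q).
  by rewrite dY; apply/funext => x; rewrite -[LHS]/(Q x - H x) -[RHS]/((ceil_process n (blk n) x -
   ceil_process n (wick_process n l phi t) x + (ceil_process n (wick_process n l phi t) x - H x)) -
   (ceil_process n (blk n) x - Q x)); ring.
have sY : tsq (ceil_process n Y) by rewrite dY; exact: (sqintB mts sb sw).
have swH := sqintB mts sw sH; have sbQ := sqintB mts sb sQ.
rewrite Qd (ipBr mts (sqintD mts sY swH) sbQ sZ) (ipDr mts sY swH sZ) orth add0r.
have h1 := ip_le mts sZ swH; have h2 := ip_le mts sZ sbQ.
rewrite nZX in h1 h2.
have X0 := nrm_ge0 P setT X.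
apply: le_trans (ler_normB _ _) _; apply: le_trans (lerD h1 h2) _.
rewrite -mulrDr; apply: ler_wpM2l => //; lra.
Unshelve. all: by end_near. Qed.

(** Linear combination of the processes with different horizons: the integrand of
    the Wick martingale jumps at the times of the list. *)
Lemma wick_sum_approx psi l r e : (forall p, p \in l -> 0 <= p.2) ->
  (forall p, p \in r -> 0 <= p.2) -> 0 < e ->
  exists H G, limit_pair H G /\ \forall n \near \oo,
    tsq (ceil_process n (fun i w => \sum_(p <- r) p.1 * wick_process n l psi p.2 i w)) /\
    tnrm (ceil_process n (fun i w => \sum_(p <- r) p.1 * wick_process n l psi p.2 i w) - H) <= e.
Proof.
move=> l0; elim: r e => [|p r IH] e r0 e0.
  exists 0, 0; split; first exact: (limit_pair0 hW).
  apply: nearW => n; have -> : ceil_process n (fun i w => \sum_(p <- [::])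
    p.1 * wick_process n l psi p.2 i w) = 0 :> (T * measurableTypeR R -> R).
    by apply/funext => x; rewrite /ceil_process big_nil.
  split; first exact: (@sqint0 _ _ _ tm ts mts).
  by rewrite subrr (@nrm0 _ _ _ tm ts mts) ltW.
have e2 : 0 < e / 2 by lra.
have [|H [G [pHG h]]] := IH (e / 2) _ e2.
  by move=> q qr; apply: r0; rewrite inE qr orbT.
have c1 : 0 < `|p.1| + 1 by rewrite ltr_wpDl.
have e3 : 0 < e / 2 / (`|p.1| + 1) by rewrite divr_gt0.
have [H' [G' [pHG' h']]] := wick_process_approx psi l0 (r0 p (mem_head _ _)) e3.
exists ((fun x => p.1 * H' x) + H), ((fun w => p.1 * G' w) + G); split.
  by apply: (limit_pairD hW) => //; exact: (limit_pairZ hW).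
have [sH _ _] := pHG; have [sH' _ _] := pHG'.
near=> n.
have n1 : (1 <= n)%N by near: n; exact: nbhs_infty_ge.
have [s1 k1] : tsq (ceil_process n (fun i w => \sum_(p <- r) p.1 * wick_process n l psi p.2 i w)) /\
    tnrm (ceil_process n (fun i w => \sum_(p <- r) p.1 * wick_process n l psi p.2 i w) - H) <= e / 2.
  by near: n; exact: h.
have k2 : tnrm (ceil_process n (wick_process n l psi p.2) - H') <= e / 2 / (`|p.1| + 1).
  by near: n; exact: h'.
have sw : tsq (ceil_process n (wick_process n l psi p.2)).
  apply: (sqint_ceil n1 (wick_process_sq hW l psi p.2 n1) (energy_finite P n (m := grid n p.2) _)).1.
  by move=> i ti; rewrite /wick_process [(i <= _)%N]leqNgt ti andbF.
set S := ceil_process n _ in s1 k1.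
have -> : ceil_process n (fun i w => \sum_(q <- p :: r) q.1 * wick_process n l psi q.2 i w) =
    (fun x => p.1 * ceil_process n (wick_process n l psi p.2) x) + S.
  by apply/funext => x; rewrite /S /ceil_process big_cons.
have sZ := sqintZ mts p.1 sw.
split; first exact: (sqintD mts sZ s1).
rewrite opprD addrACA.
have swH := sqintB mts sw sH'.
have E : (fun x => p.1 * ceil_process n (wick_process n l psi p.2) x) - (fun x => p.1 * H' x) =
    (fun x => p.1 * (ceil_process n (wick_process n l psi p.2) - H') x).
  by apply/funext => x; rewrite [RHS]mulrBr.
rewrite E.
have h3 := nrmD mts (sqintZ mts p.1 swH) (sqintB mts s1 sH).
rewrite (nrmZ mts p.1 swH) in h3.
have : `|p.1| * tnrm (ceil_process n (wick_process n l psi p.2) - H') <= e / 2.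
  have q0 := nrm_ge0 tm ts (ceil_process n (wick_process n l psi p.2) - H').
  move: k2; rewrite ler_pdivlMr// => k2; have := normr_ge0 p.1; nra.
lra.
Unshelve. all: by end_near. Qed.

(** The Wick exponential is a constant plus the integral of Wick processes; the
    isometry turns closeness of the integrands into closeness of the integrals. *)
Lemma wick_limit_approx T0 phi l e : times_within T0 l -> 0 <= T0 -> 0 < e ->
  exists H G, limit_pair H G /\ nrm (wick_limit phi l - ((fun=> cos phi) + G)) <= e.
Proof.
move=> lT T00 e0; have e4 : 0 < e / 4 by lra.
have l0 p : p \in l -> 0 <= p.2 by move=> /(times_withinP lT)[].
have [H [G [pHG h]]] := wick_sum_approx (phi + pi / 2) l0 l0 e4.
exists H, G; split=> //; have [sH sG a] := pHG.
have [Y_ [W_ hY]] := a _ e4.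
have hM := near_small e4 (fun n => nrm_ge0 _ _ _) (cvg_walk_phase hW phi T00 lT).
have [n [[[h1 h2] h3] n1]] := filter_ex (filterI (filterI (filterI h hY) hM) (nbhs_infty_ge 1)).
have std := walk_standard hW n1.
have {h1}[_ h1] := h1; have [pY k1 k2] := h2.
pose Zp := wick_integrand n (xi_ n) (grid_integrand n l) phi.
pose I := walk_integral n (xi_ n) Zp (grid n T0).
have gl0 i : (grid n T0 < i)%N -> grid_integrand n l i = 0.
  move=> ti; rewrite (grid_integrandE _ n1 lT) big_seq big1// => p pl.
  have [_ pT] := times_withinP lT pl.
  by rewrite leqNgt (leq_ltn_trans (grid_le n pT) ti) mulr0.
have pZ : walk_pair n (xi_ n) Zp I.
  apply: (@walk_pair_finite _ _ _ P n (xi_ n) std Zp (grid n T0)) => //.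
    exact: (wick_integrand_predictable n std).
  by case=> // i ti; rewrite /Zp /wick_integrand gl0//; apply/funext => w; rewrite mul0r.
have ZE : Zp = (fun i w => \sum_(p <- l) p.1 * wick_process n l (phi + pi / 2) p.2 i w).
  apply/funext => -[|i]; apply/funext => w.
    by rewrite big1// => p _; rewrite /wick_process /= mulr0.
  rewrite /Zp /wick_integrand (grid_integrandE _ n1 lT) mulr_suml.
  apply: eq_bigr => p _; rewrite /wick_process /=.
  by case: (i < grid n p.2)%N; rewrite /= ?mulr1// mulr0n /cst !mulr0 mul0r.
rewrite -ZE in h1.
have [sZ sI nZI] := walk_pair_sq hW n1 pZ; have [sY sW nYW] := walk_pair_sq hW n1 pY.
have pD := walk_pairD std pZ (walk_pairZ std (-1) pY).
have [sD1 sD2 nD] := walk_pair_sq hW n1 pD.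
have E1 : ceil_process n (fun i => Zp i + (fun w => -1 * Y_ n i w)) = ceil_process n Zp - ceil_process n (Y_ n).
  by apply/funext => x; rewrite -[LHS]/(Zp _ x.1 + -1 * Y_ n _ x.1) mulN1r.
have E2 : I + (fun w => -1 * W_ n w) = I - W_ n.
  by apply/funext => w; rewrite -[LHS]/(I w + -1 * W_ n w) mulN1r.
rewrite E1 E2 in nD.
have d1 : nrm (I - W_ n) <= e / 4 + e / 4.
  rewrite -nD; apply: le_trans (nrm_dist_trans mts sZ sH sY) _.
  by apply: lerD; [exact: h1|rewrite nrm_distC; exact: k1].
have ME : walk_phase n l phi (grid n T0) = (fun=> cos phi) + I.
  by rewrite /walk_phase wick_phase_integral.
have sM : sq (walk_phase n l phi (grid n T0)).
  by case: (walk_phase_adapted_sq hW l phi (grid n T0) n1).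
have sL : sq (wick_limit phi l) by exact/bm_sqint/bm_wick_limit.
have sc : sq (fun=> cos phi) by exact: sqint_cst.
have scG := sqintD mT sc sG.
have t1 := nrm_dist_trans mT sL sM scG.
rewrite nrm_distC in h3.
have E3 : walk_phase n l phi (grid n T0) - ((fun=> cos phi) + G) = I - G.
  by rewrite ME opprD addrACA subrr add0r.
rewrite E3 in t1.
have t2 := nrm_dist_trans mT sI sW sG.
lra.
Qed.

End wick_approximation.

(** * Weak convergence through test functions *)

Section weak_convergence.
Context {d : measure_display} {T : measurableType d} {R : realType}.
Variables (mu : {measure set T -> \bar R}) (D : set T).
Hypothesis mD : measurable D.
Variables (f_ : nat -> T -> R) (f : T -> R).
Hypothesis sf_ : forall n, (1 <= n)%N -> sqint mu D (f_ n).
Hypothesis sf : sqint mu D f.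
Local Notation sq := (sqint mu D).
Local Notation ip := (L2inner mu D).
Local Notation nrm := (L2norm mu D).
Implicit Types h g : T -> R.

(** The functions against which the sequence converges; they form a closed
    subspace as soon as the sequence is bounded. *)
Definition tests h : Prop := sq h /\ ip (f_ n) h @[n --> \oo] --> ip f h.

Lemma weak_cvgP : L2_weak_cvg mu D f_ f <-> forall h, sq h -> tests h.
Proof.
split=> [W h sh|W g /(in_L2P _ mD) sg]; last by case: (W g sg).
by split=> //; apply: W; exact/(in_L2P _ mD).
Qed.

Lemma testsD h g : tests h -> tests g -> tests (h + g).
Proof.
move=> [sh ch] [sg cg]; split; first exact: sqintD.
rewrite ipDr//.
have c : ip (f_ n) h + ip (f_ n) g @[n --> \oo] --> ip f h + ip f g by exact: cvgD.
apply: cvg_trans c; apply: near_eq_cvg; near=> n.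
by rewrite ipDr//; apply: sf_; near: n; exact: nbhs_infty_ge.
Unshelve. all: by end_near. Qed.

Lemma testsZ (c : R) h : tests h -> tests (fun x => c * h x).
Proof.
move=> [sh ch]; split; first exact: sqintZ.
rewrite ipZr//.
have c' : c * ip (f_ n) h @[n --> \oo] --> c * ip f h by apply: cvgM => //; exact: cvg_cst.
apply: cvg_trans c'; apply: near_eq_cvg; near=> n.
by rewrite ipZr//; apply: sf_; near: n; exact: nbhs_infty_ge.
Unshelve. all: by end_near. Qed.

(** Closeness is only asked in the directions of f_n and f, as the Wick processes
    are not close to their tensors in norm. *)
Lemma tests_approx h : sq h -> (forall e : R, 0 < e -> exists h', [/\ tests h',
    \forall n \near \oo, `|ip (f_ n) (h - h')| <= e & `|ip f (h - h')| <= e]) -> tests h.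
Proof.
move=> sh a; split=> //; apply/cvgrPdist_le => e e0.
have e3 : 0 < e / 3 by lra.
have [h' [[sh' /cvgrPdist_le/(_ _ e3) ch'] h1 h2]] := a _ e3.
near=> n.
have n1 : (1 <= n)%N by near: n; exact: nbhs_infty_ge.
have sn := sf_ n1.
have k1 : `|ip f h' - ip (f_ n) h'| <= e / 3 by near: n; exact: ch'.
have k2 : `|ip (f_ n) (h - h')| <= e / 3 by near: n; exact: h1.
move: h2 k1 k2; rewrite (ipBr mD sh sh' sf) (ipBr mD sh sh' sn) !ler_norml.
move=> /andP[? ?] /andP[? ?] /andP[? ?]; apply/andP; split; lra.
Unshelve. all: by end_near. Qed.

Lemma tests_closed (C : R) h : (forall n, (1 <= n)%N -> nrm (f_ n) <= C) -> sq h ->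
  (forall e : R, 0 < e -> exists2 h', tests h' & nrm (h - h') <= e) -> tests h.
Proof.
move=> fC sh a; apply: tests_approx => // e e0.
have C0 : 0 <= C by apply: le_trans (nrm_ge0 _ _ _) (fC 1%N isT).
pose c := C + nrm f + 1.
have c0 : 0 < c by rewrite ltr_wpDl// addr_ge0// nrm_ge0.
have ec : 0 < e / c by rewrite divr_gt0.
have [h' th' hh'] := a _ ec; have [sh' _] := th'.
have b g : sq g -> nrm g <= c -> `|ip g (h - h')| <= e.
  move=> sg gc; apply: le_trans (ip_le mD sg (sqintB mD sh sh')) _.
  apply: (@le_trans _ _ (c * (e / c))); first by apply: ler_pM => //; exact: nrm_ge0.
  by rewrite mulrCA divff ?mulr1// gt_eqF.
have f0 := nrm_ge0 mu D f.
exists h'; split=> //.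
  near=> n; have n1 : (1 <= n)%N by near: n; exact: nbhs_infty_ge.
  by apply: b; [exact: sf_|apply: le_trans (fC n n1) _; rewrite /c; lra].
by apply: b => //; rewrite /c; lra.
Unshelve. all: by end_near. Qed.

(** Expand |f_n - f|^2. *)
Lemma strong_weakP : nrm (f_ n - f) @[n --> \oo] --> 0 <->
  L2_weak_cvg mu D f_ f /\ nrm (f_ n) @[n --> \oo] --> nrm f.
Proof.
split=> [c|[/weak_cvgP W c]].
  split.
    apply/weak_cvgP => h sh; split=> //.
    apply/cvgrPdist_le => e e0.
    have h1 : 0 < nrm h + 1 by rewrite ltr_wpDl ?nrm_ge0.
    have eh : 0 < e / (nrm h + 1) by rewrite divr_gt0.
    have H := near_small eh (fun n => nrm_ge0 _ _ _) c.
    near=> n.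
    have n1 : (1 <= n)%N by near: n; exact: nbhs_infty_ge.
    have k : nrm (f_ n - f) <= e / (nrm h + 1) by near: n; exact: H.
    have sn := sf_ n1.
    rewrite distrC -(ipBl mD sn sf sh); apply: le_trans (ip_le mD (sqintB mD sn sf) sh) _.
    have := nrm_ge0 mu D h; have := nrm_ge0 mu D (f_ n - f).
    move: k; rewrite ler_pdivlMr//; nra.
  apply/cvgrPdist_le => e e0.
  have H := near_small e0 (fun n => nrm_ge0 _ _ _) c.
  near=> n.
  have n1 : (1 <= n)%N by near: n; exact: nbhs_infty_ge.
  have k : nrm (f_ n - f) <= e by near: n; exact: H.
  by rewrite distrC; apply: le_trans (nrm_lip mD (sf_ n1) sf) k.
have [_ cf] := W f sf; apply: nrm_cvg0_sqr.
have E : nrm f * nrm f - 2 * ip f f + nrm f ^+ 2 = 0 by rewrite -expr2 nrm_sqr; ring.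
have c' : nrm (f_ n) * nrm (f_ n) - 2 * ip (f_ n) f + nrm f ^+ 2 @[n --> \oo] --> (0 : R).
  rewrite -E; apply: cvgD; last exact: cvg_cst.
  by apply: cvgB; [exact: cvgM|apply: cvgM => //; exact: cvg_cst].
apply: cvg_trans c'; apply: near_eq_cvg; near=> n.
have n1 : (1 <= n)%N by near: n; exact: nbhs_infty_ge.
have sn := sf_ n1.
rewrite -expr2 !nrm_sqr (ipBl mD sn sf (sqintB mD sn sf)) !(ipBr mD sn sf)//.
rewrite (ipC _ _ f (f_ n)); ring.
Unshelve. all: by end_near. Qed.

End weak_convergence.

(** * Transfer of weak convergence *)

Section weak_transfer.
Context {d : measure_display} {T : measurableType d} {R : realType}.
Variables (P : probability T R) (B : R -> {RV P >-> R}) (xi : {RV P >-> R}).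
Variable xi_ : nat -> nat -> {RV P >-> R}.
Hypothesis hW : walk_approximation B xi xi_.
Hypothesis hF : d.-measurable = completion P (brownian_sigma_algebra B).
Local Notation tm := (time_measure P).
Local Notation ts := (@time_space d T R).
Local Notation mts := (@measurable_time_space d T R).
Local Notation sq := (sqint P setT).
Local Notation tsq := (sqint tm ts).
Local Notation tnrm := (L2norm tm ts).
Local Notation tip := (L2inner tm ts).
Local Notation ip := (L2inner P setT).
Local Notation nrm := (L2norm P setT).
Local Notation mT := measurableT.
Local Notation limit_pair := (limit_pair xi_).
Local Notation wick_limit := (wick_limit B).
Implicit Types (l : seq (R * R)) (s t phi : R).

Lemma times_within_bound l : (forall p, p \in l -> 0 <= p.2) ->
  forall t, 0 <= t -> exists T0, [/\ 0 <= T0, t <= T0 & times_within T0 l].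
Proof.
move=> l0 t t0; elim: l l0 => [|p l IH] l0; first by exists t.
have [|T0 [T00 tT lT]] := IH; first by move=> q ql; apply: l0; rewrite inE ql orbT.
have p0 : 0 <= p.2 by apply: l0; exact: mem_head.
exists (T0 + p.2); split; rewrite ?addr_ge0//.
  by apply: le_trans tT _; rewrite lerDl.
rewrite /times_within /= p0 lerDr T00 /=; apply/allP => q ql.
by have [-> h] := times_withinP lT ql; apply: le_trans h _; rewrite lerDl.
Qed.

Variables (Z_ : nat -> nat -> T -> R) (X_ : nat -> T -> R).
Hypothesis pX : forall n, (1 <= n)%N -> walk_pair n (xi_ n) (Z_ n) (X_ n).
Variables (Z : T * measurableTypeR R -> R) (I : T -> R).
Hypothesis pZI : limit_pair Z I.

Let sX n : (1 <= n)%N -> sq (X_ n).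
Proof. by move=> n1; case: (walk_pair_sq hW n1 (pX n1)). Qed.

Let sZ n : (1 <= n)%N -> tsq (ceil_process n (Z_ n)).
Proof. by move=> n1; case: (walk_pair_sq hW n1 (pX n1)). Qed.

Let sI : sq I. Proof. by case: pZI. Qed.

Let sZ' : tsq Z. Proof. by case: pZI. Qed.

Local Notation tests_X := (tests P setT X_ I).
Local Notation tests_Z := (tests tm ts (fun n => ceil_process n (Z_ n)) Z).

Lemma cos_of_wick_limit phi l :
  (fun w => cos (phi + theta B l w)) =
  (fun w => expR (- (energy_form l / 2)) * wick_limit phi l w).
Proof. by apply/funext => w; rewrite /wick_limit mulrA -expRD addNr expR0 mul1r. Qed.

(** Constants and second components of limit pairs are tests; by [wick_limit_approx]
    so are the Wick limits, hence the cosines, hence everything by density. *)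
Lemma weak_walk_of_ceil : L2_weak_cvg tm ts (fun n => ceil_process n (Z_ n)) Z ->
  L2_weak_cvg P setT X_ I.
Proof.
move=> W; have [C HC] := L2_weak_cvg_bounded mts sZ W.
have XC n : (1 <= n)%N -> nrm (X_ n) <= C.
  by move=> n1; case: (walk_pair_sq hW n1 (pX n1)) => _ _ <-; exact: HC.
have {}W := (@weak_cvgP _ _ _ tm ts mts (fun n => ceil_process n (Z_ n)) Z).1 W.
have tG H G : limit_pair H G -> tests_X G.
  move=> pHG; have [sH sG _] := pHG; split=> //.
  have c1 := limit_pair_transfer hW pX XC pHG.
  have [_ c2] := W H sH.
  rewrite -(limit_pair_ip hW pZI pHG) -[X in _ --> X]add0r.
  rewrite (_ : (fun n => _) = (fun n => (ip (X_ n) G - tip (ceil_process n (Z_ n)) H) +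
    tip (ceil_process n (Z_ n)) H)); first exact: cvgD.
  by apply/funext => n; rewrite subrK.
have t1 c : tests_X (fun=> c).
  rewrite (_ : (fun=> c) = (fun=> c * 1)); last by apply/funext => w; rewrite mulr1.
  apply: (testsZ mT sX sI); split; first exact: sqint_cst.
  rewrite ip_cst1 (limit_pair_mean hW pZI); apply: cvg_near_cst; near=> n.
  have n1 : (1 <= n)%N by near: n; exact: nbhs_infty_ge.
  by rewrite ip_cst1 (walk_pair_mean (walk_standard hW n1) (pX n1)).
have tM phi l : (forall p, p \in l -> 0 <= p.2) -> tests_X (wick_limit phi l).
  move=> l0; have [T0 [T00 _ lT]] := times_within_bound l0 (lexx 0).
  apply: (tests_closed mT sX sI XC) => [|e e0]; first exact/bm_sqint/bm_wick_limit.
  have [H [G [pHG h]]] := wick_limit_approx hW phi lT T00 e0.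
  exists ((fun=> cos phi) + G); last exact: h.
  by apply: (testsD mT sX sI) => //; exact: (tG H).
apply/(@weak_cvgP _ _ _ P setT mT) => g sg.
have bt f : bounded_measurable f -> tests_X f.
  move=> bf; apply: (@brownian_density _ _ _ P B hF `[0, +oo[%classic tests_X f) => //.
  - move=> _ [phi [l [lT ->]]]; rewrite cos_of_wick_limit; apply: (testsZ mT sX sI).
    by apply: tM => p /lT /=; rewrite in_itv/= andbT.
  - exact: (testsD mT sX sI).
  - exact: (testsZ mT sX sI).
  - move=> h_ h M th mh_ hM bh ch.
    apply: (tests_closed mT sX sI XC) => [|e e0]; first exact: bm_sqint.
    have c := bounded_cvg_nrm mh_ hM bh.1 ch.
    have [n hn] := filter_ex (near_small e0 (fun n => nrm_ge0 _ _ _) c).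
    by exists (h_ n); [exact: th|rewrite nrm_distC].
  - by apply: measurable_brownian_times => //; case: bf.
apply: (tests_closed mT sX sI XC) => // e e0.
have [n hn] := filter_ex (near_small e0 (fun n => nrm_ge0 _ _ _) (cvg_clip_nrm sg)).
exists (fun w => clip n%:R (g w)); last by rewrite nrm_distC.
by apply: bt; apply: clip_bm => //; case: sg.
Unshelve. all: by end_near. Qed.

(** Evaluated at the approximants of (Z, I), with their error sent to 0. *)
Lemma limit_pair_bound (Q : T * measurableTypeR R -> R) (e : R) : tsq Q -> 0 <= e ->
  (\forall n \near \oo, forall Y X, walk_pair n (xi_ n) Y X ->
     `|tip (ceil_process n Y) Q| <= nrm X * e) -> `|tip Z Q| <= nrm I * e.
Proof.
move=> sQ e0 h; apply/ler_addgt0Pr => del d0.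
have [_ _ a] := pZI.
have c0 : 0 < e + tnrm Q + 1 by rewrite ltr_wpDl// addr_ge0// nrm_ge0.
have d1 : 0 < del / (e + tnrm Q + 1) by rewrite divr_gt0.
have [Y_ [W_ hY]] := a _ d1.
have [n [[h1 [pY k1 k2]] n1]] := filter_ex (filterI (filterI h hY) (nbhs_infty_ge 1)).
have [sY sW nYW] := walk_pair_sq hW n1 pY.
have b1 := h1 _ _ pY.
have b2 := ip_le mts (sqintB mts sY sZ') sQ.
rewrite (ipBl mts sY sZ' sQ) in b2.
have b3 : nrm (W_ n) <= nrm I + del / (e + tnrm Q + 1).
  have := nrm_lip mT sW sI; have := ler_norm (nrm (W_ n) - nrm I); lra.
have b4 : `|tip Z Q| <= `|tip (ceil_process n (Y_ n)) Q| + `|tip (ceil_process n (Y_ n)) Q - tip Z Q|.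
  have h2 := ler_normB (tip (ceil_process n (Y_ n)) Q) (tip (ceil_process n (Y_ n)) Q - tip Z Q).
  by rewrite subKr in h2.
have Q0 := nrm_ge0 tm ts Q.
have b5 : nrm (W_ n) * e <= (nrm I + del / (e + tnrm Q + 1)) * e by exact: ler_wpM2r.
have b6 : tnrm (ceil_process n (Y_ n) - Z) * tnrm Q <= del / (e + tnrm Q + 1) * tnrm Q.
  exact: ler_wpM2r.
have b7 : del / (e + tnrm Q + 1) * (e + tnrm Q) <= del.
  rewrite mulrAC ler_pdivrMr// ler_pM2l//; lra.
move: b7 b5 b6; rewrite mulrDr mulrDl; lra.
Qed.

(** First components of limit pairs are tests; by [wick_tensor_approx] so are the
    products of Wick limits with 1_(]0, t]), then those of all bounded variables. *)
Lemma weak_tensor a t : L2_weak_cvg P setT X_ I -> 0 <= t -> bounded_measurable a ->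
  tests_Z (tensor a `]0, t]).
Proof.
move=> W t0; have [C XC] := L2_weak_cvg_bounded mT sX W.
have ZC n : (1 <= n)%N -> tnrm (ceil_process n (Z_ n)) <= C.
  by move=> n1; case: (walk_pair_sq hW n1 (pX n1)) => _ _ ->; exact: XC.
have C0 : 0 <= C by apply: le_trans (nrm_ge0 _ _ _) (XC 1%N isT).
have {}W := (@weak_cvgP _ _ _ P setT mT X_ I).1 W.
have tH H G : limit_pair H G -> tests_Z H.
  move=> pHG; have [sH sG _] := pHG; split=> //.
  have c1 := limit_pair_transfer hW pX XC pHG.
  have [_ c2] := W G sG.
  rewrite (limit_pair_ip hW pZI pHG) -[X in _ --> X]subr0.
  rewrite (_ : (fun n => _) = (fun n => ip (X_ n) G -
    (ip (X_ n) G - tip (ceil_process n (Z_ n)) H))); first exact: cvgB.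
  by apply/funext => n; rewrite subKr.
have tM phi l : (forall p, p \in l -> 0 <= p.2) -> tests_Z (tensor (wick_limit phi l) `]0, t]).
  move=> l0; have [T0 [T00 tT lT]] := times_within_bound l0 t0.
  have sQ : tsq (tensor (wick_limit phi l) `]0, t]).
    by apply: (sqint_tensor_itv _ (lexx 0) t0).1; exact/bm_sqint/bm_wick_limit.
  apply: (tests_approx mts sZ sZ') => // e e0.
  have I0 := nrm_ge0 P setT I.
  have c0 : 0 < C + nrm I + 1 by rewrite ltr_wpDl// addr_ge0.
  have ec : 0 < e / (C + nrm I + 1) by rewrite divr_gt0.
  have bd x : 0 <= x -> x <= C + nrm I + 1 -> x * (e / (C + nrm I + 1)) <= e.
    by move=> x0 xc; rewrite mulrA ler_pdivrMr// mulrC ler_wpM2l// ltW.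
  have [H [G [pHG h]]] := wick_tensor_approx hW phi lT t0 tT ec.
  have [sH _ _] := pHG.
  exists H; split; first exact: (tH H G).
    near=> n; have n1 : (1 <= n)%N by near: n; exact: nbhs_infty_ge.
    have k : forall Y X, walk_pair n (xi_ n) Y X ->
      `|tip (ceil_process n Y) (tensor (wick_limit phi l) `]0, t] - H)| <=
      nrm X * (e / (C + nrm I + 1)) by near: n; exact: h.
    apply: le_trans (k _ _ (pX n1)) _; apply: bd; first exact: nrm_ge0.
    by apply: le_trans (XC n n1) _; rewrite -addrA lerDl addr_ge0.
  apply: le_trans (limit_pair_bound (sqintB mts sQ sH) (ltW ec) h) _.
  by apply: bd => //; rewrite addrAC lerDr addr_ge0.
move=> ba; apply: (@brownian_density _ _ _ P B hF `[0, +oo[%classic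
  (fun a => tests_Z (tensor a `]0, t]))) => //.
- move=> _ [phi [l [lT ->]]]; rewrite cos_of_wick_limit tensorZ; apply: (testsZ mts sZ sZ').
  by apply: tM => p /lT /=; rewrite in_itv/= andbT.
- by move=> f g tf tg; rewrite tensorD; exact: (testsD mts sZ sZ').
- by move=> c f tf; rewrite tensorZ; exact: (testsZ mts sZ sZ').
- move=> h_ h M th mh_ hM bh ch.
  have sh := bm_sqint P bh.
  have sh_ n : sq (h_ n) by apply: bm_sqint; split=> //; exists M.
  apply: (tests_closed mts sZ sZ' ZC) => [|e e0].
    exact: (sqint_tensor_itv sh (lexx 0) t0).1.
  have c := bounded_cvg_nrm mh_ hM bh.1 ch.
  have c1 : 0 < t + 1 by rewrite ltr_wpDl.
  have e1 : 0 < e / (t + 1) by rewrite divr_gt0.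
  have [n hn] := filter_ex (near_small e1 (fun n => nrm_ge0 _ _ _) c).
  exists (tensor (h_ n) `]0, t]); first exact: th.
  have E : tnrm (tensor h `]0, t] - tensor (h_ n) `]0, t]) ^+ 2 = nrm (h - h_ n) ^+ 2 * (t - 0).
    by rewrite -tensorB; exact: (sqint_tensor_itv (sqintB mT sh (sh_ n)) (lexx 0) t0).2.
  rewrite -ler_sqr ?nnegrE ?nrm_ge0 ?(ltW e0)// E subr0.
  rewrite nrm_distC in hn.
  have n0 := nrm_ge0 P setT (h - h_ n).
  have h2 : nrm (h - h_ n) * (t + 1) <= e by rewrite -ler_pdivlMr.
  apply: (@le_trans _ _ ((nrm (h - h_ n) * (t + 1)) ^+ 2)); last first.
    by rewrite ler_sqr ?nnegrE ?mulr_ge0 ?(ltW e0)// ltW.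
  by rewrite exprMn; apply: ler_wpM2l; [exact: sqr_ge0|nra].
- by apply: measurable_brownian_times => //; case: ba.
Unshelve. all: by end_near. Qed.

End weak_transfer.

(** * Density of rectangles in time and chance *)

Section product_density.
Context {d : measure_display} {T : measurableType d} {R : realType}.
Variable P : probability T R.
Local Notation TR := (T * measurableTypeR R)%type.
Local Notation tm := (time_measure P).
Local Notation ts := (@time_space d T R).
Local Notation mts := (@measurable_time_space d T R).
Local Notation sq := (sqint P setT).
Local Notation tsq := (sqint tm ts).
Local Notation tnrm := (L2norm tm ts).
Local Notation ray r := (`]-oo, r]%classic : set R).
Implicit Types (a : T -> R) (r : R).

(** On nonnegative times the two intervals differ by the null set of time 0 only. *)
Lemma tensor_ray a r : sq a -> tsq (tensor a (ray r)) /\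
  tnrm (tensor a (ray r) - tensor a `]0, Num.max r 0]) = 0.
Proof.
move=> sa; have [ma _] := sa.
have m0 : 0 <= Num.max r 0 by rewrite le_max lexx orbT.
have s1 := (sqint_tensor_itv sa (lexx 0) m0).1.
have [s0 n0] : tsq (tensor a [set 0]) /\ tnrm (tensor a [set 0]) ^+ 2 = L2norm P setT a ^+ 2 * 0.
  apply: sqint_tensor => //; last exact: lebesgue_measure_set1.
  by move=> _ ->; rewrite /= in_itv/= lexx.
have [sd nd] : tsq (tensor a (ray r) - tensor a `]0, Num.max r 0]) /\
    tnrm (tensor a (ray r) - tensor a `]0, Num.max r 0]) <= tnrm (tensor a [set 0]).
  apply: (sqint_le mts _ s0).
    by apply: measurable_funTS; apply: measurable_funB; exact: measurable_tensor.
  move=> x /ts_pos x0; rewrite -[(_ - _) x]/(tensor a (ray r) x - tensor a `]0, Num.max r 0] x).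
  rewrite /tensor -mulrBr !normrM ler_wpM2l// !indicE.
  have -> : (x.2 \in ray r) = (x.2 <= r) by apply/idP/idP; rewrite inE /= in_itv.
  have -> : (x.2 \in `]0, Num.max r 0]%classic) = (0 < x.2 <= Num.max r 0).
    by apply/idP/idP; rewrite inE /= in_itv.
  have -> : (x.2 \in [set (0 : R)]) = (x.2 == 0).
    by apply/idP/idP => [/set_mem /= ->|/eqP ->]//; rewrite inE.
  rewrite le_max; have [x00|x0'] := eqVneq x.2 0.
    by rewrite x00 ltxx /= subr0 normr1; case: (0 <= r); rewrite ?normr1 ?normr0.
  have xp : 0 < x.2 by rewrite lt_neqAle eq_sym x0'.
  rewrite xp /= [x.2 <= 0]leNgt xp orbF subrr normr0 //.
split.
  rewrite -[tensor a (ray r)](subrK (tensor a `]0, Num.max r 0])); exact: (sqintD mts sd s1).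
apply/eqP; rewrite eq_le nrm_ge0 andbT; apply: le_trans nd _.
by move/eqP : n0; rewrite mulr0 sqrf_eq0 => /eqP ->.
Qed.

(** Rays unbounded on the left, and the whole line, are stable under intersection
    and contain the constant function 1. *)
Definition rectangle_class (k : TR -> R) : Prop :=
  exists A (J : set R), [/\ measurable A, J = setT \/ exists r, J = ray r &
    k = tensor \1_A J].

Lemma rectangle_class_bm k : rectangle_class k -> bounded_measurable k.
Proof.
move=> [A [J [mA HJ ->]]]; have mJ : measurable J by case: HJ => [->|[r ->]].
split; first by apply: measurable_tensor => //; exact: measurable_indic.
exists 1 => x; rewrite /tensor !indicE.
by case: (_ \in A); case: (_ \in J); rewrite ?mulr1 ?mulr0 ?normr1 ?normr0.
Qed.

Lemma rectangle_classM k k' : rectangle_class k -> rectangle_class k' -> exists (u v : R) k1 k2,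
  [/\ rectangle_class k1, rectangle_class k2 & forall x, k x * k' x = u * k1 x + v * k2 x].
Proof.
move=> [A [J [mA HJ ->]]] [A' [J' [mA' HJ' ->]]].
exists 1, 0, (tensor \1_(A `&` A') (J `&` J')), (tensor \1_(A `&` A') (J `&` J')).
have H : rectangle_class (tensor \1_(A `&` A') (J `&` J')).
  exists (A `&` A'), (J `&` J'); split=> //; first exact: measurableI.
  case: HJ HJ' => [->|[r ->]] [->|[r' ->]]; first by left; rewrite setTI.
  - by right; exists r'; rewrite setTI.
  - by right; exists r; rewrite setIT.
  - right; exists (Num.min r r'); apply/seteqP; split=> x /=; rewrite !in_itv/= le_min.
      by move=> [-> ->].
    by move/andP.
split=> // x; rewrite mul0r addr0 mul1r /tensor !indicI /=; ring.
Qed.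

Definition rectangle_generators : set (set TR) :=
  [set E | exists k A, [/\ rectangle_class k, measurable A & E = k @^-1` A]].

Lemma rectangle_generators_measurable :
  (@measurable _ TR) `<=` <<s rectangle_generators >>.
Proof.
pose S := g_sigma_algebraType rectangle_generators.
have gen A (J : set R) : measurable A -> J = setT \/ (exists r, J = ray r) ->
    @measurable _ S (A `*` J).
  move=> mA HJ; apply: sub_sigma_algebra; exists (tensor \1_A J), [set 1]; split=> //.
    by exists A, J.
  apply/seteqP; split=> x /=.
    by move=> [xA xJ]; rewrite /tensor !indicE !mem_set// mulr1.
  rewrite /tensor !indicE; case: (boolP (x.1 \in A)) => [/set_mem xA|_].
    case: (boolP (x.2 \in J)) => [/set_mem xJ|_] //.
    by rewrite mulr0 => /esym/eqP; rewrite oner_eq0.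
  by rewrite mul0r => /esym/eqP; rewrite oner_eq0.
rewrite measurable_prod_measurableType; apply: smallest_sub; first exact: smallest_sigma_algebra.
move=> _ [A mA [C mC <-]].
have -> : A `*` C = (A `*` setT) `&` (setT `*` C).
  by rewrite -setXI setIT setTI.
apply: (@measurableI _ S); first by apply: gen => //; left.
suff : @measurable_fun _ _ S (measurableTypeR R) setT snd.
  by move=> /(_ measurableT _ mC); rewrite setTI setTX.
apply: (@measurability _ _ S (measurableTypeR R) setT snd (@ocitv R)) => //.
move=> _ [_ [[u v] _ <-] <-].
have -> : setT `&` snd @^-1` `]u, v]%classic =
    ((setT : set T) `*` ray v) `\` ((setT : set T) `*` ray u).
  apply/seteqP; split=> x /=; rewrite !in_itv/=.
    move=> [_ /andP[h1 h2]]; split=> // -[_]; rewrite leNgt h1 //.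
  move=> [[_ h1] h2]; split=> //; rewrite h1 andbT ltNge; apply/negP => h3.
  by apply: h2.
by apply: (@measurableD _ S); apply: gen => //; right; eexists.
Qed.

Variables (f_ : nat -> TR -> R) (f : TR -> R) (C : R).
Hypothesis sf_ : forall n, (1 <= n)%N -> tsq (f_ n).
Hypothesis sf : tsq f.
Hypothesis fC : forall n, (1 <= n)%N -> tnrm (f_ n) <= C.
Local Notation tests := (tests tm ts f_ f).
Hypothesis tensor_tests : forall a t, 0 <= t -> bounded_measurable a -> tests (tensor a `]0, t]).

Lemma tests_ray a r : bounded_measurable a -> tests (tensor a (ray r)).
Proof.
move=> ba; have [s n0] := tensor_ray r (bm_sqint P ba).
apply: (tests_closed mts sf_ sf fC s) => e e0.
exists (tensor a `]0, Num.max r 0]); last by rewrite n0 ltW.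
by apply: tensor_tests => //; rewrite le_max lexx orbT.
Qed.

(** The indicator of times up to N makes bounded functions square-integrable, so
    that the monotone class argument runs on a space of infinite measure. *)
Lemma bounded_tests (N : R) (h : TR -> R) : bounded_measurable h ->
  tests (fun x => h x * \1_(ray N) x.2).
Proof.
move=> bh.
apply: (@functional_monotone_class _ _ R tm rectangle_class
  (fun h => tests (fun x => h x * \1_(ray N) x.2)) _ _ _ _ _ _ _ rectangle_generators) => //.
- exact: rectangle_class_bm.
- exists setT, setT; split=> //; first by left.
  by apply/funext => x; rewrite /tensor !indicT mulr1.
- exact: rectangle_classM.
- move=> _ [A [J [mA HJ ->]]].
  have bA : bounded_measurable (\1_A : T -> R) by exact: bm_indic.
  have [r E] : exists r, J `&` ray N = ray r.
    case: HJ => [->|[r ->]]; first by exists N; rewrite setTI.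
    exists (Num.min r N); apply/seteqP; split=> x /=; rewrite !in_itv/= le_min.
      by move=> [-> ->].
    by move/andP.
  rewrite (_ : (fun x => _) = tensor \1_A (ray r)); first exact: tests_ray.
  by apply/funext => x; rewrite /tensor -E indicI mulrA.
- move=> g k tg tk; rewrite (_ : (fun x => _) = (fun x => g x * \1_(ray N) x.2) +
    (fun x => k x * \1_(ray N) x.2)); first exact: (testsD mts sf_ sf).
  by apply/funext => x; rewrite [LHS]mulrDl.
- move=> c g tg; rewrite (_ : (fun x => _) = (fun x => c * (g x * \1_(ray N) x.2))).
    exact: (testsZ mts sf_ sf).
  by apply/funext => x; rewrite mulrA.
- move=> g_ g M tg mg_ gM bg cg.
  have M0 : 0 <= M by apply: le_trans (normr_ge0 _) (gM 0%N (point : TR)).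
  have sM : tsq (tensor (fun=> M) (ray N)) by apply: (tensor_ray N _).1; exact: sqint_cst.
  have mr : measurable_fun setT (fun x : TR => \1_(ray N) x.2 : R).
    by exact: measurableT_comp (measurable_indic _) measurable_snd.
  have [sg cg'] : tsq (fun x => g x * \1_(ray N) x.2) /\
      tnrm ((fun x => g_ n x * \1_(ray N) x.2) - (fun x => g x * \1_(ray N) x.2)) @[n --> \oo] --> 0.
    apply: (sqint_dominated mts (g := tensor (fun=> M) (ray N))) => //.
    + by move=> n; apply: measurable_funTS; exact: measurable_funM.
    + by apply: measurable_funTS; apply: measurable_funM => //; case: bg.
    + by apply: filterS cg => x cx _; apply: cvgM => //; exact: cvg_cst.
    + apply: aeW => x n _; rewrite /tensor normrM.
      by apply: ler_pM => //; rewrite ger0_norm.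
  apply: (tests_closed mts sf_ sf fC sg) => e e0.
  have [n hn] := filter_ex (near_small e0 (fun n => nrm_ge0 _ _ _) cg').
  by exists (fun x => g_ n x * \1_(ray N) x.2); [exact: tg|rewrite nrm_distC].
- by move=> E gE; left.
- by move=> _ A mA; apply: rectangle_generators_measurable; apply: (bh.1 measurableT).
Qed.

(** Truncation in value and in time reduces to [bounded_tests]. *)
Lemma tensor_tests_weak : L2_weak_cvg tm ts f_ f.
Proof.
apply/(@weak_cvgP _ _ _ tm ts mts) => // h sh.
pose h0 : TR -> R := h \_ ts.
have mh0 : measurable_fun setT h0 by apply/(measurable_restrictT _ mts); case: sh.
pose k n x : R := clip n%:R (h0 x) * \1_(ray n%:R) x.2.
have tk n : tests (k n).
  apply: bounded_tests; split; last by exists n%:R => x; exact: clip_le.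
  by apply: measurableT_comp => //; exact: measurable_clip.
have [_ ck] : tsq h /\ tnrm (k n - h) @[n --> \oo] --> 0.
  apply: (sqint_dominated mts _ _ (sqint_norm mts sh)).
  - by move=> n; case: (tk n) => -[].
  - by case: sh.
  - apply: aeW => x xts; apply: cvg_near_cst; near=> n.
    have h1 : `|h x| <= n%:R by near: n; exact: nbhs_infty_ger.
    have h2 : x.2 <= n%:R by near: n; exact: nbhs_infty_ger.
    rewrite /k /h0 patchE mem_set// clip_id// indicE (_ : (x.2 \in _) = true) ?mulr1//.
    by apply/mem_set; rewrite /= ?in_itv/= ?h2.
  - apply: aeW => x n xts; rewrite /k /h0 patchE mem_set// normrM.
    apply: (@le_trans _ _ (`|clip n%:R (h x)| * 1)); last by rewrite mulr1 clip_le_id.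
    by rewrite ler_wpM2l// indicE; case: (_ \in _); rewrite ?normr1 ?normr0.
apply: (tests_closed mts sf_ sf fC sh) => e e0.
have [n hn] := filter_ex (near_small e0 (fun n => nrm_ge0 _ _ _) ck).
by exists (k n); [exact: tk|rewrite nrm_distC].
Unshelve. all: by end_near. Qed.

End product_density.

(** * The equivalence *)

Theorem theorem21 (d : measure_display) (T : measurableType d) (R : realType)
  (P : probability T R)
  (B : R -> {RV P >-> R})
  (hB : brownian_motion B)
  (hF : d.-measurable = completion P (brownian_sigma_algebra B))
  (xi : {RV P >-> R})
  (xi_L2 : (xi : T -> R) \in Lfun P 2%:E)
  (xi_mean : ('E_P[xi] = 0)%E)
  (xi_var : ('V_P[xi] = 1)%E)
  (xi_ : nat -> nat -> {RV P >-> R})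
  (xi_indep : forall n, (1 <= n)%N ->
     mutually_independent P (fun i => xi_ n i.+1 : T -> R))
  (xi_distr : forall n i, (1 <= n)%N -> (1 <= i)%N ->
     same_distribution (xi_ n i) xi)
  (walk_cvg : forall t : R, 0 <= t ->
     cvg_in_probability P (fun n => random_walk n (xi_ n) t) (B t))
  (Z : T * measurableTypeR R -> R)
  (Z_L2 : in_L2 (time_measure P) (@time_space d T R) Z)
  (Z_pred : predictable B Z)
  (Z_ : nat -> nat -> T -> R)
  (Zn_L2 : forall n, (1 <= n)%N -> in_discrete_L2 n (xi_ n) (Z_ n))
  (Zn_pred : forall n, (1 <= n)%N -> discrete_predictable (xi_ n) (Z_ n))
  (* arbitrary versions of the continuous and discrete Ito integrals *)
  (I : T -> R)
  (hI : ito_integral B Z I)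
  (I_ : nat -> T -> R)
  (hI_ : forall n, (1 <= n)%N ->
     discrete_ito_integral n (xi_ n) (Z_ n) (I_ n)) :
  (L2_cvg (time_measure P) (@time_space d T R)
      (fun n => ceil_process n (Z_ n)) Z
    <-> L2_cvg P setT I_ I) /\
  (L2_weak_cvg (time_measure P) (@time_space d T R)
      (fun n => ceil_process n (Z_ n)) Z
    <-> L2_weak_cvg P setT I_ I).
Proof.
have hW : walk_approximation B xi xi_ by split.
have pX n : (1 <= n)%N -> walk_pair n (xi_ n) (Z_ n) (I_ n).
  move=> n1; apply: (discrete_ito_walk_pair (walk_standard hW n1)).
  - exact: (Zn_L2 n n1).
  - exact: (Zn_pred n n1).
  - exact: (hI_ n n1).
have pZI := ito_limit_pair hW hF Z_L2 hI.
have mts := @measurable_time_space d T R.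
have [sZ sI _] := pZI.
have sI_ n : (1 <= n)%N -> sqint P setT (I_ n).
  by move=> n1; case: (walk_pair_sq hW n1 (pX n n1)).
have sZ_ n : (1 <= n)%N -> sqint (time_measure P) (@time_space d T R) (ceil_process n (Z_ n)).
  by move=> n1; case: (walk_pair_sq hW n1 (pX n n1)).
have isometry : \forall n \near \oo, L2norm (time_measure P) (@time_space d T R)
    (ceil_process n (Z_ n)) = L2norm P setT (I_ n).
  by exists 1%N => // n /= n1; case: (walk_pair_sq hW n1 (pX n n1)).
have weak : L2_weak_cvg (time_measure P) (@time_space d T R)
    (fun n => ceil_process n (Z_ n)) Z <-> L2_weak_cvg P setT I_ I.
  split; first exact: (weak_walk_of_ceil hW hF pX pZI).
  move=> W; have [C IC] := L2_weak_cvg_bounded measurableT sI_ W.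
  apply: (tensor_tests_weak (C := C) sZ_ sZ) => [n n1|a t t0 ba].
    by have [_ _ ->] := walk_pair_sq hW n1 (pX n n1); exact: IC.
  exact: (weak_tensor hW hF pX pZI W t0 ba).
split; last exact: weak.
rewrite (L2_cvgP mts sZ_ sZ) (L2_cvgP measurableT sI_ sI).
rewrite (strong_weakP mts sZ_ sZ) (strong_weakP measurableT sI_ sI).
have nE : L2norm (time_measure P) (@time_space d T R) (ceil_process n (Z_ n)) @[n --> \oo] -->
      L2norm (time_measure P) (@time_space d T R) Z <->
    L2norm P setT (I_ n) @[n --> \oo] --> L2norm P setT I.
  rewrite -(limit_pair_nrm hW pZI); split; apply: cvg_trans; apply: near_eq_cvg;
    by apply: filterS isometry => n ->.
by split=> -[w c]; split; [exact/weak|exact/nE|exact/weak|exact/nE].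
Qed.
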